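(* Let $z_0=(x_0,y_0)=(\cos\theta_0,\cos\gamma_0)\in\,]-1,1[\,\times\,]-1,1[$ with $\theta_0,\gamma_0\in\,]0,\pi[$, and let $h:[-1,1]\times[-1,1]\to\mathbb{R}$ be defined by $h(x,y)=1$ if $(x,y)\in[x_0,1]\times[y_0,1]$ and $h(x,y)=0$ otherwise. Let $L_{n,m}$ be the bivariate Lagrange operators on the Chebyshev nodes of the second kind plus endpoints, and let $g$, $G$ and the index of convergence $i(\cdot\,;\cdot)$ be as defined in the context. Then the double sequence $(L_{n,m}h)_{n,m}$ converges uniformly to $h$ (as $n,m\to\infty$) on every compact subset of $([-1,1]\times[-1,1])\setminus Q$, where $Q:=([x_0,1]\times\{y_0\})\cup(\{x_0\}\times[y_0,1])$. As regards the behaviour of $(L_{n,m}h(x,y))_{n,m}$ for $(x,y)\in Q$, the following hold. 1) Let $x=x_0$ and $y\in\,]y_0,1]$. i) If $\frac{\theta_0}{\pi}=\frac{p_1}{q_1}$ with $p_1,q_1\in\mathbb{N}$, $q_1\neq0$, $\gcd(p_1,q_1)=1$, then $$i\left(L_{n,m}h(x_0,y);g\left(\tfrac{m_1}{q_1}\right)\right)=\frac1{q_1},\qquad m_1=0,\dots,q_1-1.$$ ii) If $\frac{\theta_0}{\pi}$ is irrational, then $i(L_{n,m}h(x_0,y);A)=|g^{-1}(A)|$ for every Peano-Jordan measurable set $A\subset\mathbb{R}$. 2) Let $x\in\,]x_0,1]$ and $y=y_0$. i) If $\frac{\gamma_0}{\pi}=\frac{p_2}{q_2}$ with $p_2,q_2\in\mathbb{N}$,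 $q_2\neq0$, $\gcd(p_2,q_2)=1$, then $$i\left(L_{n,m}h(x,y_0);g\left(\tfrac{m_2}{q_2}\right)\right)=\frac1{q_2},\qquad m_2=0,\dots,q_2-1.$$ ii) If $\frac{\gamma_0}{\pi}$ is irrational, then $i(L_{n,m}h(x,y_0);A)=|g^{-1}(A)|$ for every Peano-Jordan measurable set $A\subset\mathbb{R}$. 3) Let $x=x_0$ and $y=y_0$. i) If $\frac{\theta_0}{\pi}=\frac{p_1}{q_1}$ and $\frac{\gamma_0}{\pi}=\frac{p_2}{q_2}$ with $p_i,q_i\in\mathbb{N}$, $q_i\neq0$, $\gcd(p_i,q_i)=1$, $i=1,2$, then $$i\left(L_{n,m}h(x_0,y_0);g\left(\tfrac{m_1}{q_1}\right)g\left(\tfrac{m_2}{q_2}\right)\right)=\frac1{q_1q_2}$$ for $m_1=0,\dots,q_1-1$ and $m_2=0,\dots,q_2-1$. ii) If $\frac{\theta_0}{\pi}=\frac{p_1}{q_1}$ with $p_1,q_1\in\mathbb{N}$, $q_1\neq0$, $\gcd(p_1,q_1)=1$, and $\frac{\gamma_0}{\pi}$ is irrational, then $$i\left(L_{n,m}h(x_0,y_0);\left[0,g\left(\tfrac{j}{q_1}\right)\right]\right)\ge\frac1{q_1},\qquad j=0,\dots,q_1-1.$$ iii) If $\frac{\theta_0}{\pi}$ is irrational and $\frac{\gamma_0}{\pi}=\frac{p_2}{q_2}$ with $p_2,q_2\in\mathbb{N}$, $q_2\neq0$, $\gcd(p_2,q_2)=1$, then $$i\left(L_{n,m}h(x_0,y_0);\left[0,g\left(\tfrac{j}{q_2}\right)\right]\right)\ge\frac1{q_2},\qquad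 j=0,\dots,q_2-1.$$ iv) If $\frac{\theta_0}{\pi}$ and $\frac{\gamma_0}{\pi}$ are both irrational, then $i(L_{n,m}h(x_0,y_0);A)=|G^{-1}(A)|$ for every Peano-Jordan measurable set $A\subset\mathbb{R}$.
   Context: Density and index of convergence. $\mathbb{N}=\{1,2,\dots\}$. For $K\subset\mathbb{N}^2$ put $\delta_-(K):=\liminf_{n\to\infty}\frac{|K\cap\{1,\dots,n\}^2|}{n^2}$ and $\delta_+(K):=\limsup_{n\to\infty}\frac{|K\cap\{1,\dots,n\}^2|}{n^2}$. For a double sequence $(x_{n,m})$ of real numbers and $L\in\mathbb{R}$, $$i(x_{n,m};L):=1-\sup_{\varepsilon>0}\delta_+(\{(n,m): x_{n,m}\notin\,]L-\varepsilon,L+\varepsilon[\})=\inf_{\varepsilon>0}\delta_-(\{(n,m): x_{n,m}\in\,]L-\varepsilon,L+\varepsilon[\}),$$ and for $A\subset\mathbb{R}$, with $B_\varepsilon:=\,]-\varepsilon,\varepsilon[$, $$i(x_{n,m};A):=1-\sup_{\varepsilon>0}\delta_+(\{(n,m): x_{n,m}\notin A+B_\varepsilon\})=\inf_{\varepsilon>0}\delta_-(\{(n,m): x_{n,m}\in A+B_\varepsilon\}).$$ (Finitely many values of $n$ or of $m$ do not affect the index.) Operators. For $n\ge2$ let $x_{n,i}=y_{n,i}=\cos\frac{i-1}{n-1}\pi$, $i=1,\dots,n$, and let $\omega_{n,i}$ be the corresponding fundamental Lagrange polynomials; for $x=\cos\theta$, $$\omega_{n,i}(x)=\frac{(-1)^i}{(1+\delta_{i,1}+\delta_{i,n})(n-1)}\,\frac{\sin\theta\,\sin((n-1)\theta)}{x-x_{n,i}}$$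 (extended by continuity at $x=x_{n,i}$), where $\delta_{i,j}$ is the Kronecker symbol. For $f:[-1,1]^2\to\mathbb{R}$, $$L_{n,m}f(x,y)=\sum_{i=1}^n\sum_{j=1}^m\omega_{n,i}(x)\,\omega_{m,j}(y)\,f(x_{n,i},y_{m,j}).$$ Limit functions. $g:\,]0,1[\,\to\mathbb{R}$ is $g(x):=\frac{\sin(\pi x)}{\pi}\sum_{k=0}^{\infty}\frac{(-1)^k}{k+x}$, with the convention $g(0):=1$ when the value $g(0)$ appears; the preimage $g^{-1}(A)$ is taken in $]0,1[$. $G:\,]0,1[\,\times\,]0,1[\,\to\mathbb{R}$ is $G(x,y):=g(x)g(y)$. $|\cdot|$ denotes Peano-Jordan measure (in dimension 1 or 2). Peano-Jordan measurable sets are bounded.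
   Formalization: In 3 i) the index at g(m1/q1)g(m2/q2) is proved to be the sum of 1/(q1q2) over all pairs (k1,k2) with the same product, since distinct pairs may give the same value (for θ0=γ0=π/2 the index at 1/2 is 1/2, not 1/4). *)

(* Defs.v *)
From HB Require Import structures.
From mathcomp Require Import all_boot all_order all_algebra.
From mathcomp Require Import all_classical all_reals all_analysis.

Set Implicit Arguments.
Unset Strict Implicit.
Unset Printing Implicit Defensive.

Import Order.TTheory GRing.Theory Num.Theory.
Import numFieldNormedType.Exports.

Local Open Scope classical_set_scope.
Local Open Scope ring_scope.

(* Double sequences are functions [nat -> nat -> R] of which only the values at
   positive indices matter: here N = {1, 2, ...}, so an ordinal [i : 'I_n]
   stands for the index [i.+1] in {1, ..., n}. *)

Definition square_card (K : set (nat * nat)) (n : nat) : nat :=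
  #|[set ij : 'I_n * 'I_n | `[< K (ij.1.+1, ij.2.+1) >]]%SET|.

Definition density_ratio (R : realType) (K : set (nat * nat)) (n : nat) : R :=
  (square_card K n)%:R / (n ^ 2)%:R.

Definition upper_density (R : realType) (K : set (nat * nat)) : R :=
  limn_sup (density_ratio R K).

Definition index_pt (R : realType) (x : nat -> nat -> R) (L : R) : R :=
  1 - sup [set upper_density R [set nm | x nm.1 nm.2 \notin `]L - e, L + e[]
            | e in [set e : R | 0 < e]].

Definition enlarge (R : realType) (A : set R) (e : R) : set R :=
  [set a + b | a in A & b in `](- e), e[].

Definition index_set (R : realType) (x : nat -> nat -> R) (A : set R) : R :=
  1 - sup [set upper_density R [set nm | ~ enlarge A e (x nm.1 nm.2)]
            | e in [set e : R | 0 < e]].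

(* The nodes and the fundamental polynomials are indexed from 0:
   [node n i] is x_{n,i+1}. *)
Definition node (R : realType) (n i : nat) : R :=
  cos (i%:R / n.-1%:R * pi).

Definition fundamental (R : realType) (n : nat) (i : 'I_n) (x : R) : R :=
  \prod_(j < n | j != i) ((x - node R n j) / (node R n i - node R n j)).

Definition Lagrange_op (R : realType) (n m : nat) (f : R * R -> R)
    (z : R * R) : R :=
  \sum_(i < n) \sum_(j < m)
    fundamental i z.1 * fundamental j z.2 * f (node R n i, node R m j).

(* The series converges only conditionally: its sum is the limit of the partial
   sums. *)
Definition g (R : realType) (x : R) : R :=
  if x == 0 then 1
  else sin (pi * x) / pi * limn (series (fun k => (-1) ^+ k / (k%:R + x))).

Definition G (R : realType) (z : R * R) : R := g z.1 * g z.2.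

Definition g_preimage (R : realType) (A : set R) : set R :=
  `]0, 1[ `&` @g R @^-1` A.

Definition G_preimage (R : realType) (A : set R) : set (R * R) :=
  (`]0, 1[ `*` `]0, 1[) `&` @G R @^-1` A.

(* Peano-Jordan content relative to a family of elementary boxes [box] with
   volumes [vol].  The guard on finite covers in [PJ_measurable] is boundedness:
   [inf] and [sup] are only meaningful in its presence. *)
Definition outer_content (R : realType) (T I : Type) (box : I -> set T)
    (vol : I -> R) (A : set T) : R :=
  inf [set v : R | exists n (b : 'I_n -> I),
    A `<=` \bigcup_i box (b i) /\ v = \sum_(i < n) vol (b i)].

Definition inner_content (R : realType) (T I : Type) (box : I -> set T)
    (vol : I -> R) (A : set T) : R :=
  sup [set v : R | exists n (b : 'I_n -> I),
    [/\ trivIset setT (fun i => box (b i)),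
        \bigcup_i box (b i) `<=` A & v = \sum_(i < n) vol (b i)]].

Definition PJ_measurable (R : realType) (T I : Type) (box : I -> set T)
    (vol : I -> R) (A : set T) : Prop :=
  (exists n (b : 'I_n -> I), A `<=` \bigcup_i box (b i)) /\
  inner_content box vol A = outer_content box vol A.

(* [b.1 > b.2] is allowed and gives an empty box, of volume 0. *)
Definition box1 (R : realType) (b : R * R) : set R := `[b.1, b.2[.
Definition vol1 (R : realType) (b : R * R) : R := Num.max 0 (b.2 - b.1).
Definition box2 (R : realType) (b : (R * R) * (R * R)) : set (R * R) :=
  box1 b.1 `*` box1 b.2.
Definition vol2 (R : realType) (b : (R * R) * (R * R)) : R :=
  vol1 b.1 * vol1 b.2.

Definition PJ_measurable1 (R : realType) (A : set R) : Prop :=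
  PJ_measurable (@box1 R) (@vol1 R) A.

(* [PJ_measure1 A v]: A is Peano-Jordan measurable and |A| = v. *)
Definition PJ_measure1 (R : realType) (A : set R) (v : R) : Prop :=
  PJ_measurable1 A /\ outer_content (@box1 R) (@vol1 R) A = v.
Definition PJ_measure2 (R : realType) (A : set (R * R)) (v : R) : Prop :=
  PJ_measurable (@box2 R) (@vol2 R) A /\
  outer_content (@box2 R) (@vol2 R) A = v.

Definition step (R : realType) (x0 y0 : R) (z : R * R) : R :=
  \1_(`[x0, 1] `*` `[y0, 1]) z.

Definition exceptional (R : realType) (x0 y0 : R) : set (R * R) :=
  (`[x0, 1] `*` [set y0]) `|` ([set x0] `*` `[y0, 1]).

Definition irreducible_fraction (R : realType) (x : R) (p q : nat) : Prop :=
  [/\ (0 < p)%N, (0 < q)%N, coprime p q & x = p%:R / q%:R].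

(* Main.v *)
Require Import Defs.
From HB Require Import structures.
From mathcomp Require Import all_boot all_order all_algebra.
From mathcomp Require Import all_classical all_reals all_analysis.
From mathcomp Require Import ring lra zify.
Import Order.TTheory GRing.Theory Num.Theory.
Import numFieldNormedType.Exports.
Local Open Scope classical_set_scope.
Local Open Scope ring_scope.

Set Implicit Arguments.
Unset Strict Implicit.
Unset Printing Implicit Defensive.

(* Write N = n - 1.  Since h is a product of two step functions, L_{n,m} h (x, y)
   is a product of one-variable sums over the nodes on one side of the jump.
   By the closed form of the fundamental polynomials such a sum is alternating
   with monotone terms, hence bounded by its term nearest to x: it is bounded
   uniformly, tends to the step function away from the jump, and at the jump
   x0 = cos theta0 it differs by o(1) from g(s), where s is the fractional part
   of N theta0 / pi.  So everything depends on the distribution of s: uniform on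
   the residues k/q when theta0 / pi = p/q, uniform on [0, 1] when it is
   irrational.

   For the second case a Jordan measurable set A is approximated by a grid of
   values.  The preimage of a grid cell has small density because g is
   decreasing with |g x - g y| >= |x - y| / 32, and the sets {G >= c} have few
   boundary cells because G is monotone.  The lower bound for g rests on the
   reflection formula g(s) + g(1 - s) = 1, which is the limit of the partition
   of unity formed by the fundamental polynomials. *)

(** * Chebyshev polynomials and the fundamental polynomials *)

(** The measure statements also assert that the preimage is Jordan measurable. This is read off the
    orbit: inner and outer sums of boxes are compared with the frequency of visits of the rotation,
    so a set of undecided values is shown to have a small preimage by counting visits to it. Since
    the operators only approximate the values of g or G along the orbit, a cell of values has to lie
    inside A or keep a distance from A; merely missing A is not enough. For G a further obstacle is
    that g vanishes at 1: for s near 1 the map t -> g(s) g(t) is almost constant, so a strip of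
    small density near s = 1 is cut off before cells are counted row by row. Rotations are taken at
    [n.-1] because the n nodes have angles that are multiples of pi / (n - 1). *)

Section ChebyshevPolynomials.
Variable R : realType.
Implicit Types (n N : nat) (a x : R).

(** The pair (U_{n-1}, T_n) of Chebyshev polynomials. The recursion is the addition formula for the
    sine and cosine of (n + 1) a, so both are built together and [chebU n] has index n - 1 in the
    usual numbering. *)
Fixpoint cheb n : {poly R} * {poly R} :=
  if n is m.+1 then
    ('X * (cheb m).1 + (cheb m).2, 'X * (cheb m).2 - (1 - 'X ^+ 2) * (cheb m).1)
  else (0, 1).

Definition chebU n := (cheb n).1.
Definition chebT n := (cheb n).2.
(** At cos a this is sin a sin (n a), which vanishes at all n + 1 nodes, the endpoints included. *)
Definition nodal n := (1 - 'X ^+ 2) * chebU n.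

Lemma chebUS n : chebU n.+1 = 'X * chebU n + chebT n. Proof. by []. Qed.
Lemma chebTS n : chebT n.+1 = 'X * chebT n - nodal n. Proof. by []. Qed.

Lemma cheb_cos n a :
  (chebT n).[cos a] = cos (n%:R * a) /\ sin a * (chebU n).[cos a] = sin (n%:R * a).
Proof.
elim: n => [|n [IHT IHU]].
  by rewrite /chebT /chebU /= hornerC horner0 !mul0r cos0 sin0 mulr0.
have -> : n.+1%:R * a = n%:R * a + a by rewrite -natr1 mulrDl mul1r.
rewrite chebUS chebTS /nodal cosD sinD -IHT -IHU !hornerE -sin2cos2; split; ring.
Qed.

Lemma chebT_cos n a : (chebT n).[cos a] = cos (n%:R * a).
Proof. by have [] := cheb_cos n a. Qed.

Lemma chebU_cos n a : sin a * (chebU n).[cos a] = sin (n%:R * a).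
Proof. by have [] := cheb_cos n a. Qed.

Lemma nodal_cos n a : (nodal n).[cos a] = sin a * sin (n%:R * a).
Proof.
by rewrite -chebU_cos mulrA -expr2 sin2cos2 /nodal !hornerE.
Qed.

(** The second formula is the Chebyshev differential equation in first-order form. At a node it
    yields the denominator of the Lagrange polynomial. *)
Lemma cheb_deriv n :
  (chebT n)^`() = n%:R * chebU n /\
  (nodal n)^`() = - ('X * chebU n) - n%:R * chebT n.
Proof.
elim: n => [|n [IHT IHQ]].
  rewrite /chebT /nodal /chebU /= !mulr0 mul0r oppr0 addr0 deriv0.
  by rewrite -[1]/(1%:P) derivC.
have dT : (chebT n.+1)^`() = n.+1%:R * chebU n.+1.
  rewrite chebTS derivB derivM derivX mul1r IHT IHQ chebUS -natr1; ring.
split=> //.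
have -> : nodal n.+1 = 'X * nodal n + (1 - 'X ^+ 2) * chebT n.
  by rewrite /nodal chebUS; ring.
have d1 : (1 : {poly R})^`() = 0 by rewrite -[1]/(1%:P) derivC.
rewrite derivD (derivM 'X) [X in _ + X]derivM derivB derivXn d1 derivX.
rewrite IHT IHQ chebTS chebUS /= expr1 /nodal -natr1; ring.
Qed.

Lemma size_cheb n : (size (chebU n) <= n)%N /\ (size (chebT n) <= n.+1)%N.
Proof.
elim: n => [|n [IHU IHT]].
  by rewrite /chebU /chebT /= size_poly0 size_poly1.
rewrite chebUS chebTS; split.
  rewrite (leq_trans (size_polyD _ _))// geq_max IHT andbT.
  by rewrite (leq_trans (size_polyMleq _ _))// size_polyX.
rewrite (leq_trans (size_polyD _ _))// geq_max size_polyN; apply/andP; split.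
  by rewrite (leq_trans (size_polyMleq _ _))// size_polyX.
rewrite /nodal (leq_trans (size_polyMleq _ _))//.
have s3 : (size (1 - 'X ^+ 2 : {poly R})%R <= 3)%N.
  by rewrite (leq_trans (size_polyD _ _))// geq_max size_poly1 size_polyN size_polyXn.
by apply: leq_trans (_ : (3 + n).-1 <= _)%N; rewrite // -!subn1 leq_sub2r// leq_add.
Qed.

Lemma size_nodal n : (size (nodal n) <= n.+2)%N.
Proof.
have [IHU _] := size_cheb n.
rewrite /nodal (leq_trans (size_polyMleq _ _))//.
have s3 : (size (1 - 'X ^+ 2 : {poly R})%R <= 3)%N.
  by rewrite (leq_trans (size_polyD _ _))// geq_max size_poly1 size_polyN size_polyXn.
by apply: leq_trans (_ : (3 + n).-1 <= _)%N; rewrite // -!subn1 leq_sub2r// leq_add.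
Qed.

(** At 1 and -1 the factor sin a in [chebU_cos] vanishes, so these values need an induction of their
    own. *)
Lemma chebU1 n : (chebU n).[1] = n%:R.
Proof.
elim: n => [|n IH]; first by rewrite /chebU /= horner0.
by rewrite chebUS !hornerE IH -cos0 chebT_cos mulr0 cos0 natr1.
Qed.

Lemma cos_nat_pi n : cos (n%:R * pi) = (-1) ^+ n :> R.
Proof.
elim: n => [|n IH]; first by rewrite mul0r cos0.
by rewrite -natr1 mulrDl mul1r cosDpi IH exprS mulN1r.
Qed.

Lemma sin_nat_pi n : sin (n%:R * pi) = 0 :> R.
Proof.
elim: n => [|n IH]; first by rewrite mul0r sin0.
by rewrite -natr1 mulrDl mul1r sinDpi IH oppr0.
Qed.

Lemma chebUN1 n : (chebU n).[-1] = - (-1) ^+ n * n%:R.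
Proof.
elim: n => [|n IH]; first by rewrite /chebU /= horner0 mulr0.
rewrite chebUS !hornerE IH -cospi chebT_cos cos_nat_pi cospi exprS -natr1; ring.
Qed.

End ChebyshevPolynomials.

(** * Closed form, partition of unity and symmetry of the Lagrange polynomials *)

Section Nodes.
Variables (R : realType) (N : nat).
Hypothesis N_gt0 : (0 < N)%N.
Implicit Types (x a : R).

Local Notation nd := (node R N.+1).

Let N0 : N%:R != 0 :> R. Proof. by rewrite pnatr_eq0 -lt0n. Qed.
Let Ngt : 0 < N%:R :> R. Proof. by rewrite ltr0n. Qed.

Lemma angle_bounds (i : nat) : (i <= N)%N ->
  0 <= i%:R / N%:R * (pi : R) <= (pi : R).
Proof.
move=> iN; rewrite mulr_ge0 ?divr_ge0 ?pi_ge0//=.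
by rewrite ler_piMl ?pi_ge0// ler_pdivrMr// mul1r ler_nat.
Qed.

Lemma node_lt (i j : nat) : (i < j)%N -> (j <= N)%N -> nd j < nd i.
Proof.
move=> ij jN; rewrite /node /= ltr_cos ?in_itv /= ?angle_bounds//; last exact: (leq_trans (ltnW ij)).
by rewrite ltr_pM2r ?pi_gt0// ltr_pM2r ?invr_gt0// ltr_nat.
Qed.

Lemma node_inj (i j : nat) : (i <= N)%N -> (j <= N)%N -> nd i = nd j -> i = j.
Proof.
move=> iN jN eij; case: (ltngtP i j) => // ij.
  by have := node_lt ij jN; rewrite eij ltxx.
by have := node_lt ij iN; rewrite eij ltxx.
Qed.

Lemma mulr_angle (i : nat) : N%:R * (i%:R / N%:R * pi) = i%:R * pi :> R.
Proof. by rewrite mulrA mulrCA divff ?mulr1. Qed.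

Lemma nodal_node (i : nat) : (nodal R N).[nd i] = 0.
Proof.
by rewrite nodal_cos /= mulr_angle sin_nat_pi mulr0.
Qed.

Definition end_factor (i : nat) : R := (1 + (i == 0%N)%:R + (i == N)%:R).

Lemma end_factor_gt0 (i : nat) : 0 < end_factor i.
Proof. by rewrite /end_factor -addrA ltr_pwDl// addr_ge0// ler0n. Qed.

Lemma chebT_node (i : nat) : (chebT R N).[nd i] = (-1) ^+ i.
Proof.
by rewrite chebT_cos /= mulr_angle cos_nat_pi.
Qed.

(** At an inner node U_{N-1} vanishes and only - N T_N remains. At the two ends x U_{N-1}
    contributes the same amount once more, which is the doubling recorded by [end_factor]. *)
Lemma deriv_nodal_node (i : nat) : (i <= N)%N ->
  (nodal R N)^`().[nd i] = - (-1) ^+ i * end_factor i * N%:R.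
Proof.
move=> iN; have [_ ->] := cheb_deriv R N.
rewrite !hornerE chebT_node /end_factor.
rewrite -polyC_natr hornerC.
have [->|i0] := eqVneq i 0%N.
  have N0' : (0%N == N) = false by apply/negbTE; lia.
  by rewrite N0' /node /= mul0r mul0r cos0 chebU1 expr0 !mul1r/=; ring.
have [->|iN'] := eqVneq i N.
  by rewrite /node /= divff// mul1r cospi chebUN1/=; ring.
have : sin (i%:R / N%:R * pi) * (chebU R N).[nd i] = 0.
  by rewrite chebU_cos mulr_angle sin_nat_pi.
move=> /eqP; rewrite mulf_eq0 => /orP[|/eqP ->]; last by rewrite /=; ring.
rewrite gt_eqF// sin_gt0_pi// mulr_gt0 ?pi_gt0 ?divr_gt0 ?ltr0n ?(lt0n i)//=.
by rewrite gtr_pMl ?pi_gt0// ltr_pdivrMr// mul1r ltr_nat ltn_neqAle iN' iN.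
Qed.

(** N + 1 distinct roots exhaust a polynomial of degree at most N + 1; it is nonzero because its
    derivative at the first node is. *)
Lemma nodal_prod :
  nodal R N = lead_coef (nodal R N) *: \prod_(j < N.+1) ('X - (nd j)%:P).
Proof.
set s := [seq nd j | j : 'I_N.+1 <- enum 'I_N.+1].
have us : uniq s.
  rewrite map_inj_in_uniq ?enum_uniq// => i j _ _ /node_inj ij; apply: val_inj.
  by apply: ij; rewrite -ltnS.
have rs : all (root (nodal R N)) s.
  by apply/allP => x /mapP[i _ ->]; rewrite /root nodal_node.
have Q0 : nodal R N != 0.
  apply/eqP => Q0; have := deriv_nodal_node (leq0n N).
  rewrite Q0 deriv0 horner0 => /esym/eqP; rewrite expr0 !mulf_eq0 oppr_eq0 oner_eq0.
  by rewrite (gt_eqF (end_factor_gt0 _)) (negbTE N0).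
have ss : size s = N.+1 by rewrite size_map size_enum_ord.
have sQ : size (nodal R N) = (size s).+1.
  apply/eqP; rewrite eqn_leq ss size_nodal/=.
  by have := max_poly_roots Q0 rs us; rewrite ss.
rewrite [LHS](all_roots_prod_XsubC sQ rs) ?uniq_rootsE//; congr (_ *: _).
by rewrite big_map big_enum.
Qed.

Lemma fundamental_nodal (i : 'I_N.+1) x : x != nd i ->
  fundamental i x = (nodal R N).[x] / ((x - nd i) * (nodal R N)^`().[nd i]).
Proof.
move=> xi.
have [lc|lc] := eqVneq (lead_coef (nodal R N)) 0.
  have := deriv_nodal_node (leq0n N).
  rewrite nodal_prod lc scale0r deriv0 horner0 => /esym/eqP.
  rewrite expr0 !mulf_eq0 oppr_eq0 oner_eq0.
  by rewrite (gt_eqF (end_factor_gt0 _)) (negbTE N0).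
have QE : nodal R N = lead_coef (nodal R N) *:
    (('X - (nd i)%:P) * \prod_(j < N.+1 | j != i) ('X - (nd j)%:P)).
  by rewrite {1}nodal_prod (bigD1 i).
rewrite QE derivZ derivM derivXsubC mul1r !hornerE subrr mul0r addr0.
rewrite !horner_prod /fundamental big_split /= prodfV.
have prodXsubC y : \prod_(j < N.+1 | j != i) ('X - (nd j)%:P).[y] =
    \prod_(j < N.+1 | j != i) (y - nd j).
  by apply: eq_bigr => j _; rewrite hornerXsubC.
rewrite !prodXsubC.
set a := \prod_(j < _ | _) (x - _); set b := \prod_(j < _ | _) _.
have b0 : b != 0.
  apply/prodf_neq0 => j ji; rewrite subr_eq0; apply: contra ji => /eqP ij.
  by apply/eqP/ord_inj; apply: (node_inj _ _ (esym ij)); rewrite -ltnS.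
have xi' : x - nd i != 0 by rewrite subr_eq0.
by field; rewrite b0 lc xi'.
Qed.

(** Numbering the nodes from 0 flips the sign (-1)^i of the usual formula; the flip is absorbed by
    the denominator [nd i - cos a], which is positive for the nodes to the right of cos a. *)
Lemma fundamental_cos (i : 'I_N.+1) a : cos a != nd i ->
  fundamental i (cos a) =
    (-1) ^+ i * (sin a * sin (N%:R * a)) / (end_factor i * N%:R * (nd i - cos a)).
Proof.
move=> ai; rewrite fundamental_nodal// (deriv_nodal_node (ltn_ord i)) nodal_cos.
have e0 : end_factor i != 0 by rewrite gt_eqF// end_factor_gt0.
have s0 : (-1) ^+ i != 0 :> R by rewrite signr_eq0.
have n0 : nd i - cos a != 0 by rewrite subr_eq0 eq_sym.
rewrite -[in LHS]opprB !(mulNr, mulrN) opprK -signr_odd.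
case: (odd i); rewrite ?expr0 ?expr1; field; rewrite e0 N0 n0//=.
Qed.

Lemma fundamental_node (i j : 'I_N.+1) : fundamental i (nd j) = (i == j)%:R.
Proof.
rewrite /fundamental; have [->|ij] := eqVneq i j.
  rewrite big1// => k kj; rewrite divff// subr_eq0; apply: contra kj => /eqP kj.
  by apply/eqP/ord_inj; apply: (node_inj _ _ (esym kj)); rewrite -ltnS.
by rewrite (bigD1 j) 1?eq_sym//= subrr mul0r mul0r.
Qed.

(** The sum minus 1 is a polynomial of degree at most N that vanishes at the N + 1 nodes. *)
Lemma sum_fundamental x : \sum_(i < N.+1) fundamental i x = 1.
Proof.
pose l (i : 'I_N.+1) : {poly R} :=
  \prod_(j < N.+1 | j != i) ((nd i - nd j)^-1 *: ('X - (nd j)%:P)).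
have lE (i : 'I_N.+1) y : (l i).[y] = fundamental i y.
  rewrite /l horner_prod; apply: eq_bigr => j _.
  by rewrite !hornerE mulrC.
have cardN (i : 'I_N.+1) : #|(fun j : 'I_N.+1 => j != i)| = N.
  by rewrite -[RHS]/(N.+1.-1) -[in RHS](card_ord N.+1) -(cardC1 i); apply: eq_card.
have sl (i : 'I_N.+1) : (size (l i) <= N.+1)%N.
  rewrite /l (leq_trans (size_poly_prod_leq _ _))//.
  rewrite (@leq_trans ((\sum_(j < N.+1 | j != i) 2).+1 - N)%N)//.
    rewrite leq_sub ?ltnS//.
      by apply: leq_sum => j _; rewrite (leq_trans (size_scale_leq _ _))// size_XsubC.
    by rewrite cardN.
  by rewrite sum_nat_const cardN; lia.
suff /eqP : (\sum_(i < N.+1) l i - 1) = 0.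
  rewrite subr_eq0 => /eqP /(congr1 (horner^~ x)); rewrite horner_sum hornerC => <-.
  by apply: eq_bigr => i _; rewrite lE.
apply: (@roots_geq_poly_eq0 _ _ [seq nd j | j : 'I_N.+1 <- enum 'I_N.+1]).
- apply/allP => y /mapP[j _ ->]; rewrite /root !hornerE horner_sum.
  rewrite (bigD1 j)//= big1 => [|k kj]; last by rewrite lE fundamental_node (negbTE kj).
  by rewrite lE fundamental_node eqxx addr0 subrr.
- rewrite map_inj_in_uniq ?enum_uniq// => i j _ _ /node_inj ij; apply: val_inj.
  by apply: ij; rewrite -ltnS.
- rewrite size_map size_enum_ord (leq_trans (size_polyD _ _))// geq_max.
  rewrite size_polyN size_poly1 andbT.
  by rewrite (leq_trans (size_sum _ _ _))//; apply/bigmax_leqP.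
Qed.

Lemma node_rev (i : 'I_N.+1) : nd (rev_ord i) = - nd i.
Proof.
rewrite /node /= subSS (natrB _ (ltn_ord i : (i <= N)%N)) mulrBl divff// mulrBl mul1r.
by rewrite cosB cospi sinpi mul0r addr0 mulN1r.
Qed.

Lemma fundamental_rev (i : 'I_N.+1) x :
  @fundamental R N.+1 (rev_ord i) (- x) = @fundamental R N.+1 i x.
Proof.
rewrite /fundamental (reindex_inj rev_ord_inj) /=.
apply: eq_big => [j|j _]; first by rewrite (inj_eq rev_ord_inj).
have e k : node R N.+1 (N.+1 - (k : 'I_N.+1).+1) = - nd k := node_rev k.
by rewrite !e -!opprD invrN mulrNN.
Qed.

End Nodes.

(** * Alternating sums and trigonometric bounds *)

Section AlternatingSums.
Variable R : realType.
Implicit Types (a : nat -> R) (n : nat).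

Lemma alternating_sum_bounds a n :
  (forall i, (i < n)%N -> 0 <= a i) ->
  (forall i, (i.+1 < n)%N -> a i.+1 <= a i) ->
  0 <= \sum_(i < n) (-1) ^+ i * a i <= (if n is 0 then 0 else a 0).
Proof.
elim: n a => [|n IH] a a0 da; first by rewrite big_ord0 lexx.
rewrite big_ord_recl expr0 mul1r.
have -> : \sum_(i < n) (-1) ^+ lift ord0 i * a (lift ord0 i) =
    - \sum_(i < n) (-1) ^+ i * a i.+1.
  by rewrite -sumrN; apply: eq_bigr => i _; rewrite lift0 exprS mulN1r mulNr.
have /andP[h0 h1] := IH (a \o S) (fun i h => a0 i.+1 h) (fun i h => da i.+1 h).
rewrite subr_ge0 gerBl h0 andbT (le_trans h1)//.
by case: n {IH h0 h1} a0 da => [|n] a0 da; [apply: a0|apply: da].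
Qed.

Lemma alternating_sum_norm a n :
  (forall i, (i <= n)%N -> 0 <= a i) ->
  (forall i, (i < n)%N -> a i.+1 <= a i) ->
  `|\sum_(i < n.+1) (-1) ^+ i * a i| <= a 0%N.
Proof.
move=> a0 da; have /andP[h0 h1] := @alternating_sum_bounds a n.+1 a0 da.
by rewrite ger0_norm.
Qed.

Lemma alternating_tail a m n :
  (forall i, (m <= i <= m + n)%N -> 0 <= a i) ->
  (forall i, (m <= i < m + n)%N -> a i.+1 <= a i) ->
  `|\sum_(i < m + n.+1) (-1) ^+ i * a i - \sum_(i < m) (-1) ^+ i * a i| <= a m.
Proof.
move=> a0 da; rewrite big_split_ord /= [X in X - _]addrC addrK.
have -> : \sum_(i < n.+1) (-1) ^+ (m + i) * a (m + i)%N =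
    (-1) ^+ m * \sum_(i < n.+1) (-1) ^+ i * a (m + i)%N.
  by rewrite mulr_sumr; apply: eq_bigr => i _; rewrite exprD mulrA.
rewrite normrM normrX normrN1 expr1n mul1r -[X in _ <= a X]addn0.
apply: (@alternating_sum_norm (fun i => a (m + i)%N)) => i hi.
  by apply: a0; rewrite leq_addr leq_add2l.
by rewrite addnS da// leq_addr ltn_add2l.
Qed.

End AlternatingSums.

(** * Elementary bounds for sine and for differences of cosines *)

Section TrigonometricBounds.
Variable R : realType.
Implicit Types (a b t u x : R).

Lemma sin_mean_value a b : a < b ->
  exists2 c, a < c < b & sin b - sin a = cos c * (b - a).
Proof.
move=> ab.
have [|c] := @MVT R sin cos a b ab (fun x _ => is_derive_sin x).
  by apply: continuous_subspaceT => x; exact: continuous_sin.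
by rewrite in_itv /= => cab e; exists c.
Qed.

Lemma cos_mean_value a b : a < b ->
  exists2 c, a < c < b & cos a - cos b = sin c * (b - a).
Proof.
move=> ab.
have [|c] := @MVT R cos (fun x => - sin x) a b ab (fun x _ => is_derive_cos x).
  by apply: continuous_subspaceT => x; exact: continuous_cos.
rewrite in_itv /= => cab e; exists c => //.
by rewrite -opprB e mulNr opprK.
Qed.

Lemma sin_lipschitz a b : `|sin a - sin b| <= `|a - b|.
Proof.
wlog ab : a b / a < b.
  move=> W; case: (ltgtP a b) => [/W//|/W|->]; last by rewrite !subrr.
  by rewrite distrC [X in _ <= X -> _]distrC.
have [c _ e] := sin_mean_value ab.
by rewrite distrC e normrM distrC ler_piMl// cos_max.
Qed.

Lemma norm_sin_le x : `|sin x| <= `|x|.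
Proof. by have := sin_lipschitz x 0; rewrite sin0 !subr0. Qed.

Lemma cos_le a b : 0 <= a -> a <= b -> b <= pi -> cos b <= cos a.
Proof.
move=> a0 ab bp; case: (ltgtP a b) ab => // [ab _|->//].
by apply/ltW; rewrite ltr_cos// in_itv /= ?a0 ?(le_trans a0 (ltW ab))//= (le_trans (ltW ab)).
Qed.

Lemma sin_le_half_pi a b : 0 <= a -> a <= b -> b <= pi / 2 -> sin a <= sin b.
Proof.
move=> a0 ab bp.
have h c : sin c = cos (pi / 2 - c) by rewrite cosB cos_pihalf sin_pihalf mul0r add0r mul1r.
rewrite !h; apply: cos_le; have := pi_gt0 R; lra.
Qed.

Lemma sin_pi_sub x : sin (pi - x) = sin x.
Proof. by rewrite sinB sinpi cospi mul0r sub0r mulN1r opprK. Qed.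

Lemma cos_pi_sub x : cos (pi - x) = - cos x.
Proof. by rewrite cosB sinpi cospi mul0r addr0 mulN1r. Qed.

(** Write sin u = 2 sin(u/2) cos(u/2) and apply the mean value theorem to sin(u/2): this gives u cos
    c cos(u/2) with cos c >= cos(u/2), and 2 cos^2(u/2) = 1 + cos u >= 1. *)
Lemma sin_ge_half u : 0 <= u <= pi / 2 -> u / 2 <= sin u.
Proof.
move=> /andP[u0 up]; have [->|un0] := eqVneq u 0; first by rewrite mul0r sin0.
have up0 : 0 < u by rewrite lt_neqAle eq_sym un0.
have u2 : 0 < u / 2 by rewrite divr_gt0.
have [c /andP[c0 cu]] := sin_mean_value u2.
rewrite sin0 !subr0 => e.
have cc : cos (u / 2) <= cos c by apply: cos_le; have := pi_gt0 R; lra.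
have c2 : 0 <= cos (u / 2) by apply: cos_ge0_pihalf; have := pi_gt0 R; lra.
have cu0 : 0 <= cos u by apply: cos_ge0_pihalf; have := pi_gt0 R; lra.
have uE : u = (u / 2) *+ 2 by rewrite mulr2n; lra.
move: cu0; rewrite {1}uE cos_mulr2n => cu0.
have -> : sin u = cos (u / 2) * cos c * u.
  by rewrite {1}uE sin_mulr2n e mulr2n; lra.
have h1 : 2^-1 <= cos (u / 2) ^+ 2 by lra.
have h2 : cos (u / 2) ^+ 2 <= cos (u / 2) * cos c by rewrite expr2 ler_wpM2l.
nra.
Qed.

Lemma sin_ge_half_sin a b : a / 2 <= b <= a -> 0 <= a <= pi -> sin a / 2 <= sin b.
Proof.
move=> /andP[ab ba] /andP[a0 ap].
have sa : 0 <= sin a by apply: sin_ge0_pi; rewrite a0.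
have [bp|bp] := leP b (pi / 2).
  have h : sin (a / 2) <= sin b by apply: sin_le_half_pi => //; lra.
  have aE : a = (a / 2) *+ 2 by rewrite mulr2n; lra.
  rewrite {1}aE sin_mulr2n -mulr_natl.
  have := cos_le1 (a / 2).
  have : 0 <= sin (a / 2) by apply: sin_ge0_pi; lra.
  move: h; nra.
have h : sin a <= sin b.
  by rewrite -(sin_pi_sub a) -(sin_pi_sub b); apply: sin_le_half_pi; lra.
lra.
Qed.

(** The difference equals 2 sin(a - t/2) sin(t/2). As a - t/2 stays in [a/2, a], the first sine is
    at least sin(a)/2, and the second is at least t/4. *)
Lemma cos_sub_lower a t : 0 <= t <= a -> a <= pi ->
  t * sin a / 4 <= cos (a - t) - cos a.
Proof.
move=> /andP[t0 ta] ap.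
have -> : cos (a - t) - cos a = 2 * (sin (a - t / 2) * sin (t / 2)).
  set b := a - t / 2.
  have -> : a - t = b - t / 2 by rewrite /b; lra.
  have -> : a = b + t / 2 by rewrite /b; lra.
  rewrite cosB cosD; ring.
have h1 : sin a / 2 <= sin (a - t / 2) by apply: sin_ge_half_sin; lra.
have h2 : t / 2 / 2 <= sin (t / 2) by apply: sin_ge_half; lra.
have sa : 0 <= sin a by apply: sin_ge0_pi; lra.
have h : sin a / 2 * (t / 2 / 2) <= sin (a - t / 2) * sin (t / 2).
  by apply: ler_pM => //; lra.
lra.
Qed.

(** The kernel is its pole 1/t up to an error uniform in t: the denominator is t sin c with sin c >=
    sin(a)/4, and |sin a - sin c| <= t cancels the pole. *)
Lemma kernel_bound a t : 0 < t <= a -> a < pi ->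
  `|sin a / (cos (a - t) - cos a) - t^-1| <= 4 / sin a.
Proof.
move=> /andP[t0 ta] ap.
have sa : 0 < sin a by apply: sin_gt0_pi; lra.
have hl : t * sin a / 4 <= cos (a - t) - cos a by apply: cos_sub_lower; lra.
have [|c /andP[ca cb] e] := @cos_mean_value (a - t) a; first by lra.
have {}e : cos (a - t) - cos a = sin c * t by rewrite e; congr (_ * _); ring.
rewrite e in hl *.
have sc0 : sin a / 4 <= sin c.
  by rewrite -(ler_pM2r t0); lra.
have sc : 0 < sin c by lra.
have -> : sin a / (sin c * t) - t^-1 = (sin a - sin c) / (sin c * t).
  by field; rewrite !gt_eqF.
have sct : 0 < sin c * t by rewrite mulr_gt0.
rewrite normrM normfV (gtr0_norm sct) ler_pdivrMr ?mulr_gt0//.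
apply: (le_trans (sin_lipschitz _ _)).
have h : 1 <= 4 / sin a * sin c.
  rewrite mulrAC ler_pdivlMr// mul1r; lra.
rewrite ger0_norm; last by lra.
rewrite mulrA; nra.
Qed.

End TrigonometricBounds.

(** * Sums of Lagrange polynomials over the nodes on one side *)

Section PartialSums.
Variable R : realType.
Implicit Types (N k : nat) (a x s : R).

Definition lsum N k x : R := \sum_(i < N.+1 | (i <= k)%N) fundamental i x.

(** Partition of unity combined with x -> -x: the nodes after index k, read in reverse, are the
    first N - k nodes. This reduces points to the right of node k to points on its left. *)
Lemma lsum_complement N k x : (k < N)%N ->
  lsum N k x + lsum N (N - k).-1 (- x) = 1.
Proof.
move=> kN; have N_gt0 : (0 < N)%N := leq_ltn_trans (leq0n k) kN.
rewrite -(sum_fundamental N_gt0 x) [RHS](bigID (fun i : 'I_N.+1 => (i <= k)%N)) /=.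
congr (_ + _); rewrite /lsum (reindex_inj rev_ord_inj) /=.
apply: eq_big => [i|i _]; last by rewrite fundamental_rev.
by have := ltn_ord i; lia.
Qed.

(** Counted backwards from node [k], the summed node nearest to a point cos a on its left, so that
    the terms decrease with j. *)
Definition kern N k a (j : nat) : R :=
  (end_factor R N (k - j) * N%:R * (node R N.+1 (k - j) - cos a))^-1.

Lemma end_factor_inner N i : (0 < i < N)%N -> end_factor R N i = 1.
Proof.
by move=> /andP[i0 iN]; rewrite /end_factor gtn_eqF// ltn_eqF// !addr0.
Qed.

Section Below.
Variables (N k : nat) (a : R).
Hypotheses (kN : (k < N)%N) (a0pi : 0 <= a <= pi) (ak : cos a < node R N.+1 k).

Let N_gt0 : (0 < N)%N. Proof. exact: leq_ltn_trans kN. Qed.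
Let Npos : 0 < N%:R :> R. Proof. by rewrite ltr0n. Qed.

Lemma node_above j : cos a < node R N.+1 (k - j).
Proof.
case: j => [|j]; first by rewrite subn0.
case: k kN ak => [|k'] // k'N ak'.
apply: (lt_le_trans ak'); apply: ltW; apply: node_lt; lia.
Qed.

Lemma kern_gt0 j : 0 < kern N k a j.
Proof.
by rewrite invr_gt0 !mulr_gt0 ?end_factor_gt0// subr_gt0 node_above.
Qed.

Lemma end_factor_ge1 M i : 1 <= end_factor R M i.
Proof. by rewrite /end_factor -addrA lerDl addr_ge0. Qed.

(** The doubled denominator at node 0 can only affect the last and smallest term, in the favourable
    direction. *)
Lemma kern_decreasing j : (j < k)%N -> kern N k a j.+1 <= kern N k a j.
Proof.
move=> jk; have e1 : end_factor R N (k - j) = 1.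
  by apply: end_factor_inner; rewrite subn_gt0 jk (leq_ltn_trans (leq_subr _ _) kN).
have h (x y : R) : 0 < x -> x <= y -> y^-1 <= x^-1.
  by move=> x0 xy; rewrite lef_pV2// posrE// (lt_le_trans x0).
apply: h; rewrite e1 mul1r.
  by rewrite mulr_gt0// subr_gt0 node_above.
apply: ler_pM; rewrite ?(ltW Npos) ?subr_ge0 ?(ltW (node_above _))//.
  by rewrite ler_peMl ?(ltW Npos)// end_factor_ge1.
by rewrite lerD2r; apply/ltW/node_lt; lia.
Qed.

Lemma kern0_le : kern N k a 0 <= (N%:R * (node R N.+1 k - cos a))^-1.
Proof.
rewrite /kern subn0 lef_pV2 ?posrE ?mulr_gt0 ?end_factor_gt0 ?subr_gt0//.
rewrite -mulrA ler_peMl ?end_factor_ge1// mulr_ge0 ?subr_ge0 ?ltW//.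
Qed.

Lemma lsum_alternating : lsum N k (cos a) =
  (-1) ^+ k * (sin a * sin (N%:R * a)) *
  \sum_(j < k.+1) (-1) ^+ j * kern N k a j.
Proof.
pose F i := (-1) ^+ i * (sin a * sin (N%:R * a)) /
  (end_factor R N i * N%:R * (node R N.+1 i - cos a)).
transitivity (\sum_(i < N.+1 | (i < k.+1)%N) F i).
  apply: eq_big => // i ik; rewrite fundamental_cos//.
  have := node_above (k - i); rewrite subKn// => h.
  by rewrite neq_lt h.
rewrite -(big_ord_widen _ F) ?ltnS 1?ltnW//.
rewrite (reindex_inj rev_ord_inj) /= mulr_sumr; apply: eq_bigr => j _.
rewrite subSS /F -/(kern N k a j).
have -> : (-1) ^+ k = (-1) ^+ (k - j) * (-1) ^+ j :> R.
  by rewrite -exprD subnK// -ltnS.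
rewrite [RHS](_ : _ = (-1) ^+ j * (-1) ^+ j *
  ((-1) ^+ (k - j) * (sin a * sin (N%:R * a)) * kern N k a j)); last by ring.
by rewrite -expr2 sqrr_sign mul1r.
Qed.

Lemma lsum_le : `|lsum N k (cos a)| <=
  `|sin a * sin (N%:R * a)| * (N%:R * (node R N.+1 k - cos a))^-1.
Proof.
rewrite lsum_alternating !normrM normrX normrN1 expr1n mul1r.
apply: ler_wpM2l; first by rewrite mulr_ge0.
apply: le_trans kern0_le; apply: alternating_sum_norm => i ik.
  exact/ltW/kern_gt0.
exact: kern_decreasing.
Qed.

End Below.

Lemma lt_cos_angle a b : 0 <= a <= pi -> 0 <= b <= pi -> cos a < cos b -> b < a.
Proof. by move=> ha hb; rewrite ltr_cos// in_itv. Qed.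

(** Near node k, of angle b, the bound [lsum_le] has the form 0/0. Since N b is a multiple of pi,
    |sin (N a)| <= N (a - b), while the denominator is at least N (a - b) sin(a) / 4. The factors N,
    a - b and sin a all cancel and leave 4. *)
Lemma lsum_le4 N k a : (k < N)%N -> 0 <= a <= pi -> cos a < node R N.+1 k ->
  `|lsum N k (cos a)| <= 4.
Proof.
move=> kN api ak; apply: le_trans (lsum_le kN api ak) _.
have N_gt0 : (0 < N)%N := leq_ltn_trans (leq0n k) kN.
have Npos : 0 < N%:R :> R by rewrite ltr0n.
have kpi := angle_bounds R N_gt0 (ltnW kN).
have := lt_cos_angle api kpi ak; set b := k%:R / N%:R * pi => ba.
have sa : 0 <= sin a by apply: sin_ge0_pi.
have h1 : `|sin (N%:R * a)| <= N%:R * (a - b).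
  have -> : N%:R * a = N%:R * (a - b) + k%:R * pi.
    by rewrite -(mulr_angle R N_gt0) -/b; ring.
  rewrite sinD sin_nat_pi mulr0 addr0 normrM cos_nat_pi normrX normrN1 expr1n mulr1.
  apply: le_trans (norm_sin_le _) _.
  by rewrite ger0_norm// mulr_ge0 ?(ltW Npos)// subr_ge0 (ltW ba).
have h2 : (a - b) * sin a / 4 <= node R N.+1 k - cos a.
  have := @cos_sub_lower R a (a - b); rewrite subKr; apply; last by case/andP: api.
  by rewrite subr_ge0 ltW//= gerBl; case/andP: kpi.
have n0 : 0 < node R N.+1 k - cos a by rewrite subr_gt0.
rewrite ler_pdivrMr ?mulr_gt0// normrM (ger0_norm sa).
apply: le_trans (ler_wpM2l sa h1) _.
have -> : sin a * (N%:R * (a - b)) = 4 * (N%:R * ((a - b) * sin a / 4)) by field.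
by rewrite ler_wpM2l// ler_wpM2l// ltW.
Qed.

Lemma node_complement N k : (k < N)%N ->
  node R N.+1 (N - k).-1 = - node R N.+1 k.+1.
Proof.
move=> kN; have N_gt0 : (0 < N)%N := leq_ltn_trans (leq0n k) kN.
have kN' : (k.+1 < N.+1)%N by [].
have := node_rev R N_gt0 (Ordinal kN') => /= <-.
by congr node; lia.
Qed.

(** At or to the right of node k the complementary sum at -x is bounded by 4, hence 1 + 4. *)
Lemma lsum_le5 N k a : (k < N)%N -> 0 <= a <= pi -> `|lsum N k (cos a)| <= 5.
Proof.
move=> kN api; have N_gt0 : (0 < N)%N := leq_ltn_trans (leq0n k) kN.
have [ak|ak] := ltP (cos a) (node R N.+1 k).
  by apply: le_trans (lsum_le4 kN api ak) _; lra.
have ak' : node R N.+1 k.+1 < cos a.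
  by apply: lt_le_trans ak; apply: node_lt.
have api' : 0 <= pi - a <= pi by lra.
have := @lsum_le4 N (N - k).-1 (pi - a) _ api'.
rewrite cos_pi_sub node_complement// ltrN2 => /(_ _ ak') h.
have {}h : `|lsum N (N - k).-1 (- cos a)| <= 4 by apply: h; lia.
have -> : lsum N k (cos a) = 1 - lsum N (N - k).-1 (- cos a).
  by rewrite -(lsum_complement (cos a) kN) addrK.
by apply: le_trans (ler_normB _ _) _; rewrite normr1; lra.
Qed.

Lemma lsum_far_below N k a d : (k < N)%N -> 0 <= a <= pi -> 0 < d ->
  cos a + d <= node R N.+1 k -> `|lsum N k (cos a)| <= (N%:R * d)^-1.
Proof.
move=> kN api d0 ad; have N_gt0 : (0 < N)%N := leq_ltn_trans (leq0n k) kN.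
have Npos : 0 < N%:R :> R by rewrite ltr0n.
have ak : cos a < node R N.+1 k by apply: lt_le_trans ad; rewrite ltrDl.
apply: le_trans (lsum_le kN api ak) _.
have h : `|sin a * sin (N%:R * a)| <= 1.
  by rewrite normrM mulr_ile1// ?sin_max.
rewrite -[leRHS]mul1r; apply: ler_pM => //.
  by rewrite invr_ge0 mulr_ge0 ?ltW// subr_gt0.
rewrite lef_pV2 ?posrE ?mulr_gt0// ?subr_gt0//.
by rewrite ler_pM2l// lerBrDl.
Qed.

Lemma lsum_far_above N k a d : (k < N)%N -> 0 <= a <= pi -> 0 < d ->
  node R N.+1 k.+1 + d <= cos a -> `|lsum N k (cos a) - 1| <= (N%:R * d)^-1.
Proof.
move=> kN api d0 ad.
have api' : 0 <= pi - a <= pi by lra.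
have -> : lsum N k (cos a) - 1 = - lsum N (N - k).-1 (- cos a).
  by rewrite -(lsum_complement (cos a) kN) opprD addNKr.
rewrite normrN -cos_pi_sub.
apply: lsum_far_below => //; first lia.
by rewrite cos_pi_sub node_complement//; lra.
Qed.

(** The point lies s steps beyond node k, so sin (N a) = (-1)^k sin(pi s) and the angle to node k -
    j is (j + s) pi / N. Each of the first J terms is replaced by its pole at the cost of one kernel
    error; the remaining terms alternate and are bounded by the term of index J. *)
Lemma lsum_approx N k s J a : (k < N)%N -> 0 < s < 1 -> (0 < J < k)%N ->
  a = (k%:R + s) / N%:R * pi ->
  `|lsum N k (cos a) - sin (pi * s) / pi * \sum_(j < J) (-1) ^+ j / (j%:R + s)|
    <= J.+1%:R * (4 / sin a) / N%:R + J%:R^-1.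
Proof.
move=> kN /andP[s0 s1] /andP[J0 Jk] aE.
have N_gt0 : (0 < N)%N := leq_ltn_trans (leq0n k) kN.
have Npos : 0 < N%:R :> R by rewrite ltr0n.
have pi0 := pi_gt0 R.
have ksN : k%:R + s < N%:R.
  by apply: (@lt_le_trans _ _ k.+1%:R); rewrite ?ler_nat// -natr1 ltrD2l.
have a0 : 0 < a by rewrite aE mulr_gt0 ?divr_gt0// ltr_wpDl.
have api : a < pi by rewrite aE gtr_pMl// ltr_pdivrMr// mul1r.
have sa : 0 < sin a by apply: sin_gt0_pi; rewrite a0.
have a0pi : 0 <= a <= pi by rewrite !ltW.
have ndE j : (j <= k)%N -> node R N.+1 (k - j) = cos (a - (j%:R + s) / N%:R * pi).
  move=> jk; rewrite /node /= natrB// aE; congr cos; ring.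
have ak : cos a < node R N.+1 k.
  rewrite /node/= ltr_cos ?in_itv/= ?angle_bounds ?(ltnW kN)//.
  by rewrite aE ltr_pM2r// ltr_pM2r ?invr_gt0// ltrDl.
have kernE j : (j < k)%N ->
    `|sin a * kern N k a j - (pi * (j%:R + s))^-1| <= 4 / sin a / N%:R.
  move=> jk; have e1 : end_factor R N (k - j) = 1.
    by apply: end_factor_inner; rewrite subn_gt0 jk (leq_ltn_trans (leq_subr _ _) kN).
  set t := (j%:R + s) / N%:R * pi.
  have t0 : 0 < t by rewrite mulr_gt0 ?divr_gt0// ltr_wpDl.
  have ta : t <= a.
    by rewrite /t aE ler_pM2r// ler_pM2r ?invr_gt0// lerD2r ler_nat ltnW.
  have ta' : 0 < t <= a by rewrite t0.
  have := kernel_bound ta' api.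
  rewrite /kern e1 mul1r (ndE _ (ltnW jk)) -/t => h.
  have nz : cos (a - t) - cos a != 0.
    by rewrite gt_eqF// /t -(ndE _ (ltnW jk)) subr_gt0; apply: node_above.
  have js : j%:R + s != 0 by rewrite gt_eqF// ltr_wpDl.
  have -> : sin a / (N%:R * (cos (a - t) - cos a)) - (pi * (j%:R + s))^-1 =
      (sin a / (cos (a - t) - cos a) - t^-1) / N%:R.
    have alg (n p i D c : R) : n != 0 -> p != 0 -> i != 0 -> D != 0 ->
        c / (n * D) - (p * i)^-1 = (c / D - (i / n * p)^-1) / n.
      by move=> n0 p0 i0 D0; field; rewrite n0 p0 i0 D0.
    by apply: alg => //; rewrite gt_eqF.
  rewrite normrM (ger0_norm (x := _^-1)) ?invr_ge0 ?(ltW Npos)//.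
  by rewrite ler_wpM2r// invr_ge0 (ltW Npos).
have sNa : sin (N%:R * a) = (-1) ^+ k * sin (pi * s).
  have -> : N%:R * a = pi * s + k%:R * pi by rewrite aE; field; rewrite gt_eqF.
  by rewrite sinD sin_nat_pi mulr0 addr0 cos_nat_pi mulrC.
rewrite (lsum_alternating kN a0pi ak) sNa.
have kk : (-1) ^+ k * (-1) ^+ k = 1 :> R by rewrite -expr2 sqrr_sign.
set S := \sum_(j < k.+1) _; set T := \sum_(j < J) _.
have -> : (-1) ^+ k * (sin a * ((-1) ^+ k * sin (pi * s))) * S =
    sin (pi * s) * (sin a * S).
  rewrite -[RHS]mul1r -[X in _ = X * _]kk; ring.
rewrite -mulrA -mulrBr normrM.
apply: (@le_trans _ _ `|sin a * S - pi^-1 * T|).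
  by rewrite ler_piMl// sin_max.
pose S' := \sum_(j < J) (-1) ^+ j * kern N k a j.
have -> : sin a * S - pi^-1 * T = sin a * (S - S') + (sin a * S' - pi^-1 * T) by ring.
apply: le_trans (ler_normD _ _) _.
(* Term J of the tail is itself compared with its pole, which is the extra kernel error that turns J
   into J + 1. *)
have h1 : `|sin a * (S - S')| <= J%:R^-1 + 4 / sin a / N%:R.
  rewrite normrM (gtr0_norm sa).
  have -> : S = \sum_(j < J + (k - J).+1) (-1) ^+ j * kern N k a j.
    by rewrite /S addnS subnKC// ltnW.
  have hk : `|\sum_(j < J + (k - J).+1) (-1) ^+ j * kern N k a j - S'| <= kern N k a J.
    apply: alternating_tail => i; rewrite subnKC ?(ltnW Jk)// => /andP[_ ik].
      exact/ltW/kern_gt0.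
    exact: kern_decreasing.
  apply: le_trans (ler_wpM2l (ltW sa) hk) _.
  have := kernE J Jk; rewrite ler_distl => /andP[_ h].
  have hJ : (pi * (J%:R + s))^-1 <= J%:R^-1.
    have js : 0 < J%:R + s by rewrite ltr_wpDl.
    rewrite lef_pV2 ?posrE ?ltr0n ?(mulr_gt0 pi0 js)//.
    have p1 : 1 <= pi :> R by have := pi_ge2 R; lra.
    have J1 : 0 <= J%:R :> R by [].
    nra.
  lra.
have h2 : `|sin a * S' - pi^-1 * T| <= J%:R * (4 / sin a / N%:R).
  rewrite /S' /T !mulr_sumr -sumrB.
  apply: le_trans (ler_norm_sum _ _ _) _.
  have -> : J%:R * (4 / sin a / N%:R) = \sum_(j < J) (4 / sin a / N%:R).
    by rewrite sumr_const card_ord mulr_natl.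
  apply: ler_sum => j _.
  have -> : sin a * ((-1) ^+ j * kern N k a j) - pi^-1 * ((-1) ^+ j / (j%:R + s)) =
     (-1) ^+ j * (sin a * kern N k a j - (pi * (j%:R + s))^-1).
    by rewrite invfM; ring.
  rewrite normrM normrX normrN1 expr1n mul1r; apply: kernE.
  exact: ltn_trans Jk.
apply: le_trans (lerD h1 h2) _.
by rewrite -[J.+1%:R]natr1; lra.
Qed.

End PartialSums.

(** * The limit function g *)

Section LimitFunction.
Variable R : realType.
Implicit Types (x y s : R).

Lemma small_inverse (e : R) : 0 < e -> exists2 m : nat, (0 < m)%N & m%:R^-1 < e.
Proof.
move=> e0; have h := archi_boundP (ltW (_ : 0 < e^-1)).
have {}h : e^-1 < (Num.bound e^-1)%:R by apply: h; rewrite invr_gt0.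
have m0 : (0 < Num.bound e^-1)%N by rewrite -(ltr0n R) (lt_trans _ h)// invr_gt0.
exists (Num.bound e^-1) => //.
by rewrite invf_plt ?posrE ?ltr0n.
Qed.

Lemma eq_of_le_inverse (x y C : R) :
  (forall J : nat, (0 < J)%N -> `|x - y| <= C / J%:R) -> x = y.
Proof.
move=> h; apply/eqP; rewrite -subr_eq0 -normr_eq0; apply/negP => /negP nz.
have p : 0 < `|x - y| by rewrite lt_neqAle eq_sym nz normr_ge0.
have C0 : 0 < C.
  by have := h 1%N isT; rewrite divr1; apply: lt_le_trans.
have [m m0 hm] := @small_inverse (`|x - y| / C) (divr_gt0 p C0).
have := h m m0; rewrite leNgt => /negP; apply.
by move: hm; rewrite ltr_pdivlMr// mulrC.
Qed.

(** Terms of the series of Nielsen's beta function. *)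
Definition beta_term x (k : nat) : R := (-1) ^+ k / (k%:R + x).
Definition beta x : R := limn (series (beta_term x)).

Lemma beta_tail x m n : 0 < x -> (m <= n)%N ->
  `|series (beta_term x) n - series (beta_term x) m| <= (m%:R + x)^-1.
Proof.
move=> x0 mn; rewrite /series /= !big_mkord.
case: (ltngtP m n) mn => // [mn _|-> _]; last first.
  by rewrite subrr normr0 invr_ge0 addr_ge0// ltW.
rewrite -(subnKC mn) addSnnS.
apply: (@alternating_tail R (fun i => (i%:R + x)^-1)) => i _.
  by rewrite invr_ge0 addr_ge0// ltW.
have p k : 0 < k%:R + x by rewrite ltr_wpDl.
by rewrite lef_pV2 ?posrE// lerD2r ler_nat.
Qed.

Lemma is_cvg_beta x : 0 < x -> cvgn (series (beta_term x)).
Proof.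
move=> x0; apply/cauchy_cvgP/cauchy_exP => e e0.
have [m m0 me] := small_inverse e0.
exists (series (beta_term x) m); exists m => // n /= mn.
rewrite /ball /= distrC; apply: le_lt_trans (beta_tail x0 mn) _.
apply: le_lt_trans me; rewrite lef_pV2 ?posrE ?ltr0n ?ltr_wpDl//.
by rewrite lerDl ltW.
Qed.

Lemma beta_approx x m : 0 < x ->
  `|beta x - series (beta_term x) m| <= (m%:R + x)^-1.
Proof.
move=> x0; apply/ler_addgt0Pr => e e0.
have /cvgrPdist_le /(_ e e0) [n _ hn] := is_cvg_beta x0.
have := hn (maxn n m) (leq_maxl _ _) => /= h1.
have h2 := beta_tail x0 (leq_maxr n m).
have -> : beta x - series (beta_term x) m =
  (series (beta_term x) (maxn n m) - series (beta_term x) m) +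
  (beta x - series (beta_term x) (maxn n m)) by ring.
by apply: le_trans (ler_normD _ _) (lerD h2 h1).
Qed.

Lemma alternating_sum_ge (a : nat -> R) n : (forall i, 0 <= a i) ->
  (forall i, a i.+1 <= a i) -> (1 < n)%N ->
  a 0%N - a 1%N <= \sum_(i < n) (-1) ^+ i * a i.
Proof.
case: n => [|[|n]]// a0 da _.
have /andP[h _] := @alternating_sum_bounds R (fun i => a i.+2) n
  (fun i _ => a0 i.+2) (fun i _ => da i.+2).
rewrite !big_ord_recl /= expr0 expr1 mul1r mulN1r addrA lerDl.
apply: le_trans h _; rewrite le_eqVlt; apply/orP; left; apply/eqP.
by apply: eq_bigr => i _; rewrite !exprS mulN1r mulN1r opprK.
Qed.

(** The first two terms give 1 / (x (1 + x)), and 1 + x <= 2. *)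
Lemma beta_lower x : 0 < x <= 1 -> (2 * x)^-1 <= beta x.
Proof.
move=> /andP[x0 x1]; apply: limr_ge; first exact: is_cvg_beta.
exists 2%N => // n /= n2; rewrite /series /= big_mkord.
apply: le_trans (@alternating_sum_ge (fun i => (i%:R + x)^-1) n _ _ n2) => [|i|i].
- rewrite add0r.
  have -> : x^-1 - (1 + x)^-1 = (x * (1 + x))^-1.
    by field; rewrite ?gt_eqF ?ltr_wpDr ?(ltW x0).
  rewrite lef_pV2 ?posrE ?mulr_gt0 ?ltr_wpDr ?(ltW x0)//; nra.
- by rewrite invr_ge0 addr_ge0// ltW.
- have p k : 0 < k%:R + x by rewrite ltr_wpDl.
  by rewrite lef_pV2 ?posrE// lerD2r ler_nat.
Qed.

Lemma beta_gt0 x : 0 < x <= 1 -> 0 < beta x.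
Proof.
move=> h; apply: lt_le_trans (beta_lower h).
by rewrite invr_gt0 mulr_gt0//; case/andP: h.
Qed.

(** The termwise differences (y - x) / ((i + x)(i + y)) decrease, so the first two bound the
    alternating sum from below. The constant 4 bounds (1 + x)(1 + y). *)
Lemma beta_difference x y : 0 < x -> x <= y -> y <= 1 ->
  (y - x) / (4 * (x * y)) <= beta x - beta y.
Proof.
move=> x0 xy y1; have y0 : 0 < y := lt_le_trans x0 xy.
have cx := is_cvg_beta x0; have cy := is_cvg_beta y0.
rewrite /beta -limB//; apply: limr_ge; first exact: is_cvgB.
exists 2%N => // n /= n2.
have -> : (series (beta_term x) - series (beta_term y)) n =
    \sum_(i < n) (-1) ^+ i * ((i%:R + x)^-1 - (i%:R + y)^-1).
  transitivity (series (beta_term x) n - series (beta_term y) n) => //.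
  rewrite /series /= !big_mkord -sumrB.
  by apply: eq_bigr => i _; rewrite /beta_term -mulrBr.
have dE i : (i%:R + x)^-1 - (i%:R + y)^-1 = (y - x) * ((i%:R + x) * (i%:R + y))^-1.
  have p k z : 0 < z -> k%:R + z != 0 :> R by move=> z0; rewrite gt_eqF// ltr_wpDl.
  by move: (p i x x0) (p i y y0) => px py; field; rewrite px py.
have yx : 0 <= y - x by rewrite subr_ge0.
apply: le_trans (@alternating_sum_ge
  (fun i => (i%:R + x)^-1 - (i%:R + y)^-1) n _ _ n2) => [|i|i].
- rewrite !dE !add0r -mulrBr ler_wpM2l//.
  have -> : (x * y)^-1 - ((1 + x) * (1 + y))^-1 =
      (1 + x + y) * ((1 + x) * (1 + y))^-1 / (x * y).
    by field; rewrite ?gt_eqF ?ltr_wpDr ?(ltW x0) ?(ltW y0).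
  rewrite invfM ler_wpM2r ?invr_ge0 ?mulr_ge0 ?(ltW x0) ?(ltW y0)//.
  rewrite ler_pdivlMr ?mulr_gt0 ?ltr_wpDr ?(ltW x0) ?(ltW y0)//; nra.
- by rewrite dE mulr_ge0// invr_ge0 mulr_ge0// addr_ge0// ltW.
- rewrite !dE ler_wpM2l//.
  have p k (z : R) : 0 < z -> 0 < k%:R + z by move=> z0; rewrite ltr_wpDl.
  rewrite lef_pV2 ?posrE ?mulr_gt0 ?p//.
  by apply: ler_pM; [exact/ltW/p|exact/ltW/p| |]; rewrite lerD2r ler_nat.
Qed.

Lemma gE x : x != 0 -> g x = sin (pi * x) / pi * beta x.
Proof. by move=> x0; rewrite /g (negbTE x0). Qed.

Lemma g0 : g 0 = 1 :> R.
Proof. by rewrite /g eqxx. Qed.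

(** With this value g is monotone on the closed interval, so that grid points at 1 can be treated
    like the others. *)
Lemma g1 : g 1 = 0 :> R.
Proof. by rewrite gE ?oner_eq0// mulr1 sinpi !mul0r. Qed.

Lemma lsum_g N k s J a : (k < N)%N -> 0 < s < 1 -> (0 < J < k)%N ->
  a = (k%:R + s) / N%:R * pi ->
  `|lsum N k (cos a) - g s| <= J.+1%:R * (4 / sin a) / N%:R + 2 / J%:R.
Proof.
move=> kN hs hJ aE; have /andP[s0 s1] := hs.
have := lsum_approx kN hs hJ aE; set S := lsum _ _ _ => h.
have J0 : 0 < J%:R :> R by rewrite ltr0n; case/andP: hJ.
have h2 := beta_approx J s0; rewrite /series /= big_mkord in h2.
have {}h2 : `|sin (pi * s) / pi * \sum_(j < J) (-1) ^+ j / (j%:R + s) - g s| <= J%:R^-1.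
  rewrite (gE (lt0r_neq0 s0)) -mulrBr normrM.
  apply: (@le_trans _ _ (J%:R + s)^-1).
    apply: le_trans h2; rewrite distrC ler_piMl// normrM.
    have p1 : `|pi^-1| <= 1 :> R.
      rewrite gtr0_norm ?invr_gt0 ?pi_gt0// invf_le1 ?pi_gt0//.
      by have := pi_ge2 R; lra.
    by rewrite mulr_ile1// sin_max.
  by rewrite lef_pV2 ?posrE ?ltr_wpDl// ?lerDl ltW.
have -> : S - g s = (S - sin (pi * s) / pi * \sum_(j < J) (-1) ^+ j / (j%:R + s)) +
  (sin (pi * s) / pi * \sum_(j < J) (-1) ^+ j / (j%:R + s) - g s) by ring.
apply: le_trans (ler_normD _ _) _; move: h h2; lra.
Qed.

(* Partition of unity for the fundamental polynomials at the angle
   [(k + s) pi / (2 k)]: its two halves tend to [g s] and [g (1 - s)]. *)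
Lemma g_reflection s : 0 < s < 1 -> g s + g (1 - s) = 1.
Proof.
move=> hs; have /andP[s0 s1] := hs; have pi0 := pi_gt0 R.
pose c : R := cos (pi / 4).
have c0 : 0 < c by apply: cos_gt0_pihalf; lra.
apply: (@eq_of_le_inverse _ _ (2 * (4 / c + 2))) => J J0.
(* [k] grows like J^2, so J + 1 kernel errors divided by N are O(1/J). The summand 2 ensures k >= 2,
   hence a - pi/2 <= pi/4 and sin a >= c. *)
pose k := (J * J.+1 + 2)%N; pose N := (k + k)%N.
have i2 : J.+1%:R * J%:R <= N%:R :> R by rewrite -natrM ler_nat /N /k; nia.
have J0' : 0 < J%:R :> R by rewrite ltr0n.
have k0 : 0 < k%:R :> R by rewrite ltr0n /k addn2.
have NE : N%:R = 2 * k%:R :> R by rewrite /N natrD; ring.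
pose a : R := (k%:R + s) / N%:R * pi.
pose b : R := (k.-1%:R + (1 - s)) / N%:R * pi.
have kS : k%:R = k.-1%:R + 1 :> R by rewrite natr1 prednK// /k addn2.
have ab : cos b = - cos a.
  by rewrite -cos_pi_sub /a /b NE kS; congr cos; field; rewrite -kS gt_eqF.
have aE : a = s * pi / (2 * k%:R) + pi / 2.
  by rewrite /a NE; field; rewrite gt_eqF.
have sa : c <= sin a.
  rewrite aE sinDpihalf; apply: cos_le; last by lra.
    by rewrite divr_ge0 ?mulr_ge0 ?ltW.
  rewrite ler_pdivrMr ?mulr_gt0//.
  have k2 : 2 <= k%:R :> R by rewrite (ler_nat _ 2) /k addn2.
  nra.
have sab : sin b = sin a.
  by rewrite -(sin_pi_sub a) /a /b NE kS; congr sin; field; rewrite -kS gt_eqF.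
have kN : (k < N)%N by rewrite /N /k; lia.
have k1N : (k.-1 < N)%N by rewrite /N /k; lia.
have Jk : (0 < J < k)%N by rewrite /k; nia.
have Jk1 : (0 < J < k.-1)%N by rewrite /k; nia.
have hs' : 0 < 1 - s < 1 by lra.
have h1 := lsum_g kN hs Jk (erefl a).
have h2 := lsum_g k1N hs' Jk1 (erefl b).
have := lsum_complement (cos a) kN.
have -> : (N - k).-1 = k.-1 by rewrite /N addnK.
rewrite -ab => unity; rewrite sab in h2.
have hE : J.+1%:R * (4 / sin a) / N%:R <= (4 / c) / J%:R.
  clear h1 h2 ab aE sab unity b.
  have N0 : 0 < N%:R :> R by rewrite NE mulr_gt0.
  rewrite ler_pdivrMr// mulrAC ler_pdivlMr//.
  have i1 : (sin a)^-1 <= c^-1 by rewrite lef_pV2// posrE// (lt_le_trans c0).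
  have i3 : 0 <= J.+1%:R * J%:R :> R by rewrite mulr_ge0.
  have i4 : 0 < c^-1 by rewrite invr_gt0.
  have -> : J.+1%:R * (4 / sin a) * J%:R = 4 * ((J.+1%:R * J%:R) / sin a) by ring.
  have -> : 4 / c * N%:R = 4 * (N%:R / c) by ring.
  rewrite ler_pM2l//.
  by apply: ler_pM => //; rewrite invr_ge0 ltW// (lt_le_trans c0).
rewrite -[X in _ - X]unity.
set S1 := lsum N k _ in h1 *; set S2 := lsum N _ _ in h2 *.
have -> : g s + g (1 - s) - (S1 + S2) = - ((S1 - g s) + (S2 - g (1 - s))) by ring.
rewrite normrN; apply: le_trans (ler_normD _ _) _.
have -> : 2 * (4 / c + 2) / J%:R = 2 * (4 / c / J%:R + 2 / J%:R) by ring.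
move: h1 h2 hE; lra.
Qed.

Lemma g_gt0 x : 0 < x < 1 -> 0 < g x.
Proof.
move=> /andP[x0 x1]; have pi0 := pi_gt0 R.
rewrite gE ?gt_eqF// !mulr_gt0 ?invr_gt0 ?beta_gt0 ?x0 ?(ltW x1)//.
by apply: sin_gt0_pi; rewrite mulr_gt0//= gtr_pMr.
Qed.

Lemma g_lt1 x : 0 < x < 1 -> g x < 1.
Proof.
move=> hx; rewrite -(g_reflection hx) ltrDl g_gt0//; lra.
Qed.

Lemma sin_pi_ge x : 0 <= x <= 1 -> pi / 2 * (x * (1 - x)) <= sin (pi * x).
Proof.
move=> /andP[x0 x1]; have pi0 := pi_gt0 R.
have h y : 0 <= y <= 2^-1 -> pi / 2 * (y * (1 - y)) <= sin (pi * y).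
  move=> /andP[y0 y2].
  have hy : pi * y / 2 <= sin (pi * y) by apply: sin_ge_half; nra.
  nra.
have [x2|x2] := leP x 2^-1; first by apply: h; rewrite x0.
have := h (1 - x); have -> : pi * (1 - x) = pi - pi * x by ring.
rewrite sin_pi_sub => h'; have := h' _; lra.
Qed.

(* With [D x := beta x + beta (1 - x) = pi / sin (pi x)] one has
   [g x = beta x / D x], so that [g x - g y] is a sum of two products of
   differences of [beta] with positive factors. *)
Lemma g_lower_lipschitz x y : 0 < x -> x <= y -> y < 1 ->
  (y - x) / 32 <= g x - g y.
Proof.
move=> x0 xy y1; have pi0 := pi_gt0 R.
have y0 : 0 < y := lt_le_trans x0 xy; have x1 : x < 1 := le_lt_trans xy y1.
have rx : g x + g (1 - x) = 1 by apply: g_reflection; rewrite x0.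
have ry : g y + g (1 - y) = 1 by apply: g_reflection; rewrite y0.
have -> : g x - g y = g x * g (1 - y) - g y * g (1 - x).
  have -> : g (1 - x) = 1 - g x by lra.
  have -> : g (1 - y) = 1 - g y by lra.
  ring.
have sE z : sin (pi * (1 - z)) = sin (pi * z).
  by rewrite -(sin_pi_sub (pi * z)); congr sin; ring.
rewrite !gE ?gt_eqF// ?subr_gt0// !sE.
set A := beta x - beta y; set B := beta (1 - y); set C := beta y.
pose D := beta (1 - y) - beta (1 - x).
set sx := sin (pi * x); set sy := sin (pi * y).
have -> : sx / pi * beta x * (sy / pi * B) - sy / pi * C * (sx / pi * beta (1 - x)) =
  (sx / pi) * (sy / pi) * (A * B + C * D) by rewrite /A /B /C /D; ring.
have hA : (y - x) / (4 * (x * y)) <= A by apply: beta_difference => //; apply: ltW.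
have hB : (2 * (1 - y))^-1 <= B by apply: beta_lower; lra.
have hC : (2 * y)^-1 <= C by apply: beta_lower; lra.
have hD : (y - x) / (4 * ((1 - y) * (1 - x))) <= D.
  have -> : y - x = (1 - x) - (1 - y) by ring.
  by apply: beta_difference; lra.
have hsx : x * (1 - x) / 2 <= sx / pi.
  rewrite ler_pdivlMr//; have := @sin_pi_ge x; rewrite -/sx => h.
  have := h _; lra.
have hsy : y * (1 - y) / 2 <= sy / pi.
  rewrite ler_pdivlMr//; have := @sin_pi_ge y; rewrite -/sy => h.
  have := h _; lra.
have x1' : 0 < 1 - x by lra.
have y1' : 0 < 1 - y by lra.
have d0 : 0 <= y - x by lra.
have hAB : (y - x) / (4 * (x * y)) * (2 * (1 - y))^-1 <= A * B.
  by apply: ler_pM => //; rewrite ?divr_ge0 ?invr_ge0 ?mulr_ge0// ltW.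
have hCD : (2 * y)^-1 * ((y - x) / (4 * ((1 - y) * (1 - x)))) <= C * D.
  by apply: ler_pM => //; rewrite ?divr_ge0 ?invr_ge0 ?mulr_ge0// ltW.
have hss : x * (1 - x) / 2 * (y * (1 - y) / 2) <= sx / pi * (sy / pi).
  by apply: ler_pM => //; rewrite ?divr_ge0 ?mulr_ge0// ltW.
(* After cancellation the two summands are (1 - x)(y - x)/32 and x (y - x)/32; their weights add up
   to 1, and 32 = 2 . 2 . 8. *)
have -> : (y - x) / 32 = x * (1 - x) / 2 * (y * (1 - y) / 2) *
  ((y - x) / (4 * (x * y)) * (2 * (1 - y))^-1 +
   (2 * y)^-1 * ((y - x) / (4 * ((1 - y) * (1 - x))))).
  by field; rewrite !gt_eqF.
apply: ler_pM => //; last exact: lerD.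
  by rewrite ?mulr_ge0 ?invr_ge0// ltW.
by rewrite addr_ge0 ?mulr_ge0 ?invr_ge0 ?mulr_ge0// ltW.
Qed.

Lemma g_bounds x : 0 <= x <= 1 -> 0 <= g x <= 1.
Proof.
move=> /andP[x0 x1].
have [->|xn0] := eqVneq x 0; first by rewrite g0 ler01 lexx.
have [->|xn1] := eqVneq x 1; first by rewrite g1 lexx ler01.
have hx : 0 < x < 1 by rewrite !lt_neqAle x0 x1 xn1 eq_sym xn0.
by rewrite !ltW ?g_gt0 ?g_lt1.
Qed.

Lemma g_nonincreasing x y : 0 <= x -> x <= y -> y <= 1 -> g y <= g x.
Proof.
move=> x0 xy y1.
have [->|xn0] := eqVneq x 0.
  by rewrite g0; have /g_bounds/andP[] : 0 <= y <= 1 by rewrite y1 (le_trans x0).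
have [->|yn1] := eqVneq y 1.
  by rewrite g1; have /g_bounds/andP[] : 0 <= x <= 1 by rewrite x0 (le_trans xy).
have := @g_lower_lipschitz x y; rewrite !lt_neqAle x0 xy y1 yn1 eq_sym xn0.
move=> /(_ isT isT isT); lra.
Qed.

Lemma g_injective x y : 0 <= x < 1 -> 0 <= y < 1 -> g x = g y -> x = y.
Proof.
wlog xy : x y / x <= y.
  move=> W hx hy e; case: (leP x y) => [xy|/ltW yx]; first exact: W.
  by apply/esym/W.
move=> /andP[x0 x1] /andP[y0 y1] e; apply/eqP; rewrite eq_le xy /=.
have [x00|xn0] := eqVneq x 0; last first.
  have := @g_lower_lipschitz x y; rewrite !lt_neqAle x0 eq_sym xn0 => /(_ isT xy).
  by rewrite -lt_neqAle y1 e => /(_ isT); lra.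
have [y00|yn0] := eqVneq y 0; first by rewrite y00.
have /g_lt1 : 0 < y < 1 by rewrite lt_neqAle eq_sym yn0 y0.
by rewrite -e x00 g0 ltxx.
Qed.

End LimitFunction.

(** * Densities and indices *)

Section Densities.
Variable R : realType.
Implicit Types (K : set (nat * nat)) (P Q : set nat) (n : nat) (c e : R).

Local Notation ratio := (density_ratio R).

Definition counting P n : nat := (\sum_(i < n) `[< P i.+1 >])%N.
Definition frequency P n : R := (counting P n)%:R / n%:R.

Lemma square_cardE K n :
  square_card K n = (\sum_(i < n) \sum_(j < n) `[< K (i.+1, j.+1) >])%N.
Proof.
rewrite /square_card -sum1_card pair_bigA /= big_mkcond /=.
by apply: eq_bigr => -[i j] _; rewrite inE /=; case: asboolP.
Qed.

Lemma square_card_prod P Q n :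
  square_card [set nm | P nm.1 /\ Q nm.2] n = (counting P n * counting Q n)%N.
Proof.
rewrite square_cardE /counting big_distrl; apply: eq_bigr => i _.
rewrite -[RHS]/(_ * _)%N big_distrr; apply: eq_bigr => j _.
by rewrite /= asbool_and; case: asboolP => _; case: asboolP.
Qed.

Lemma counting_setT n : counting setT n = n.
Proof.
rewrite /counting (eq_bigr (fun _ => 1%N)) ?sum1_card ?card_ord// => i _.
by case: asboolP => // /(_ I).
Qed.

Lemma ratio_prod P Q n :
  ratio [set nm | P nm.1 /\ Q nm.2] n = frequency P n * frequency Q n.
Proof.
by rewrite /density_ratio square_card_prod natrM natrX expr2 invfM mulrACA.
Qed.

Lemma ratio_fst P n : ratio [set nm | P nm.1] n = frequency P n.
Proof.
have -> : [set nm : nat * nat | P nm.1] = [set nm | P nm.1 /\ setT nm.2].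
  by apply/seteqP; split => // x [].
rewrite ratio_prod /frequency counting_setT.
by case: n => [|n]; rewrite ?invr0 ?mulr0 ?mul0r// divff// ?mulr1 ?pnatr_eq0.
Qed.

Lemma ratio_snd P n : ratio [set nm | P nm.2] n = frequency P n.
Proof.
have -> : [set nm : nat * nat | P nm.2] = [set nm | setT nm.1 /\ P nm.2].
  by apply/seteqP; split => // x [].
rewrite ratio_prod /frequency counting_setT.
by case: n => [|n]; rewrite ?invr0 ?mulr0 ?mul0r// divff// ?mul1r ?pnatr_eq0.
Qed.

Lemma ratio_le K K' n : (forall nm, K nm -> K' nm) -> ratio K n <= ratio K' n.
Proof.
move=> KK'; rewrite ler_wpM2r ?invr_ge0// ler_nat !square_cardE.
do 2!(apply: leq_sum => ? _); case: asboolP => // /KK' ?.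
by case: asboolP.
Qed.

Lemma ratio_ge0 K n : 0 <= ratio K n.
Proof. by rewrite divr_ge0. Qed.

Lemma ratio_setT n : (0 < n)%N -> ratio setT n = 1.
Proof.
move=> n0; have -> : [set: nat * nat] = [set nm | setT nm.1 /\ setT nm.2].
  by apply/seteqP; split.
by rewrite ratio_prod /frequency counting_setT divff ?mulr1// pnatr_eq0 -lt0n.
Qed.

Lemma ratio_le1 K n : ratio K n <= 1.
Proof.
case: n => [|n]; first by rewrite /density_ratio exp0n// invr0 mulr0.
by rewrite -(@ratio_setT n.+1)//; apply: ratio_le.
Qed.

Lemma ratio_bigcup (I : finType) (A : pred I) (F : I -> set (nat * nat)) K n :
  (forall nm, K nm -> exists2 i, A i & F i nm) ->
  ratio K n <= \sum_(i | A i) ratio (F i) n.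
Proof.
move=> h; rewrite -mulr_suml ler_wpM2r ?invr_ge0// -natr_sum ler_nat.
rewrite square_cardE (eq_bigr _ (fun i _ => square_cardE (F i) n)).
rewrite [X in (_ <= X)%N]exchange_big; apply: leq_sum => a _.
rewrite [X in (_ <= X)%N]exchange_big; apply: leq_sum => b _.
case: asboolP => // /h[i Ai Fi]; rewrite (bigD1 i)//=.
by case: asboolP.
Qed.

Lemma ratio_disjoint (I : finType) (A : pred I) (F : I -> set (nat * nat)) K n :
  (forall nm i, A i -> F i nm -> K nm) ->
  (forall nm i j, F i nm -> F j nm -> i = j) ->
  \sum_(i | A i) ratio (F i) n <= ratio K n.
Proof.
move=> h d; rewrite -mulr_suml ler_wpM2r ?invr_ge0// -natr_sum ler_nat.
rewrite square_cardE (eq_bigr _ (fun i _ => square_cardE (F i) n)).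
rewrite exchange_big; apply: leq_sum => a _.
rewrite exchange_big; apply: leq_sum => b _.
case: asboolP => Kab; last first.
  rewrite big1// => i Ai; case: asboolP => // /(h _ _ Ai); contradiction.
have [/existsP[i0 /andP[Ai0 /asboolP Fi0]]|] :=
    boolP [exists i, A i && `[< F i (a.+1, b.+1) >]].
  rewrite (bigD1 i0)//= big1 ?addn0 => [|i /andP[_ ii0]]; first by case: asboolP.
  by case: asboolP => // /(d _ _ _ Fi0) e; rewrite e eqxx in ii0.
rewrite negb_exists => /forallP nex; rewrite big1// => i Ai.
by have := nex i; rewrite Ai /= => /negbTE ->.
Qed.

Lemma ratio_setU K K' n : ratio (K `|` K') n <= ratio K n + ratio K' n.
Proof.
have := @ratio_bigcup bool predT (fun b => if b then K else K') (K `|` K') n.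
rewrite big_bool; apply => nm [Kn|Kn]; first by exists true.
by exists false.
Qed.

Lemma ratio_setC K n : (0 < n)%N -> ratio (~` K) n = 1 - ratio K n.
Proof.
move=> n0; apply/eqP; rewrite eq_le; apply/andP; split; last first.
  rewrite lerBlDr -(ratio_setT n0).
  by apply: le_trans (ratio_setU _ _ _); rewrite setUC setUv.
rewrite lerBrDr; have := @ratio_disjoint bool predT
  (fun b => if b then ~` K else K) setT n.
rewrite big_bool ratio_setT//; apply=> // nm [] [] //=.
Qed.

(** Pairs with a coordinate at most N0 fill a fraction at most 2 N0 / n of the square, so estimates
    valid only for large n and m still control densities. *)
Lemma ratio_eventually_le K K' (N0 : nat) e : 0 < e ->
  (forall n m, (N0 <= n)%N -> (N0 <= m)%N -> K (n, m) -> K' (n, m)) ->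
  \forall n \near \oo, ratio K n <= ratio K' n + e.
Proof.
(* The added 1 keeps the divisor positive when N0 = 0. *)
move=> e0 h; have p : 0 < 2 * N0%:R + 1 :> R by rewrite ltr_wpDl// mulr_ge0.
have [m m0 me] := small_inverse (divr_gt0 e0 p).
exists m => // n /= mn; have n0 : (0 < n)%N := leq_trans m0 mn.
have fN0 : frequency [set k | (k <= N0)%N] n <= N0%:R / n%:R.
  rewrite ler_wpM2r ?invr_ge0// ler_nat /counting.
  rewrite (eq_bigr (fun i : 'I_n => (i < N0)%N : nat)); last first.
    by move=> i _; congr nat_of_bool; apply/asboolP/idP.
  rewrite -big_mkcond /= sum1_card.
  have [nN|Nn] := leqP n N0; first by rewrite (leq_trans (max_card _))// card_ord.
  rewrite -[X in (_ <= X)%N]card_ord -(card_in_imset (f := widen_ord (ltnW Nn)) (D := predT)).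
    apply: subset_leq_card; apply/fintype.subsetP => i; rewrite -[_ \in _]/(i < N0)%N => iN.
    by apply/imsetP; exists (Ordinal iN) => //; apply/val_inj.
  by move=> i j _ _ /(congr1 val) /= ij; apply/val_inj.
have : ratio K n <= ratio K' n + e.
  apply: (@le_trans _ _ (ratio (K' `|` ([set nm | (nm.1 <= N0)%N] `|`
      [set nm | (nm.2 <= N0)%N])) n)).
    apply: ratio_le => -[a b] Kab; case: (leqP a N0) => [aN|aN].
      by right; left.
    case: (leqP b N0) => [bN|bN]; first by right; right.
    by left; apply: h => //; apply: ltnW.
  apply: le_trans (ratio_setU _ _ _) _; rewrite lerD2l.
  apply: le_trans (ratio_setU _ _ _) _.
  rewrite (ratio_fst [set k | (k <= N0)%N]) (ratio_snd [set k | (k <= N0)%N]).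
  apply: (le_trans (lerD fN0 fN0)).
  have n0' : 0 < n%:R :> R by rewrite ltr0n.
  have hn : n%:R^-1 < e / (2 * N0%:R + 1).
    by apply: le_lt_trans me; rewrite lef_pV2 ?posrE ?ltr0n// ler_nat.
  rewrite ltr_pdivlMr// in hn.
  have ninv : 0 < n%:R^-1 :> R by rewrite invr_gt0.
  move: hn ninv; lra.
by [].
Qed.

Lemma upper_densityE K :
  upper_density R K = inf (range (sups (ratio K))).
Proof.
apply: limn_supE; exists 1; split; first exact: num_real.
move=> M M1 n _ /=; rewrite ger0_norm ?ratio_ge0//.
by rewrite (le_trans (ratio_le1 _ _))// ltW.
Qed.

Let has_ubound_sdrop K n : has_ubound (sdrop (ratio K) n).
Proof. by exists 1 => _ [k _ <-]; exact: ratio_le1. Qed.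

Let has_lbound_sups K : has_lbound (range (sups (ratio K))).
Proof.
exists 0 => _ [n _ <-]; apply: le_trans (ratio_ge0 K n) _.
by apply: ub_le_sup; [exact: has_ubound_sdrop|exists n => //=].
Qed.

Lemma upper_density_le K c :
  (forall e, 0 < e -> \forall n \near \oo, ratio K n <= c + e) ->
  upper_density R K <= c.
Proof.
move=> h; rewrite upper_densityE; apply/ler_addgt0Pr => e e0.
have [N _ hN] := h e e0.
apply: (@le_trans _ _ (sups (ratio K) N)).
  by apply: ge_inf; [exact: has_lbound_sups|exists N].
apply: ge_sup; first by exists (ratio K N); exists N => //=.
by move=> _ [k /= Nk <-]; apply: hN.
Qed.

Lemma upper_density_ge K c :
  (forall e, 0 < e -> \forall n \near \oo, c - e <= ratio K n) ->
  c <= upper_density R K.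
Proof.
move=> h; rewrite upper_densityE; apply: lb_le_inf.
  by exists (sups (ratio K) 0%N); exists 0%N.
move=> _ [m _ <-]; apply/ler_addgt0Pr => e e0; rewrite -lerBlDr.
have [N _ hN] := h e e0.
apply: le_trans (hN (maxn N m) _) _; first exact: leq_maxl.
by apply: ub_le_sup; [exact: has_ubound_sdrop|exists (maxn N m) => //=; exact: leq_maxr].
Qed.

Section Index.
Variables (D : R -> set (nat * nat)) (v : R).
Hypothesis upper : forall e, 0 < e -> upper_density R (D e) <= 1 - v.
Hypothesis lower : forall eta, 0 < eta ->
  exists2 e, 0 < e & 1 - v - eta <= upper_density R (D e).

(** Both kinds of index unfold to this shape, with [D e] the pairs whose term stays outside the
    e-neighbourhood. *)
Lemma index_eq :
  1 - sup [set upper_density R (D e) | e in [set e : R | 0 < e]] = v.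
Proof.
suff -> : sup [set upper_density R (D e) | e in [set e : R | 0 < e]] = 1 - v by ring.
apply/eqP; rewrite eq_le; apply/andP; split.
  apply: ge_sup; first by exists (upper_density R (D 1)); exists 1 => //=.
  by move=> _ [e /= e0 <-]; apply: upper.
apply/ler_addgt0Pr => eta eta0; rewrite -lerBlDr.
have [e e0 he] := lower eta0; apply: le_trans he _.
apply: ub_le_sup; last by exists e.
by exists (1 - v) => _ [e' /= e'0 <-]; apply: upper.
Qed.

End Index.

Lemma index_ge (D : R -> set (nat * nat)) (v : R) :
  (forall e, 0 < e -> upper_density R (D e) <= 1 - v) ->
  v <= 1 - sup [set upper_density R (D e) | e in [set e : R | 0 < e]].
Proof.
move=> upper; rewrite lerBrDr -lerBrDl; apply: ge_sup.
  by exists (upper_density R (D 1)); exists 1 => //=.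
by move=> _ [e /= e0 <-]; apply: upper.
Qed.

End Densities.

(** * Sequences that approach finitely many values on classes with a density *)

Section FiniteClasses.
Variables (R : realType) (J : finType) (cl : nat * nat -> J) (w : J -> R).
Variables (z : nat -> nat -> R) (d : J -> R).
Hypothesis z_close : forall e : R, 0 < e -> exists N0, forall n m,
  (N0 <= n)%N -> (N0 <= m)%N -> `|z n m - w (cl (n, m))| < e.
Hypothesis cl_density : forall j,
  density_ratio R [set nm | cl nm = j] @ \oo --> d j.

Let P (a : pred J) := [set nm | a (cl nm)].

Lemma class_density (a : pred J) :
  density_ratio R (P a) @ \oo --> \sum_(j | a j) d j.
Proof.
have -> : density_ratio R (P a) =
    (fun n => \sum_(j | a j) density_ratio R [set nm | cl nm = j] n).
  apply/funext => n; apply/eqP; rewrite eq_le; apply/andP; split.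
    by apply: ratio_bigcup => nm anm; exists (cl nm).
  apply: ratio_disjoint => [nm j aj /= cj|nm i j /= <- //].
  by rewrite /P /= cj.
by apply: cvg_big => [|j _]; [exact: add_continuous|exact: cl_density].
Qed.

Lemma class_density_sum : \sum_j d j = 1.
Proof.
have h := @class_density predT; apply/esym; apply: (cvg_unique _ _ h) => //.
apply: cvg_near_cst; exists 1%N => // n /= n0.
by rewrite (_ : P predT = setT) ?ratio_setT//; apply/seteqP; split.
Qed.

(** For a radius below the distance from v to the other values, the exceptional set is eventually
    the union of the classes with w j != v. Classes sharing the value v add up. *)
Lemma index_pt_classes v : index_pt z v = \sum_(j | w j == v) d j.
Proof.
have dE : 1 - \sum_(j | w j == v) d j = \sum_(j | w j != v) d j.
  by rewrite -class_density_sum (bigID (fun j => w j == v)) /= [X in X - _]addrC addrK.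
apply: index_eq => e e0; rewrite dE.
  apply: upper_density_le => eta eta0.
  have eta2 : 0 < eta / 2 by rewrite divr_gt0.
  have [N0 hN0] := z_close e0.
  have /cvgrPdist_le /(_ _ eta2) h := @class_density (fun j => w j != v).
  have h' := @ratio_eventually_le R
    [set nm | z nm.1 nm.2 \notin `]v - e, v + e[] (P (fun j => w j != v)) N0 _ eta2.
  near=> n.
  have h1 : `|\sum_(j | w j != v) d j - density_ratio R (P (fun j => w j != v)) n| <= eta / 2.
    by near: n.
  have h2 : density_ratio R [set nm | z nm.1 nm.2 \notin `]v - e, v + e[] n <=
    density_ratio R (P (fun j => w j != v)) n + eta / 2.
    near: n; apply: h' => n m nN mN /=; rewrite in_itv /= /P /=.
    apply: contraNN => /eqP wv; have := hN0 n m nN mN; rewrite wv.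
    by rewrite ltr_distl.
  move: h1; rewrite ler_distl => /andP[h1 _]; move: h1 h2; lra.
have [gap gap0 hgap] : exists2 gap, 0 < gap & forall j, w j != v -> gap <= `|w j - v|.
  (* The default 1 covers the case where every class has value v. *)
  exists (\big[Num.min/1]_(j | w j != v) `|w j - v|).
    by apply: lt_bigmin => // j wj; rewrite normr_gt0 subr_eq0.
  by move=> j wj; apply: bigmin_le_cond.
have gap2 : 0 < gap / 2 by rewrite divr_gt0.
exists (gap / 2) => //; apply: upper_density_ge => eta eta0.
have eta2 : 0 < eta / 2 by rewrite divr_gt0.
have [N0 hN0] := z_close gap2.
have /cvgrPdist_le /(_ _ eta2) h := @class_density (fun j => w j != v).
have h' := @ratio_eventually_le R (P (fun j => w j != v))
  [set nm | z nm.1 nm.2 \notin `]v - gap / 2, v + gap / 2[] N0 _ eta2.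
near=> n.
have h1 : `|\sum_(j | w j != v) d j - density_ratio R (P (fun j => w j != v)) n| <= eta / 2.
  by near: n.
have h2 : density_ratio R (P (fun j => w j != v)) n <=
   density_ratio R [set nm | z nm.1 nm.2 \notin `]v - gap / 2, v + gap / 2[] n + eta / 2.
  near: n; apply: h' => n m nN mN /=; rewrite in_itv /= /P /= => wv.
  rewrite -ltr_distl; apply/negP => zv; have := hgap _ wv; rewrite leNgt => /negP; apply.
  have -> : w (cl (n, m)) - v = - (z n m - w (cl (n, m))) + (z n m - v) by ring.
  apply: le_lt_trans (ler_normD _ _) _; rewrite normrN.
  have := hN0 n m nN mN; move: zv; lra.
move: h1; rewrite ler_distl => /andP[_ h1]; move: h1 h2; lra.
Unshelve. all: by end_near. Qed.

End FiniteClasses.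

(** * Equidistribution of rotations *)

Section Blocks.
Implicit Types (F : nat -> nat) (q K n : nat).

Lemma sum_blocks F q b : (\sum_(i < b * q) F i =
  \sum_(c < b) \sum_(j < q) F (c * q + j))%N.
Proof.
elim: b => [|b IH]; first by rewrite mul0n !big_ord0.
by rewrite mulSn addnC big_split_ord /= IH big_ord_recr.
Qed.

Lemma sum_widen F n m : (n <= m)%N -> (\sum_(i < n) F i <= \sum_(i < m) F i)%N.
Proof.
by move=> nm; rewrite -(subnKC nm) big_split_ord /= leq_addr.
Qed.

Lemma sum_blocks_le F q K n : (0 < q)%N ->
  (forall c, (\sum_(j < q) F (c + j) <= K)%N) ->
  (\sum_(i < n) F i <= (n %/ q).+1 * K)%N.
Proof.
move=> q0 h; apply: leq_trans (@sum_widen F n ((n %/ q).+1 * q) _) _.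
  by rewrite ltnW// -ltn_divLR.
rewrite sum_blocks; apply: leq_trans (leq_sum _ (fun c _ => h _)) _.
by rewrite sum_nat_const card_ord.
Qed.

Lemma sum_blocks_ge F q K n : (0 < q)%N ->
  (forall c, (K <= \sum_(j < q) F (c + j))%N) ->
  (n %/ q * K <= \sum_(i < n) F i)%N.
Proof.
move=> q0 h; apply: leq_trans (_ : \sum_(i < n %/ q * q) F i <= _)%N.
  rewrite sum_blocks; apply: leq_trans (leq_sum _ (fun c _ => h _)).
  by rewrite sum_nat_const card_ord.
by apply: sum_widen; apply: leq_trunc_div.
Qed.

End Blocks.

Section Rotation.
Variable R : realType.

Lemma inverse_nat_lt (m n : nat) (e : R) : (0 < m)%N -> (m <= n)%N ->
  m%:R^-1 < e -> n%:R^-1 < e.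
Proof.
move=> m0 mn; apply: le_lt_trans.
by rewrite lef_pV2 ?posrE ?ltr0n ?(leq_trans m0)// ler_nat.
Qed.

Implicit Types (alpha a b e : R).

(** Fractional part of i alpha; [Num.truncn] is the floor on nonnegative reals, so this is used with
    0 <= alpha. *)
Definition rotation alpha (i : nat) : R :=
  i%:R * alpha - (Num.truncn (i%:R * alpha))%:R.

Lemma rotation_itv alpha i : 0 <= alpha -> 0 <= rotation alpha i < 1.
Proof.
move=> a0; have /truncn_itv/andP[h1 h2] : 0 <= i%:R * alpha by rewrite mulr_ge0.
by rewrite subr_ge0 h1 ltrBlDl natr1.
Qed.

Lemma irrational_mul_neq alpha (q p : nat) : irrational alpha -> (0 < q)%N ->
  q%:R * alpha != p%:R.
Proof.
move=> ira q0; apply/eqP => e; apply: ira.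
apply/rationalP; exists p%:Z, q; rewrite -[p%:~R]/(p%:R : R).
by rewrite -e mulrAC divff ?mul1r// pnatr_eq0 -lt0n.
Qed.

Lemma rotation_gt0 alpha i : 0 <= alpha -> irrational alpha -> (0 < i)%N ->
  0 < rotation alpha i.
Proof.
move=> a0 ira i0; have /andP[h _] := rotation_itv i a0.
by rewrite lt_neqAle h andbT eq_sym subr_eq0 irrational_mul_neq.
Qed.

(** This forces a good rational approximation to have a denominator above B. *)
Lemma irrational_gap alpha (B : nat) : 0 <= alpha -> irrational alpha ->
  exists2 eta, 0 < eta & forall q p : nat, (0 < q <= B)%N ->
    eta <= `|q%:R * alpha - p%:R|.
Proof.
move=> a0 ira; elim: B => [|B [eta eta0 h]].
  by exists 1 => // q p; case: q.
have f0 := rotation_gt0 a0 ira (ltn0Sn B).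
have /andP[_ f1] := rotation_itv B.+1 a0.
exists (Num.min eta (Num.min (rotation alpha B.+1) (1 - rotation alpha B.+1))).
  by rewrite !lt_min eta0 f0 subr_gt0.
move=> q p /andP[q0]; rewrite leq_eqVlt => /orP[/eqP ->|qB]; last first.
  by rewrite ge_min h ?q0.
rewrite ge_min; apply/orP; right; rewrite ge_min.
case: (leqP p (Num.truncn (B.+1%:R * alpha))) => hp; apply/orP; [left|right].
  apply: le_trans (ler_norm _); rewrite lerD2l lerN2 ler_nat//.
rewrite distrC; apply: le_trans (ler_norm _).
have : (Num.truncn (B.+1%:R * alpha)).+1%:R <= p%:R :> R by rewrite ler_nat.
rewrite -natr1 /rotation; lra.
Qed.

Lemma dirichlet alpha (Q : nat) : 0 <= alpha -> (0 < Q)%N ->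
  exists q p : nat, (0 < q <= Q)%N /\ `|q%:R * alpha - p%:R| < Q%:R^-1.
Proof.
move=> a0 Q0; have Q0' : 0 < Q%:R :> R by rewrite ltr0n.
have fQ (i : 'I_Q.+1) : (Num.truncn (Q%:R * rotation alpha i) < Q)%N.
  have /andP[h0 h1] := rotation_itv i a0.
  rewrite -(ltr_nat R); apply: (@le_lt_trans _ _ (Q%:R * rotation alpha i)).
    by have /truncn_itv/andP[] : 0 <= Q%:R * rotation alpha i by rewrite mulr_ge0.
  by rewrite gtr_pMr.
pose f (i : 'I_Q.+1) := Ordinal (fQ i).
have : ~~ injectiveb f.
  apply/negP => /injectiveP /leq_card; rewrite !card_ord.
  by rewrite ltnn.
case/injectivePn => x [y xy fxy].
wlog lxy : x y xy fxy / (x < y)%N.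
  move=> W; case: (ltngtP x y) => [|yx|/val_inj e]; first exact: W.
    by apply: (W y x) => //; rewrite eq_sym.
  by rewrite e eqxx in xy.
exists (y - x)%N, (Num.truncn (y%:R * alpha) - Num.truncn (x%:R * alpha))%N.
split; first by have := ltn_ord y; lia.
have tm : (Num.truncn (x%:R * alpha) <= Num.truncn (y%:R * alpha))%N.
  by apply: le_truncn; rewrite ler_wpM2r// ler_nat ltnW.
rewrite !natrB ?(ltnW lxy)//.
have -> : (y%:R - x%:R) * alpha -
   ((Num.truncn (y%:R * alpha))%:R - (Num.truncn (x%:R * alpha))%:R) =
   rotation alpha y - rotation alpha x by rewrite /rotation; ring.
have h i : (Num.truncn (Q%:R * rotation alpha i))%:R <= Q%:R * rotation alpha i
    < (Num.truncn (Q%:R * rotation alpha i))%:R + 1.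
  have /andP[h0 h1] := rotation_itv i a0.
  have /truncn_itv : 0 <= Q%:R * rotation alpha i by rewrite mulr_ge0.
  by rewrite natr1.
have := h x; have := h y; have /(congr1 val) /= -> := fxy => /andP[h1 h2] /andP[h3 h4].
rewrite -[ltRHS]mul1r ltr_pdivlMr// -[X in _ * X](gtr0_norm Q0') -normrM ltr_norml.
by apply/andP; split; lra.
Qed.

(** Dirichlet's theorem is applied with 1/Q below the gap for denominators up to B. Dividing q and p
    by their gcd only decreases |q alpha - p|, so the reduced denominator exceeds B as well. *)
Lemma coprime_approximation alpha (B : nat) : 0 <= alpha -> irrational alpha ->
  exists q p : nat, [/\ (B < q)%N, coprime p q &
    `|q%:R * alpha - p%:R| <= q%:R^-1].
Proof.
move=> a0 ira; have [eta eta0 heta] := irrational_gap B a0 ira.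
have [Q Q0 hQ] := small_inverse eta0.
have [q [p [/andP[q0 qQ] hqp]]] := dirichlet a0 Q0.
pose d := gcdn p q; have d0 : (0 < d)%N by rewrite gcdn_gt0 q0 orbT.
have qd : q = (q %/ d * d)%N by rewrite divnK// dvdn_gcdr.
have pd : p = (p %/ d * d)%N by rewrite divnK// dvdn_gcdl.
have q'0 : (0 < q %/ d)%N by rewrite divn_gt0// dvdn_leq// dvdn_gcdr.
have le : `|(q %/ d)%:R * alpha - (p %/ d)%:R| <= `|q%:R * alpha - p%:R|.
  rewrite [in leRHS]qd [in leRHS]pd !natrM.
  rewrite -[in leRHS]mulrA [d%:R * alpha]mulrC mulrA -mulrBl normrM.
  by rewrite ler_peMr// ger0_norm// ler1n.
exists (q %/ d)%N, (p %/ d)%N; split.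
- rewrite ltnNge; apply/negP => qB.
  have := heta (q %/ d)%N (p %/ d)%N; rewrite q'0 qB => /(_ isT).
  by rewrite leNgt (le_lt_trans le)// (lt_trans hqp).
- by rewrite /coprime -(eqn_pmul2r d0) mul1n muln_gcdl -pd -qd.
- apply: le_trans le _; apply: ltW; apply: lt_le_trans hqp _.
  rewrite lef_pV2 ?posrE ?ltr0n// ler_nat.
  by apply: leq_trans qQ; apply: leq_div.
Qed.

(** An arc of R/Z given by a lift [a, b]; the free integer k allows arcs that pass through 0. *)
Definition on_circle alpha a b (i : nat) : Prop :=
  exists k : int, a <= i%:R * alpha - k%:~R <= b.

(* In a block of [q] consecutive indices the points are within [1/q] of the
   [q] translates of a lattice of step [1/q]. *)
Lemma circle_block alpha (q p c : nat) a b : (0 < q)%N -> coprime p q ->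
  `|q%:R * alpha - p%:R| <= q%:R^-1 -> a <= b ->
  (\sum_(j < q) `[< on_circle alpha a b (c + j) >] <=
    (Num.truncn (q%:R * (b - a) + 3)).+1)%N.
Proof.
move=> q0 pq hqp ab; have q0' : 0 < q%:R :> R by rewrite ltr0n.
pose u := q%:R * (a - c%:R * alpha) - 1.
pose v := q%:R * (b - c%:R * alpha) + 1.
rewrite -big_mkcond /= sum1_card.
pose k (j : 'I_q) : int :=
  xget 0 [set k : int | a <= (c + j)%:R * alpha - k%:~R <= b].
have kP (j : 'I_q) : on_circle alpha a b (c + j) ->
    a <= (c + j)%:R * alpha - (k j)%:~R <= b.
  by case=> k0 hk0; rewrite /k; case: xgetP => [k1 -> //|/(_ k0)]; contradiction.
(* Up to a fixed shift, q times the j-th point is within 1 of the integer [m j], and m j determines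
   j modulo q because p is invertible. So it suffices to count integers in [u, v], of length q (b -
   a) + 2; counting from the floor of u adds one more. *)
pose m (j : 'I_q) : int := j%:Z * p%:Z - k j * q%:Z.
have mP (j : 'I_q) : on_circle alpha a b (c + j) -> u <= (m j)%:~R <= v.
  move=> /kP/andP[h1 h2].
  have hj : `|j%:R * (q%:R * alpha - p%:R)| <= 1.
    rewrite normrM ger0_norm//; apply: (@le_trans _ _ (q%:R * q%:R^-1)).
      by apply: ler_pM => //; rewrite ler_nat ltnW.
    by rewrite divff// gt_eqF.
  have mE : (m j)%:~R = q%:R * ((c + j)%:R * alpha - (k j)%:~R) -
      q%:R * (c%:R * alpha) - j%:R * (q%:R * alpha - p%:R) :> R.
    by rewrite /m rmorphB !rmorphM /= natrD; ring.
  rewrite -(ler_pM2l q0') in h1; rewrite -(ler_pM2l q0') in h2.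
  rewrite mE /u /v; move: hj; rewrite ler_norml => /andP[h3 h4].
  by apply/andP; split; move: h1 h2 h3 h4; lra.
have fu (j : 'I_q) : on_circle alpha a b (c + j) -> (Num.floor u <= m j)%R.
  move=> /mP/andP[h _]; rewrite -(ler_int R).
  by apply: le_trans h; apply: floor_le_tmp.
pose N := (Num.truncn (q%:R * (b - a) + 3)).+1.
have hN (j : 'I_q) : on_circle alpha a b (c + j) ->
    (`|m j - Num.floor u|%N < N)%N.
  move=> hj; rewrite /N ltnS truncn_ge_nat; last first.
    by rewrite addr_ge0 ?mulr_ge0 ?subr_ge0.
  have -> : (`|m j - Num.floor u|%N)%:R = (m j - Num.floor u)%:~R :> R.
    by rewrite natr_absz ger0_norm// subr_ge0 fu.
  have /andP[_ h2] := mP j hj; have := floorD1_gt u.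
  by rewrite rmorphB /= rmorphD /=; move: h2; rewrite /u /v; lra.
pose f (j : 'I_q) : 'I_N := inord `|m j - Num.floor u|%N.
rewrite -/N -[X in (_ <= X)%N]card_ord; apply: (@leq_card_in _ _ f) => i j.
rewrite !unfold_in => /asboolP hi /asboolP hj /(congr1 val).
rewrite /= !inordK ?hN// => e.
have {}e : m i = m j.
  have := fu i hi; have := fu j hj; move: e; lia.
wlog ij : i j hi hj e / (i <= j)%N.
  by move=> W; case: (leqP i j) => [|/ltnW] ij; [exact: W|apply/esym; exact: W].
apply/val_inj/eqP; rewrite eqn_leq ij /= -subn_eq0.
have : (q %| (j - i) * p)%N.
  have : ((j - i) * p)%N%:Z = (k j - k i) * q%:Z.
    by rewrite PoszM -subzn// mulrBl; move: e; rewrite /m; lia.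
  by move=> /(congr1 absz); rewrite abszM absz_nat => ->; apply: dvdn_mull.
rewrite Gauss_dvdl ?(coprime_sym q)// => /dvdn_leq h.
rewrite -leqn0 leqNgt; apply/negP => ji; have := h ji.
by have := ltn_ord j; lia.
Qed.

(** At most n/q + 1 blocks with at most q (b - a) + 4 points each: 4/q <= e/2 fixes q, then (q +
    4)/n <= e/2 fixes n. Neither choice depends on the arc, and this uniformity is essential later,
    where the arc varies with the row. *)
Lemma circle_upper alpha e : 0 <= alpha -> irrational alpha -> 0 < e ->
  \forall n \near \oo, forall a b, a <= b ->
    (\sum_(i < n) `[< on_circle alpha a b i >])%:R / n%:R <= b - a + e.
Proof.
move=> a0 ira e0; have e8 : 0 < e / 8 by rewrite divr_gt0.
have [B B0 hB] := small_inverse e8.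
have [q [p [Bq pq hqp]]] := coprime_approximation B a0 ira.
have q0 : (0 < q)%N := leq_ltn_trans (leq0n _) Bq.
have q0' : 0 < q%:R :> R by rewrite ltr0n.
have hq : q%:R^-1 < e / 8.
  exact: inverse_nat_lt (ltnW Bq) hB.
have p4 : 0 < 2 * (q%:R + 4) :> R by rewrite mulr_gt0 ?addr_gt0.
have [M M0 hM] := small_inverse (divr_gt0 e0 p4).
exists M => // n /= Mn a b ab.
have n0 : 0 < n%:R :> R by rewrite ltr0n (leq_trans M0).
have [ba|ba] := leP 1 (b - a).
  apply: (@le_trans _ _ 1); last by move: ba e0; lra.
  rewrite ler_pdivrMr// mul1r ler_nat -[leqRHS]card_ord -sum1_card.
  by apply: leq_sum => i _; case: asboolP.
have h1 := @sum_blocks_le (fun i => `[< on_circle alpha a b i >]) q _ n q0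
  (fun c => @circle_block alpha q p c a b q0 pq hqp ab).
have ba0 : 0 <= b - a by rewrite subr_ge0.
have h2 : (Num.truncn (q%:R * (b - a) + 3)).+1%:R <= q%:R * (b - a) + 4.
  have /truncn_itv/andP[h _] : 0 <= q%:R * (b - a) + 3 by rewrite addr_ge0// mulr_ge0.
  by rewrite -natr1; move: h; lra.
have h3 : (n %/ q).+1%:R <= n%:R / q%:R + 1 :> R.
  rewrite -natr1 lerD2r ler_pdivlMr// -natrM ler_nat; exact: leq_trunc_div.
rewrite ler_pdivrMr//; apply: (@le_trans _ _ ((n%:R / q%:R + 1) * (q%:R * (b - a) + 4))).
  move: h1; rewrite -(ler_nat R) natrM => h1; apply: le_trans h1 _.
  exact: ler_pM.
have hM' : n%:R^-1 < e / (2 * (q%:R + 4)).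
  exact: inverse_nat_lt Mn hM.
have k1 : q%:R + 4 <= e / 2 * n%:R.
  rewrite ltr_pdivlMr// in hM'; rewrite mulrC ltr_pdivrMr// in hM'.
  move: hM'; lra.
have k2 : 4 / q%:R * n%:R <= e / 2 * n%:R.
  rewrite ler_pM2r//; move: hq; lra.
have -> : (n%:R / q%:R + 1) * (q%:R * (b - a) + 4) =
   n%:R * (b - a) + 4 / q%:R * n%:R + (q%:R * (b - a) + 4).
  by field; rewrite gt_eqF.
have k3 : q%:R * (b - a) <= q%:R by rewrite ger_pMr// ltW.
move: k1 k2 k3; lra.
Qed.

Lemma rotation_on_circle alpha a b i :
  a <= rotation alpha i <= b -> on_circle alpha a b i.
Proof. by move=> h; exists (Num.truncn (i%:R * alpha))%:Z. Qed.

Lemma rotation_upper alpha e : 0 <= alpha -> irrational alpha -> 0 < e ->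
  \forall n \near \oo, forall a b, a <= b ->
    frequency R [set k | a <= rotation alpha k.-1 <= b] n <= b - a + e.
Proof.
move=> a0 ira e0; have [M _ hM] := circle_upper a0 ira e0.
exists M => // n /= Mn a b ab; apply: le_trans (hM n Mn a b ab).
rewrite ler_wpM2r ?invr_ge0// ler_nat; apply: leq_sum => i _ /=.
case: asboolP => // /rotation_on_circle h; by case: asboolP.
Qed.

Lemma frequency_setC P n : (0 < n)%N -> frequency R (~` P) n = 1 - frequency R P n.
Proof.
move=> n0; rewrite -!ratio_fst -ratio_setC//.
Qed.

(* The complement of [a, b[ in the circle is the arc [b, a + 1[. *)
Lemma rotation_lower alpha e : 0 <= alpha -> irrational alpha -> 0 < e ->
  \forall n \near \oo, forall a b, 0 <= a -> a <= b -> b <= 1 ->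
    b - a - e <= frequency R [set k | a <= rotation alpha k.-1 < b] n.
Proof.
move=> a0 ira e0; have [M _ hM] := circle_upper a0 ira e0.
exists M.+1 => // n /= Mn a b ha ab b1; have n0 : (0 < n)%N := leq_ltn_trans (leq0n _) Mn.
have ba : b <= a + 1 by lra.
have := hM n (ltnW Mn) b (a + 1) ba.
set S := [set k | _]; have := frequency_setC S n0.
have : frequency R (~` S) n <=
    (\sum_(i < n) `[< on_circle alpha b (a + 1) i >])%:R / n%:R.
  rewrite ler_wpM2r ?invr_ge0// ler_nat; apply: leq_sum => i _ /=.
  case: asboolP => // /negP; rewrite negb_and -ltNge -leNgt /= => h.
  have /andP[r0 r1] := rotation_itv i a0.
  suff : on_circle alpha b (a + 1) i by case: asboolP.
  case/orP: h => [h|h]; last by apply: rotation_on_circle; rewrite h/=; lra.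
  (* A point r < a is on the arc as r + 1, so its integer part is lowered by one. *)
  exists ((Num.truncn (i%:R * alpha))%:Z - 1).
  have -> : ((Num.truncn (i%:R * alpha))%:Z - 1)%:~R =
    (Num.truncn (i%:R * alpha))%:R - 1 :> R by rewrite rmorphB.
  move: h r0; rewrite /rotation; lra.
lra.
Qed.

Lemma rational_rotation (p q i : nat) : (0 < q)%N ->
  rotation (p%:R / q%:R) i = ((i * p) %% q)%:R / q%:R.
Proof.
move=> q0; have q0' : 0 < q%:R :> R by rewrite ltr0n.
have e : i%:R * (p%:R / q%:R) = (i * p %/ q)%:R + ((i * p) %% q)%:R / q%:R :> R.
  rewrite mulrA -natrM {1}(divn_eq (i * p) q) natrD natrM mulrDl.
  by rewrite mulfK// gt_eqF.
rewrite /rotation {2}e (_ : Num.truncn _ = (i * p %/ q)%N).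
  by rewrite e addrAC subrr add0r.
apply/eqP; rewrite truncn_eq; last by rewrite addr_ge0 ?divr_ge0.
rewrite lerDl divr_ge0//= -natr1 ltrD2l ltr_pdivrMr// mul1r ltr_nat.
exact: ltn_pmod.
Qed.

(** Multiplication by p permutes the residues, so each block of q consecutive indices meets r
    exactly once and the error is at most 1/n. *)
Lemma rational_frequency (p q r : nat) : (0 < q)%N -> coprime p q -> (r < q)%N ->
  frequency R [set k | (k.-1 * p) %% q = r]%N @ \oo --> (q%:R^-1 : R).
Proof.
move=> q0 pq rq; have q0' : 0 < q%:R :> R by rewrite ltr0n.
pose F i : nat := ((i * p) %% q == r)%N.
have block c : (\sum_(j < q) F (c + j) = 1)%N.
  pose f (j : 'I_q) : 'I_q := Ordinal (ltn_pmod ((c + j) * p) q0).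
  have fi : injective f.
    move=> i j /(congr1 val) /= /eqP.
    wlog ij : i j / (i <= j)%N.
      move=> W h; case: (leqP i j) => [|/ltnW] ij; first exact: W.
      by apply/esym/W => //; rewrite eq_sym.
    rewrite eq_sym eqn_mod_dvd ?leq_mul2r ?leq_add2l ?ij ?orbT// -mulnBl subnDl.
    rewrite Gauss_dvdl ?(coprime_sym q)// => /dvdn_leq h.
    apply/val_inj/eqP; rewrite eqn_leq ij /= leqNgt; apply/negP => ji.
    by have := ltn_ord j; have := h; rewrite subn_gt0 ji => /(_ isT); lia.
  have [g' fK gK] := injF_bij fi.
  rewrite (bigD1 (g' (Ordinal rq)))//= big1 => [|j jn].
    by rewrite /F -[X in (X == r)%N]/(val (f (g' (Ordinal rq)))) gK eqxx.
  apply/eqP; rewrite /F eqb0; apply: contra jn => /eqP jr.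
  by apply/eqP; rewrite -(fK j); congr g'; apply/val_inj.
have h1 n := @sum_blocks_le F q 1 n q0 (fun c => eq_leq (block c)).
have h2 n := @sum_blocks_ge F q 1 n q0 (fun c => eq_leq (esym (block c))).
apply/cvgrPdist_le => e e0; have [M M0 hM] := small_inverse e0.
exists M => // n /= Mn; have n0 : 0 < n%:R :> R by rewrite ltr0n (leq_trans M0).
have -> : frequency R [set k | (k.-1 * p) %% q = r]%N n = (\sum_(i < n) F i)%:R / n%:R.
  congr (_%:R / _); apply: eq_bigr => i _; rewrite /F; congr nat_of_bool.
  by apply/asboolP/eqP.
apply: (@le_trans _ _ n%:R^-1); last first.
  exact: ltW (inverse_nat_lt M0 Mn hM).
have := h1 n; have := h2 n; rewrite !muln1 => k1 k2.
have := divn_eq n q; have := ltn_pmod n q0; set b := (n %/ q)%N in k1 k2 *.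
set s := (\sum_(i < n) F i)%N in k1 k2 * => hm nE.
have -> : q%:R^-1 - s%:R / n%:R = (n%:R - s%:R * q%:R) / q%:R / n%:R :> R.
  by field; rewrite !gt_eqF.
rewrite normrM (ger0_norm (x := n%:R^-1)) ?invr_ge0// ler_piMl ?invr_ge0//.
rewrite normrM (ger0_norm (x := q%:R^-1)) ?invr_ge0// ler_pdivrMr// mul1r.
rewrite ler_norml lerBlDr lerBrDr addrC -natrM -!natrD.
rewrite lerBlDl -natrD !ler_nat; move: k1 k2 hm nE; clear; nia.
Qed.

End Rotation.

(** * Jordan content *)

Section CountingIntegers.
Variable R : realType.
Implicit Types (u w : R) (W : nat).

Lemma card_open_interval_le W u w : u <= w ->
  #|[set k : 'I_W | u < k%:R < w]%SET|%:R <= w - u + 1.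
Proof.
move=> uw; have wu : 0 <= w - u by rewrite subr_ge0.
have hf (k : 'I_W) : u < k%:R < w ->
    (Num.truncn (k%:R - u) < (Num.truncn (w - u)).+1)%N.
  move=> /andP[h1 h2]; rewrite ltnS; apply: le_truncn.
  by rewrite lerD2r ltW.
pose f (k : 'I_W) : 'I_(Num.truncn (w - u)).+1 := inord (Num.truncn (k%:R - u)).
have fi : {in [set k : 'I_W | u < k%:R < w]%SET &, injective f}.
  move=> i j; rewrite !inE => hi hj /(congr1 val) /=.
  rewrite !inordK ?hf// => e.
  have /truncn_itv/andP[i1 i2] : 0 <= i%:R - u.
    by rewrite subr_ge0 ltW//; case/andP: hi.
  have /truncn_itv/andP[j1 j2] : 0 <= j%:R - u.
    by rewrite subr_ge0 ltW//; case/andP: hj.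
  rewrite e in i1 i2; rewrite -!natr1 in i2 j2.
  have h1 : i%:R < j%:R + 1 :> R by lra.
  have h2 : j%:R < i%:R + 1 :> R by lra.
  rewrite natr1 ltr_nat ltnS in h1; rewrite natr1 ltr_nat ltnS in h2.
  by apply/val_inj/eqP; rewrite eqn_leq h1.
have := leq_card_in f _ fi; rewrite card_ord -(ler_nat R) => h; apply: le_trans h _.
by have /truncn_itv/andP[h _] := wu; rewrite -natr1 lerD2r.
Qed.

Lemma card_closed_interval_ge W u w : 0 <= u -> w <= W%:R ->
  w - u - 2 <= #|[set k : 'I_W | (u <= k%:R) && (k.+1%:R <= w)]%SET|%:R.
Proof.
move=> u0 wW; have [h|h] := ltP (w - u - 1) 0.
  by apply: (@le_trans _ _ 0) => //; lra.
pose L := Num.truncn (w - u - 1).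
have /truncn_itv/andP[L1 L2] := h; rewrite -/L in L1 L2.
have /truncn_itv/andP[c1 c2] := u0; set c := Num.truncn u in c1 c2.
have fW (i : 'I_L) : (c.+1 + i < W)%N.
  rewrite -(ler_nat R) -addnS natrD -natr1.
  have : i.+1%:R <= L%:R :> R by rewrite ler_nat.
  lra.
pose f (i : 'I_L) : 'I_W := Ordinal (fW i).
have fi : injective f by move=> i j /(congr1 val) /= /addnI /val_inj.
apply: (@le_trans _ _ L%:R); first by move: L2; rewrite -natr1; lra.
rewrite ler_nat -[X in (X <= _)%N]card_ord -(card_imset predT fi).
apply/subset_leq_card/fintype.subsetP => k /imsetP[i _ ->]; rewrite inE /=.
have iL : i.+1%:R <= L%:R :> R by rewrite ler_nat.
have hc : u < c.+1%:R by [].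
rewrite natrD -addnS natrD -natr1; apply/andP; split.
  by rewrite -[leLHS]addr0; apply: lerD; rewrite ?natr1 ?(ltW hc).
rewrite -natr1; lra.
Qed.

End CountingIntegers.

(** * Grid cells that a Jordan measurable set leaves undecided *)

Section ValueGrid.
Variables (R : realType) (A : set R).
Implicit Types (M k : nat).

Definition grid_inside M k : Prop :=
  forall x, k%:R <= M%:R * x < k.+1%:R -> A x.
(** The margin 1/M leaves room for the error of approximation: a value in a cell that is not close
    stays outside a small enlargement of A even after a perturbation. *)
Definition grid_close M k : Prop :=
  exists x a, [/\ k%:R <= M%:R * x < k.+1%:R, A a & `|x - a| < M%:R^-1].

Section Window.
Variables (nP : nat) (P : 'I_nP -> R * R) (nQ : nat) (Q : 'I_nQ -> R * R).
Hypothesis P_disjoint : trivIset setT (fun i => box1 (P i)).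
Hypothesis P_inside : \bigcup_i box1 (P i) `<=` A.
Hypothesis Q_cover : A `<=` \bigcup_i box1 (Q i).
Variables (S M : nat).
Hypothesis M_gt0 : (0 < M)%N.
Hypothesis P_window : forall i, - S%:R <= (P i).1 /\ (P i).2 <= S%:R.

(** Number of cells of length 1/M in [-S, S[; shifting by S makes natural numbers index all of
    them. *)
Let W := (2 * S * M)%N.
Let Mp : 0 < M%:R :> R. Proof. by rewrite ltr0n. Qed.

Let inside (k : 'I_W) : Prop :=
  forall x, k%:R <= M%:R * (x + S%:R) < k.+1%:R -> A x.
Let close (k : 'I_W) : Prop :=
  exists x a, [/\ k%:R <= M%:R * (x + S%:R) < k.+1%:R, A a & `|x - a| < M%:R^-1].

(** A box of length l that fits in the window contains at least M l - 2 whole cells, and disjoint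
    boxes share none. *)
Lemma window_inside :
  M%:R * \sum_(i < nP) vol1 (P i) - 2 * nP%:R <=
    #|[set k | `[< inside k >]]%SET|%:R.
Proof.
pose D (i : 'I_nP) := [set k : 'I_W | (M%:R * ((P i).1 + S%:R) <= k%:R) &&
  (k.+1%:R <= M%:R * ((P i).2 + S%:R))]%SET.
have DP i (k : 'I_W) : k \in D i ->
    forall x, k%:R <= M%:R * (x + S%:R) < k.+1%:R -> box1 (P i) x.
  rewrite inE => /andP[h1 h2] x /andP[h3 h4]; rewrite /box1 /= in_itv /=.
  have := le_trans h1 h3; rewrite ler_pM2l// lerD2r => ->.
  by have := lt_le_trans h4 h2; rewrite ltr_pM2l// ltrD2r.
(* The left endpoint of cell k: a point by which two boxes containing the same cell are seen to
   meet. *)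
have mid (k : nat) : (k%:R : R) <= M%:R * ((k%:R / M%:R - S%:R) + S%:R) < (k.+1%:R : R).
  by rewrite subrK mulrCA divff ?gt_eqF// mulr1 lexx ltr_nat ltnSn.
have cD i : M%:R * vol1 (P i) - 2 <= #|D i|%:R.
  have [hS hS'] := P_window i.
  have [h|h] := leP (P i).2 (P i).1.
    rewrite /vol1 max_l ?subr_le0// mulr0; apply: (@le_trans _ _ 0) => //; lra.
  rewrite /vol1 max_r ?subr_ge0 ?(ltW h)//.
  have -> : M%:R * ((P i).2 - (P i).1) - 2 =
    M%:R * ((P i).2 + S%:R) - M%:R * ((P i).1 + S%:R) - 2 by ring.
  apply: card_closed_interval_ge.
    by rewrite mulr_ge0// -lerBlDr sub0r.
  rewrite /W !natrM mulrC ler_pM2r//; lra.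
have : (\sum_(i < nP) #|D i| <= #|[set k | `[< inside k >]]%SET|)%N.
  rewrite -(card_in_imset (f := id)) ?imset_id; last by [].
  rewrite (eq_bigr (fun i => \sum_(k in [set k | `[< inside k >]]%SET) (k \in D i))%N).
    rewrite exchange_big -sum1_card; apply: leq_sum => k _.
    have [/existsP[i0 Di0]|] := boolP [exists i, k \in D i].
      rewrite (bigD1 i0)//= big1 ?addn0 ?Di0// => i ii0.
      apply/eqP; rewrite eqb0; apply: contra ii0 => Di; apply/eqP.
      apply: P_disjoint => //; exists (k%:R / M%:R - S%:R); split.
        by apply: (DP _ _ Di); apply: mid.
      by apply: (DP _ _ Di0); apply: mid.
    rewrite negb_exists => /forallP nex; rewrite big1// => i _.
    by rewrite (negbTE (nex i)).
  move=> i _; rewrite -sum1_card [LHS]big_mkcond [RHS]big_mkcond /=.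
  apply: eq_bigr => k _; case: ifP => kD; last by case: ifP.
  rewrite inE ifT//; apply/asboolP => x hx; apply: P_inside; exists i => //.
  exact: DP hx.
rewrite -(ler_nat R) natr_sum; apply: le_trans.
apply: le_trans (ler_sum _ (fun i _ => cD i)).
by rewrite sumrB -mulr_sumr sumr_const card_ord -[2 *+ nP]mulr_natr.
Qed.

Lemma window_close :
  #|[set k | `[< close k >]]%SET|%:R <= M%:R * \sum_(j < nQ) vol1 (Q j) + 4 * nQ%:R.
Proof.
(* In units of a cell, the box is widened by 1 on each side for the margin and by 1 more on the left
   for the length of the cell. *)
pose D (j : 'I_nQ) := [set k : 'I_W | ((Q j).1 < (Q j).2) &&
  (M%:R * ((Q j).1 + S%:R) - 2 < k%:R < M%:R * ((Q j).2 + S%:R) + 1)]%SET.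
have cD j : #|D j|%:R <= M%:R * vol1 (Q j) + 4.
  rewrite /D; have [h|h] := ltP (Q j).1 (Q j).2; last first.
    rewrite (_ : [set k | _]%SET = finset.set0); last by apply/setP => k; rewrite !inE.
    by rewrite cards0 addr_ge0// mulr_ge0// /vol1 le_max lexx.
  rewrite /vol1 max_r ?subr_ge0 ?(ltW h)//=.
  apply: le_trans (card_open_interval_le _ _) _; last lra.
  have : M%:R * (Q j).1 <= M%:R * (Q j).2 by rewrite ler_pM2l// ltW.
  lra.
have : (#|[set k | `[< close k >]]%SET| <= \sum_(j < nQ) #|D j|)%N.
  apply: leq_trans (_ : #|\bigcup_(j < nQ) D j|%SET <= _)%N; last first.
    apply: (big_ind2 (fun (X : {set 'I_W}) n => #|X| <= n)%N) => [|X m Y n h1 h2|//].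
      by rewrite cards0.
    by rewrite (leq_trans (leq_card_setU _ _))// leq_add.
  apply/subset_leq_card/fintype.subsetP => k; rewrite inE => /asboolP.
  move=> [x [a [/andP[h1 h2] Aa]]]; have [j _] := Q_cover Aa.
  rewrite /box1 /= in_itv /= => /andP[q1 q2].
  rewrite ltr_distl -(ltr_pM2l Mp) -(ltr_pM2l Mp (x)) mulrBr mulrDr divff ?gt_eqF//.
  move=> /andP[xa ax]; apply/bigcupP; exists j => //; rewrite inE (le_lt_trans q1 q2)/=.
  move: q1 q2; rewrite -(ler_pM2l Mp) -(ltr_pM2l Mp) => q1 q2.
  rewrite -natr1 in h2; apply/andP; split; lra.
rewrite -(ler_nat R) natr_sum => h; apply: le_trans h _.
apply: le_trans (ler_sum _ (fun i _ => cD i)) _.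
by rewrite big_split /= -mulr_sumr sumr_const card_ord -[_ *+ nQ]mulr_natr.
Qed.

(* Close cells are counted by an outer cover and inside cells by inner boxes,
   with an error of O(1) per box. *)
Lemma window_bad :
  #|[set k | `[< close k /\ ~ inside k >]]%SET|%:R <=
    M%:R * (\sum_(j < nQ) vol1 (Q j) - \sum_(i < nP) vol1 (P i)) +
    (4 * nQ%:R + 2 * nP%:R).
Proof.
have e : (#|[set k | `[< close k /\ ~ inside k >]]%SET| +
    #|[set k | `[< inside k >]]%SET| = #|[set k | `[< close k >]]%SET|)%N.
  rewrite -cardsUI (_ : _ :&: _ = finset.set0).
    rewrite cards0 addn0; apply: eq_card => k; rewrite !inE.
    apply/orP/asboolP => [[/asboolP[]//|/asboolP ik]|ck].
      have mid : (k%:R : R) <= M%:R * ((k%:R / M%:R - S%:R) + S%:R) < (k.+1%:R : R).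
        by rewrite subrK mulrCA divff ?gt_eqF// mulr1 lexx ltr_nat ltnSn.
      exists (k%:R / M%:R - S%:R), (k%:R / M%:R - S%:R); split => //; first exact: ik.
      by rewrite subrr normr0 invr_gt0.
    by case: (asboolP (inside k)) => ik; [right|left; apply/asboolP].
  apply/setP => k; rewrite !inE; apply/negP => /andP[/asboolP[_ n1] /asboolP].
  contradiction.
have := window_inside; have := window_close; rewrite -e natrD; lra.
Qed.

(** The values of interest lie in ]0, 1[, whose cells sit in the window with offset S M. *)
Lemma window_unit : (0 < S)%N ->
  #|[set k : 'I_M | `[< grid_close M k /\ ~ grid_inside M k >]]%SET|%:R <=
    M%:R * (\sum_(j < nQ) vol1 (Q j) - \sum_(i < nP) vol1 (P i)) +
    (4 * nQ%:R + 2 * nP%:R) :> R.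
Proof.
move=> S0; apply: le_trans window_bad; rewrite ler_nat.
have fW (k : 'I_M) : (k + S * M < W)%N.
  by rewrite /W -mulnA mul2n -addnn ltn_add2r (leq_trans (ltn_ord k))// leq_pmull.
pose f (k : 'I_M) : 'I_W := Ordinal (fW k).
have fi : injective f by move=> i j /(congr1 val) /= /addIn /val_inj.
rewrite -(card_imset _ fi); apply/subset_leq_card/fintype.subsetP => k' /imsetP[k].
rewrite inE => /asboolP[[x [a [hx Aa xa]]] nin] ->; rewrite inE; apply/asboolP.
have e x' : ((f k)%:R <= M%:R * (x' + S%:R) < (f k).+1%:R) =
    (k%:R <= M%:R * x' < k.+1%:R) :> bool.
  by rewrite /= -addSn !natrD natrM mulrDr [S%:R * M%:R]mulrC lerD2r ltrD2r.
split; first by exists x, a; split; rewrite ?e.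
by move=> i; apply: nin => x' hx'; apply: i; rewrite e.
Qed.

End Window.

Lemma bounding_window nP (P : 'I_nP -> R * R) :
  exists2 S : nat, (0 < S)%N & forall i, - S%:R <= (P i).1 /\ (P i).2 <= S%:R.
Proof.
pose B := \sum_(i < nP) (`|(P i).1| + `|(P i).2|).
have B0 : 0 <= B by apply: sumr_ge0 => i _; rewrite addr_ge0.
exists (Num.bound B).
  by rewrite -(ltr0n R); apply: le_lt_trans (archi_boundP B0).
move=> i; have iB : `|(P i).1| + `|(P i).2| <= B.
  by rewrite /B (bigD1 i)//= lerDl; apply: sumr_ge0 => j _; rewrite addr_ge0.
have := archi_boundP B0; set S := _%:R => BS.
have h1 := ler_norm (- (P i).1); rewrite normrN in h1.
have h2 := ler_norm (P i).2.
have := normr_ge0 (P i).1; have := normr_ge0 (P i).2.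
split; lra.
Qed.

(** The count in [window_bad] is nonnegative, so the outer sum minus the inner sum is at least -C/M
    for every M. *)
Lemma inner_le_outer1 nP (P : 'I_nP -> R * R) nQ (Q : 'I_nQ -> R * R) :
  trivIset setT (fun i => box1 (P i)) ->
  \bigcup_i box1 (P i) `<=` A -> A `<=` \bigcup_i box1 (Q i) ->
  \sum_(i < nP) vol1 (P i) <= \sum_(i < nQ) vol1 (Q i).
Proof.
move=> dP PA AQ; have [S S0 hS] := bounding_window P.
apply/ler_addgt0Pr => e e0.
have C0 : 0 < 4 * nQ%:R + 2 * nP%:R + 1 :> R by rewrite ltr_wpDl// addr_ge0 ?mulr_ge0.
have [M M0 hM] := small_inverse (divr_gt0 e0 C0).
have Mp : 0 < M%:R :> R by rewrite ltr0n.
have := window_bad dP PA AQ M0 hS; set c := #|_|%:R => h.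
have c0 : 0 <= c by rewrite /c.
rewrite ltr_pdivlMr// mulrC ltr_pdivrMr// in hM.
rewrite -(ler_pM2l Mp); move: h hM c0; lra.
Qed.

(** Inner boxes and an outer cover within rho/4 of the common content leave rho M / 2 undecided
    cells, and M is taken large enough to absorb the O(1) error per box. *)
Lemma PJ_grid (rho : R) : PJ_measurable1 A -> 0 < rho ->
  exists M (B : {set 'I_M}), [/\ (0 < M)%N, #|B|%:R <= rho * M%:R &
    forall k : 'I_M, k \notin B -> grid_inside M k \/ ~ grid_close M k].
Proof.
move=> [[nC [C AC]] io] rho0; have r4 : 0 < rho / 4 by rewrite divr_gt0.
set SO := [set v : R | exists n (b : 'I_n -> R * R),
    A `<=` \bigcup_i box1 (b i) /\ v = \sum_(i < n) vol1 (b i)].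
set SI := [set v : R | exists n (b : 'I_n -> R * R),
    [/\ trivIset setT (fun i => box1 (b i)),
        \bigcup_i box1 (b i) `<=` A & v = \sum_(i < n) vol1 (b i)]].
have vol0 (b : R * R) : 0 <= vol1 b by rewrite /vol1 le_max lexx.
have hSO : has_inf SO.
  split; first by exists (\sum_(i < nC) vol1 (C i)), nC, C.
  by exists 0 => _ [n [b [_ ->]]]; apply: sumr_ge0.
have hSI : has_sup SI.
  split.
    exists (\sum_(i < 0) vol1 ((fun=> (0, 0)) i)), 0%N, (fun=> (0, 0)).
    by split=> [[]|x [[]]|].
  exists (\sum_(i < nC) vol1 (C i)) => _ [n [b [dP PA ->]]].
  exact: inner_le_outer1 AC.
have [_ [nQ [Q [AQ ->]]] hQ] := inf_adherent r4 hSO.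
have [_ [nP [P [dP PA ->]]] hP] := sup_adherent r4 hSI.
have {}io : sup SI = inf SO := io.
have [S S0 hS] := bounding_window P.
have C0 : 0 < 4 * nQ%:R + 2 * nP%:R + 1 :> R by rewrite ltr_wpDl// addr_ge0 ?mulr_ge0.
have r2 : 0 < rho / 2 by rewrite divr_gt0.
have [M M0 hM] := small_inverse (divr_gt0 r2 C0).
have Mp : 0 < M%:R :> R by rewrite ltr0n.
exists M, [set k : 'I_M | `[< grid_close M k /\ ~ grid_inside M k >]]%SET; split => //.
  apply: le_trans (window_unit dP PA AQ M0 hS S0) _.
  rewrite ltr_pdivlMr// mulrC ltr_pdivrMr// in hM.
  have h : \sum_(j < nQ) vol1 (Q j) - \sum_(i < nP) vol1 (P i) <= rho / 2.
    move: hQ hP io; lra.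
  have := ler_wpM2l (ltW Mp) h; lra.
move=> k; rewrite inE => /asboolP h.
case: (pselect (grid_inside M k)) => [|n1]; [by left|right => cl].
by apply: h.
Qed.

End ValueGrid.

(** * Index of a sequence that follows a function along an equidistributed orbit *)

Section JordanIndex.
Variables (R : realType) (T I : Type) (box : I -> set T) (vol : I -> R).
Variables (U : set T) (p : nat * nat -> T) (H : T -> R) (z : nat -> nat -> R).
Local Notation ratio := (density_ratio R).

(** One setting for dimensions 1 and 2: the orbit [p] is equidistributed with respect to boxes, and
    [z] follows [H] along it. *)
Hypothesis vol_ge0 : forall b, 0 <= vol b.
Hypothesis box_upper : forall b (e : R), 0 < e ->
  \forall n \near \oo, ratio [set nm | box b (p nm)] n <= vol b + e.
Hypothesis box_lower : forall b (e : R), 0 < e -> box b `<=` U ->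
  \forall n \near \oo, vol b - e <= ratio [set nm | box b (p nm)] n.
Hypothesis p_in : exists N1, forall n m, (N1 <= n)%N -> (N1 <= m)%N -> U (p (n, m)).
Hypothesis H_itv : forall t, U t -> 0 < H t < 1.
Hypothesis z_close : forall e : R, 0 < e -> exists N0, forall n m,
  (N0 <= n)%N -> (N0 <= m)%N -> `|z n m - H (p (n, m))| < e.
(** A small proportion of cells of values is rarely visited, with [rho] chosen before the fineness
    M. It will follow from the expansion of g. *)
Hypothesis bad_small : forall e : R, 0 < e -> exists2 rho : R, 0 < rho &
  forall M (B : {set 'I_M}), (0 < M)%N -> #|B|%:R <= rho * M%:R ->
  \forall n \near \oo, ratio [set nm | U (p nm) /\
    exists2 k : 'I_M, k \in B & Num.truncn (M%:R * H (p nm)) = k] n <= e.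
(** A partition into boxes on most of which H stays within one cell of values. It will follow from
    monotonicity. *)
Hypothesis grid : forall M (e : R), (0 < M)%N -> 0 < e ->
  exists (C : finType) (bx : C -> I) (bad : pred C),
  [/\ forall c c' t, box (bx c) t -> box (bx c') t -> c = c',
      forall t, U t -> exists c, box (bx c) t,
      \sum_(c | bad c) vol (bx c) <= e &
      forall c, ~~ bad c -> box (bx c) `<=` U /\
        exists k, forall t, box (bx c) t -> Num.truncn (M%:R * H t) = k].

Variable A : set R.
Hypothesis A_PJ : PJ_measurable1 A.
Let E := U `&` H @^-1` A.

Lemma sum_share_le (J : finType) (a : pred J) (e : R) : 0 < e ->
  \sum_(j | a j) (e / #|J|.+1%:R) <= e.
Proof.
move=> e0; have c0 : 0 < e / #|J|.+1%:R by rewrite divr_gt0.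
apply: (@le_trans _ _ (\sum_(j : J) (e / #|J|.+1%:R))).
  by rewrite [leRHS](bigID a) /= lerDl sumr_ge0// => j _; apply: ltW.
rewrite sumr_const -[leLHS]mulr_natr mulrAC ler_pdivrMr//.
by rewrite ler_pM2l// ler_nat ltnW// ltnS max_card.
Qed.

Lemma sum_box_upper (J : finType) (a : pred J) (b : J -> I) (K : set T) (e : R) :
  0 < e -> (forall t, K t -> exists2 j, a j & box (b j) t) ->
  \forall n \near \oo,
    ratio [set nm | K (p nm)] n <= \sum_(j | a j) vol (b j) + e.
Proof.
move=> e0 h; have J0 : 0 < #|J|.+1%:R :> R by [].
have eJ : 0 < e / #|J|.+1%:R by rewrite divr_gt0.
have : \forall n \near \oo, forall j : J,
    ratio [set nm | box (b j) (p nm)] n <= vol (b j) + e / #|J|.+1%:R.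
  by apply: filter_forall => j; apply: box_upper.
apply: filterS => n hn.
apply: (@le_trans _ _ (\sum_(j | a j) ratio [set nm | box (b j) (p nm)] n)).
  by apply: ratio_bigcup => nm /h.
apply: le_trans (ler_sum _ (fun j _ => hn j)) _.
by rewrite big_split /= lerD2l; exact: sum_share_le.
Qed.

Lemma sum_box_lower (J : finType) (a : pred J) (b : J -> I) (K : set T) (e : R) :
  0 < e -> (forall j, a j -> box (b j) `<=` U) ->
  (forall j t, a j -> box (b j) t -> K t) ->
  (forall i j t, box (b i) t -> box (b j) t -> i = j) ->
  \forall n \near \oo,
    \sum_(j | a j) vol (b j) - e <= ratio [set nm | K (p nm)] n.
Proof.
move=> e0 bU h d; have J0 : 0 < #|J|.+1%:R :> R by [].
have eJ : 0 < e / #|J|.+1%:R by rewrite divr_gt0.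
have : \forall n \near \oo, forall j : J, a j ->
    vol (b j) - e / #|J|.+1%:R <= ratio [set nm | box (b j) (p nm)] n.
  apply: filter_forall => j; case: (boolP (a j)) => aj; last by apply: nearW.
  by have := box_lower eJ (bU j aj); apply: filterS.
apply: filterS => n hn.
apply: (@le_trans _ _ (\sum_(j | a j) ratio [set nm | box (b j) (p nm)] n)); last first.
  by apply: ratio_disjoint => [nm j aj /h|nm i j]; [apply|apply: d].
apply: le_trans (ler_sum _ (fun j aj => hn j aj)).
by rewrite sumrB lerD2l lerN2; exact: sum_share_le.
Qed.

Let outs := [set v : R | exists n (b : 'I_n -> I),
    E `<=` \bigcup_i box (b i) /\ v = \sum_(i < n) vol (b i)].
Let ins := [set v : R | exists n (b : 'I_n -> I),
    [/\ trivIset setT (fun i => box (b i)),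
        \bigcup_i box (b i) `<=` E & v = \sum_(i < n) vol (b i)]].

Lemma outs_upper w (e : R) : 0 < e -> outs w ->
  \forall n \near \oo, ratio [set nm | E (p nm)] n <= w + e.
Proof.
move=> e0 [n [b [Eb ->]]]; apply: sum_box_upper => // t /Eb[i _ bi].
by exists i.
Qed.

Lemma ins_lower v (e : R) : 0 < e -> ins v ->
  \forall n \near \oo, v - e <= ratio [set nm | E (p nm)] n.
Proof.
move=> e0 [n [b [d bE ->]]]; apply: sum_box_lower => //.
- by move=> j _ t bt; have [] : E t by apply: bE; exists j.
- by move=> j t _ bt; apply: bE; exists j.
- by move=> i j t bi bj; apply: d => //; exists t.
Qed.

(** Both sums are compared with the share of visits to E at one large n. *)
Lemma ins_le_outs v w : ins v -> outs w -> v <= w.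
Proof.
move=> iv ow; apply/ler_addgt0Pr => e e0; have e2 : 0 < e / 2 by rewrite divr_gt0.
have [n [h1 h2]] := filter_ex (filterI (ins_lower e2 iv) (outs_upper e2 ow)).
lra.
Qed.

Lemma value_grid (e : R) : 0 < e -> exists M (B : {set 'I_M}),
  [/\ (0 < M)%N,
    \forall n \near \oo, ratio [set nm | U (p nm) /\
      exists2 k : 'I_M, k \in B & Num.truncn (M%:R * H (p nm)) = k] n <= e &
    forall t, U t -> (exists2 k : 'I_M, k \in B & Num.truncn (M%:R * H t) = k) \/
      (forall t', U t' -> Num.truncn (M%:R * H t') = Num.truncn (M%:R * H t) -> A (H t'))
      \/ (forall t' a, U t' -> Num.truncn (M%:R * H t') = Num.truncn (M%:R * H t) ->
           A a -> M%:R^-1 <= `|H t' - a|)].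
Proof.
move=> e0; have [rho rho0 hrho] := bad_small e0.
have [M [B [M0 hB hk]]] := PJ_grid A_PJ rho0.
exists M, B; split => // [|t Ut]; first exact: hrho.
have M0' : 0 < M%:R :> R by rewrite ltr0n.
have kM t' : U t' -> (Num.truncn (M%:R * H t') < M)%N.
  move=> /H_itv/andP[h0 h1]; rewrite truncn_lt_nat ?mulr_ge0 ?(ltW h0)//.
  by rewrite gtr_pMr.
have tk t' : U t' -> (Num.truncn (M%:R * H t'))%:R <= M%:R * H t' <
    (Num.truncn (M%:R * H t')).+1%:R.
  by move=> /H_itv/andP[h0 h1]; apply: truncn_itv; rewrite mulr_ge0// ltW.
pose k : 'I_M := Ordinal (kM t Ut).
have [kB|kB] := boolP (k \in B); first by left; exists k.
right; have [ik|nk] := hk k kB; [left|right].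
  by move=> t' Ut' e'; apply: ik; rewrite /= -e'; apply: tk.
move=> t' a Ut' e' Aa; rewrite leNgt; apply/negP => lt; apply: nk.
by exists (H t'), a; split => //; rewrite /= -e'; apply: tk.
Qed.

(** A box that meets E without lying in it is [bad] or is mapped into an undecided cell of values.
    The boxes of the second kind have total volume at most the frequency with which the orbit visits
    undecided values. *)
Lemma sandwich (e : R) : 0 < e -> exists v w, [/\ ins v, outs w & w <= v + e].
Proof.
move=> e0; have e2 : 0 < e / 2 by rewrite divr_gt0.
have [M [B [M0 hB hk]]] := value_grid e2.
have [C [bx [bad [dC cC sbad gC]]]] := grid M0 e2.
pose BT t := U t /\ exists2 k : 'I_M, k \in B & Num.truncn (M%:R * H t) = k.
pose amb c := ~~ bad c && `[< box (bx c) `<=` BT >].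
pose ain c := `[< box (bx c) `<=` E >].
pose meet c := `[< box (bx c) `&` E !=set0 >].
have samb : \sum_(c | amb c) vol (bx c) <= e / 2.
  apply/ler_addgt0Pr => h h0.
  have l : \forall n \near \oo, \sum_(c | amb c) vol (bx c) - h <=
      ratio [set nm | BT (p nm)] n.
    apply: sum_box_lower => // [c /andP[/gC[]//]|c t /andP[_ /asboolP]].
    exact.
  have [n [h1 h2]] := filter_ex (filterI l hB); rewrite lerBlDr in h1.
  by apply: le_trans h1 _; rewrite lerD2r.
have mi c : meet c -> ain c || (bad c || amb c).
  move=> /asboolP[t [bt [Ut At]]]; rewrite /amb; case: (boolP (bad c)) => [|nb].
    by rewrite orbT.
  have [bU [k hkc]] := gC c nb.
  have same t' : box (bx c) t' -> Num.truncn (M%:R * H t') = Num.truncn (M%:R * H t).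
    by move=> bt'; rewrite !hkc.
  case: (hk t Ut) => [[k0 k0B tk0]|[hA|far]].
  - apply/orP; right; apply/asboolP => t' bt'; split; first exact: bU.
    by exists k0 => //; rewrite same.
  - apply/orP; left; apply/asboolP => t' bt'; split; first exact: bU.
    by apply: hA; [exact: bU|exact: same].
  - have := far t (H t) Ut erefl At; rewrite subrr normr0 leNgt.
    by rewrite invr_gt0 ltr0n M0.
exists (\sum_(c | ain c) vol (bx c)), (\sum_(c | meet c) vol (bx c)); split.
- exists #|ain|, (fun i => bx (enum_val i)); split.
  + move=> i j _ _ [t [bi bj]]; apply: enum_val_inj; exact: dC bi bj.
  + move=> t [i _ bt]; have := enum_valP i; rewrite unfold_in => /asboolP; exact.
  + by rewrite [LHS]big_enum_val.
- exists #|meet|, (fun i => bx (enum_val i)); split.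
  + move=> t Et; have [c bc] := cC t Et.1.
    have mc : c \in meet by apply/asboolP; exists t.
    by exists (enum_rank_in mc c) => //=; rewrite enum_rankK_in.
  + by rewrite [LHS]big_enum_val.
- have -> : e = e / 2 + e / 2 by lra.
  apply: le_trans (lerD (lexx _) (lerD sbad samb)).
  rewrite [leLHS]big_mkcond [X in _ <= X + _]big_mkcond.
  rewrite [X in _ <= _ + (X + _)]big_mkcond [X in _ <= _ + (_ + X)]big_mkcond.
  rewrite -!big_split /=.
  apply: ler_sum => c _; case: ifP => [/mi|_].
    by case: (ain c); case: (bad c); case: (amb c) => //= _;
      rewrite ?addr0 ?add0r// ?lerDl ?addr_ge0.
  by rewrite !addr_ge0//; case: ifP.
Qed.

Lemma jordan_content : PJ_measurable box vol E /\
  ratio [set nm | E (p nm)] @ \oo --> outer_content box vol E.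
Proof.
have [v0 [w0 [iv0 ow0 _]]] := sandwich ltr01.
have hin w : outs w -> outer_content box vol E <= w.
  by move=> ow; apply: ge_inf => //; exists v0 => w' /(ins_le_outs iv0).
have hsu v : ins v -> v <= inner_content box vol E.
  by move=> iv; apply: ub_le_sup => //; exists w0 => v' /ins_le_outs; apply.
have hsv v : ins v -> v <= outer_content box vol E.
  by move=> iv; apply: lb_le_inf => [|w]; [exists w0|exact: ins_le_outs].
split.
  split; first by case: ow0 => n [b [Eb _]]; exists n, b.
  apply/eqP; rewrite eq_le; apply/andP; split.
    by apply: ge_sup => [|v /hsv]; first by exists v0.
  apply/ler_addgt0Pr => e e0; have [v [w [iv ow wv]]] := sandwich e0.
  apply: le_trans (hin w ow) _; apply: le_trans wv _.
  by rewrite lerD2r; apply: hsu.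
apply/cvgrPdist_le => e e0; have e2 : 0 < e / 2 by rewrite divr_gt0.
have [v [w [iv ow wv]]] := sandwich e2.
apply: (filterS _ (filterI (ins_lower e2 iv) (outs_upper e2 ow))) => n [h1 h2].
have := hin w ow; have := hsv v iv; rewrite ler_distl; move: h1 h2 => /=.
by move=> h1 h2 h3 h4; apply/andP; split; lra.
Qed.

Lemma jordan_index : PJ_measurable box vol E /\
  outer_content box vol E = index_set z A.
Proof.
have [mE lE] := jordan_content; split => //.
have [N1 hN1] := p_in; set v := outer_content box vol E in lE *.
apply/esym; apply: index_eq => e e0.
  apply: upper_density_le => eta eta0; have eta2 : 0 < eta / 2 by rewrite divr_gt0.
  have [N0 hN0] := z_close e0.
  have h' := @ratio_eventually_le R [set nm | ~ enlarge A e (z nm.1 nm.2)]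
    (~` [set nm | E (p nm)]) N0 _ eta2.
  have {}h' : \forall n \near \oo, ratio [set nm | ~ enlarge A e (z nm.1 nm.2)] n <=
      ratio (~` [set nm | E (p nm)]) n + eta / 2.
    apply: h' => n m nN mN /= nz [Up Ap]; apply: nz.
    exists (H (p (n, m))) => //; exists (z n m - H (p (n, m))); last by rewrite addrC subrK.
    by rewrite /= in_itv /= -ltr_norml hN0.
  move/cvgrPdist_le: lE => /(_ _ eta2) h; near=> n.
  have n0 : (0 < n)%N by near: n; exists 1%N.
  have h1 : `|v - ratio [set nm | E (p nm)] n| <= eta / 2 by near: n.
  have h2 : ratio [set nm | ~ enlarge A e (z nm.1 nm.2)] n <=
      ratio (~` [set nm | E (p nm)]) n + eta / 2 by near: n.
  rewrite ratio_setC// in h2.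
  move: h1; rewrite ler_distl => /andP[h1 h3]; move: h1 h2 h3; lra.
have [M [B [M0 hB hk]]] := value_grid e0.
have M0' : 0 < M%:R :> R by rewrite ltr0n.
pose BT t := U t /\ exists2 k : 'I_M, k \in B & Num.truncn (M%:R * H t) = k.
(* Half a cell for |z - H| and half for the enlargement of A together stay below the margin 1/M. *)
pose d : R := M%:R^-1 / 2; have d0 : 0 < d by rewrite divr_gt0// invr_gt0.
exists d => //; apply: upper_density_ge => eta eta0.
have eta2 : 0 < eta / 2 by rewrite divr_gt0.
have [N0 hN0] := z_close d0.
have h' := @ratio_eventually_le R
  (~` ([set nm | E (p nm)] `|` [set nm | BT (p nm)]))
  [set nm | ~ enlarge A d (z nm.1 nm.2)] (maxn N0 N1) _ eta2.
have {}h' : \forall n \near \oo,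
    ratio (~` ([set nm | E (p nm)] `|` [set nm | BT (p nm)])) n <=
    ratio [set nm | ~ enlarge A d (z nm.1 nm.2)] n + eta / 2.
  apply: h' => n m; rewrite !geq_max => /andP[nN nN1] /andP[mN mN1] /= nEB.
  move=> [a Aa [b]]; rewrite /= in_itv /= -ltr_norml => bd zE.
  have Up := hN1 n m nN1 mN1; apply: nEB.
  have Ha : `|H (p (n, m)) - a| < M%:R^-1.
    have -> : H (p (n, m)) - a = - (z n m - H (p (n, m))) + b by rewrite -zE; ring.
    apply: le_lt_trans (ler_normD _ _) _; rewrite normrN.
    by have := hN0 n m nN mN; move: bd; rewrite /d; lra.
  case: (hk _ Up) => [hB'|[hA|far]]; first by right.
    by left; split => //; apply: hA.
  by have := far _ a Up erefl Aa; rewrite leNgt Ha.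
move/cvgrPdist_le: lE => /(_ _ eta2) h; near=> n.
have n0 : (0 < n)%N by near: n; exists 1%N.
have h1 : `|v - ratio [set nm | E (p nm)] n| <= eta / 2 by near: n.
have h2 : ratio (~` ([set nm | E (p nm)] `|` [set nm | BT (p nm)])) n <=
    ratio [set nm | ~ enlarge A d (z nm.1 nm.2)] n + eta / 2 by near: n.
have h3 : ratio [set nm | BT (p nm)] n <= e by near: n.
have h4 := @ratio_setU R [set nm | E (p nm)] [set nm | BT (p nm)] n.
rewrite ratio_setC// in h2.
move: h1; rewrite ler_distl => /andP[h1 h5]; move: h1 h2 h3 h4 h5; lra.
Unshelve. all: by end_near. Qed.

End JordanIndex.

(** * Grids of the unit interval and square for monotone functions *)

Section UnitCells.
Variable R : realType.
Implicit Types (N M i j : nat) (t : R).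

Definition unit_cell N i : R * R := (i%:R / N%:R, i.+1%:R / N%:R).

Lemma unit_cellP N i t : (0 < N)%N ->
  box1 (unit_cell N i) t <-> i%:R <= N%:R * t < i.+1%:R.
Proof.
move=> N0; have N0' : 0 < N%:R :> R by rewrite ltr0n.
by rewrite /box1 /= in_itv /= ler_pdivrMr// ltr_pdivlMr// mulrC.
Qed.

Lemma unit_cell_truncn N i t : (0 < N)%N ->
  box1 (unit_cell N i) t -> Num.truncn (N%:R * t) = i.
Proof. by move=> N0 /unit_cellP => /(_ N0) /truncn_def. Qed.

Lemma vol_unit_cell N i : vol1 (unit_cell N i) = N%:R^-1.
Proof.
rewrite /vol1 /= -mulrBl -natr1 [_ + 1]addrC addrK mul1r max_r// invr_ge0//.
Qed.

Lemma unit_cell_cover N t : (0 < N)%N -> 0 < t < 1 ->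
  exists i : 'I_N, box1 (unit_cell N i) t.
Proof.
move=> N0 /andP[t0 t1]; have N0' : 0 < N%:R :> R by rewrite ltr0n.
have Nt : 0 <= N%:R * t by rewrite mulr_ge0 ?ltW.
have iN : (Num.truncn (N%:R * t) < N)%N by rewrite truncn_lt_nat// gtr_pMr.
by exists (Ordinal iN); apply/unit_cellP => //; apply: truncn_itv.
Qed.

Lemma unit_cell_itv N (i : 'I_N) t : box1 (unit_cell N i) t ->
  [/\ i%:R / N%:R <= t, t < i.+1%:R / N%:R, 0 <= i%:R / N%:R :> R &
      i.+1%:R / N%:R <= 1 :> R].
Proof.
have N0 : (0 < N)%N := leq_ltn_trans (leq0n i) (ltn_ord i).
rewrite /box1 /= in_itv /= => /andP[h1 h2]; split => //.
by rewrite ler_pdivrMr ?ltr0n// mul1r ler_nat.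
Qed.

Lemma sum_shift (f : nat -> nat) N :
  (\sum_(i < N) f i <= f 0 + \sum_(i < N) f i.+1)%N.
Proof.
have <- : (\sum_(i < N.+1) f i = f 0 + \sum_(i < N) f i.+1)%N.
  by rewrite big_ord_recl.
by rewrite big_ord_recr leq_addr.
Qed.

(** Each jump uses up at least one unit of the initial value. *)
Lemma count_jumps1 (f : nat -> nat) N M : (f 0 <= M)%N ->
  (forall i, (i < N)%N -> f i.+1 <= f i)%N ->
  (\sum_(i < N) (f i != f i.+1) <= M)%N.
Proof.
move=> f0 df; have h : (\sum_(i < N) (f i != f i.+1) + \sum_(i < N) f i.+1 <=
    \sum_(i < N) f i)%N.
  rewrite -big_split /=; apply: leq_sum => i _; have := df i (ltn_ord i).
  by rewrite leq_eqVlt eq_sym; case: eqVneq => //= ->.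
have := sum_shift f N; move: f0 h; lia.
Qed.

(* Along each diagonal the values of a monotone array telescope. *)
Lemma count_jumps2 (f : nat -> nat -> nat) N M : (forall i j, f i j <= M)%N ->
  (forall i j, (i < N)%N -> (j < N)%N -> f i.+1 j.+1 <= f i j)%N ->
  (\sum_(i < N) \sum_(j < N) (f i j != f i.+1 j.+1) <= 2 * N * M)%N.
Proof.
move=> fM df.
have h : (\sum_(i < N) \sum_(j < N) (f i j != f i.+1 j.+1) +
    \sum_(i < N) \sum_(j < N) f i.+1 j.+1 <= \sum_(i < N) \sum_(j < N) f i j)%N.
  rewrite -big_split /=; apply: leq_sum => i _; rewrite -big_split /=.
  apply: leq_sum => j _; have := df i j (ltn_ord i) (ltn_ord j).
  by rewrite leq_eqVlt eq_sym; case: eqVneq => //= ->.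
have h1 : (\sum_(i < N) \sum_(j < N) f i j <=
    N * M + \sum_(i < N) \sum_(j < N) f i j.+1)%N.
  have -> : (N * M = \sum_(i < N) M)%N by rewrite sum_nat_const card_ord.
  rewrite -big_split /=; apply: leq_sum => i _.
  by apply: leq_trans (sum_shift _ _) _; rewrite leq_add2r.
have h2 : (\sum_(i < N) \sum_(j < N) f i j.+1 <=
    N * M + \sum_(i < N) \sum_(j < N) f i.+1 j.+1)%N.
  rewrite exchange_big [X in (_ <= _ + X)%N]exchange_big /=.
  have -> : (N * M = \sum_(i < N) M)%N by rewrite sum_nat_const card_ord.
  rewrite -big_split /=; apply: leq_sum => j _.
  by apply: leq_trans (sum_shift (fun i => f i j.+1) _) _; rewrite leq_add2r.
move: h h1 h2; lia.
Qed.

Lemma ratio_rows (K : set (nat * nat)) n (c : R) : 0 <= c ->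
  (forall i, frequency R (fun m => K (i, m)) n <= c) ->
  density_ratio R K n <= c.
Proof.
move=> c0 h; case: (posnP n) => [->|n0].
  by rewrite /density_ratio exp0n// invr0 mulr0.
have n0' : 0 < n%:R :> R by rewrite ltr0n.
rewrite /density_ratio natrX ler_pdivrMr ?exprn_gt0// square_cardE natr_sum.
apply: (@le_trans _ _ (\sum_(i < n) c * n%:R)); last first.
  by rewrite sumr_const card_ord -[leLHS]mulr_natr expr2 mulrA.
apply: ler_sum => i _; have := h i.+1.
by rewrite /frequency ler_pdivrMr.
Qed.

End UnitCells.

Section GridCells.
Variable R : realType.
Implicit Types (N M : nat).

Lemma diameter_itv (S : set R) (L : R) : 0 <= L ->
  (forall x y, S x -> S y -> x <= y -> y - x <= L) ->
  exists a, forall x, S x -> a <= x <= a + L.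
Proof.
move=> L0 h; have [->|/set0P[x0 Sx0]] := eqVneq S set0; first by exists 0.
have hb x : S x -> lbound S (x - L).
  move=> Sx y Sy; case: (leP x y) => xy.
    by apply: le_trans xy; rewrite gerBl.
  by have := h y x Sy Sx (ltW xy); lra.
exists (inf S) => x Sx; apply/andP; split.
  by apply: ge_inf => //; exists (x0 - L); apply: hb.
by rewrite -lerBlDr; apply: lb_le_inf; [exists x0|apply: hb].
Qed.

(** Values in one cell differ by at most 1/M and c g expands distances by at least c/32. The factor
    c is 1 for g itself and the value of g at the other coordinate for G. *)
Lemma g_cell M (c : R) (k : nat) : (0 < M)%N -> 0 < c ->
  exists a, forall t, 0 < t < 1 -> Num.truncn (M%:R * (c * g t)) = k ->
    a <= t <= a + 32 / (M%:R * c).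
Proof.
move=> M0 c0; have M0' : 0 < M%:R :> R by rewrite ltr0n.
have Mc : 0 < M%:R * c by rewrite mulr_gt0.
have [||a ha] := @diameter_itv
  [set t | 0 < t < 1 /\ Num.truncn (M%:R * (c * g t)) = k] (32 / (M%:R * c)).
- by rewrite divr_ge0// ltW.
- move=> x y [/andP[x0 x1] ex] [/andP[y0 y1] ey] xy.
  have := g_lower_lipschitz x0 xy y1.
  have hx : 0 <= M%:R * (c * g x).
    by rewrite mulrA mulr_ge0 ?(ltW Mc)// ltW// g_gt0// x0.
  have hy : 0 <= M%:R * (c * g y).
    by rewrite mulrA mulr_ge0 ?(ltW Mc)// ltW// g_gt0// y0.
  have := truncn_itv hx; have := truncn_itv hy; rewrite ex ey -natr1.
  move=> /andP[p1 p2] /andP[p3 p4] lip.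
  rewrite ler_pdivlMr//.
  have : (g x - g y) * (M%:R * c) <= 1 by lra.
  have : (y - x) / 32 * (M%:R * c) <= (g x - g y) * (M%:R * c) by rewrite ler_pM2r.
  lra.
by exists a => t t01 et; apply: ha.
Qed.

Lemma g_grid M (e : R) : (0 < M)%N -> 0 < e ->
  exists (C : finType) (bx : C -> R * R) (bad : pred C),
  [/\ forall c c' t, box1 (bx c) t -> box1 (bx c') t -> c = c',
      forall t : R, t \in `]0, 1[ -> exists c, box1 (bx c) t,
      \sum_(c | bad c) vol1 (bx c) <= e &
      forall c, ~~ bad c -> box1 (bx c) `<=` [set` `]0, 1[] /\
        exists k, forall t, box1 (bx c) t -> Num.truncn (M%:R * g t) = k].
Proof.
move=> M0 e0; have C0 : 0 < (M.+1)%:R :> R by [].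
have M0' : 0 < M%:R :> R by rewrite ltr0n.
have [N N0 hN] := small_inverse (divr_gt0 e0 C0).
have N0' : 0 < N%:R :> R by rewrite ltr0n.
pose f i := Num.truncn (M%:R * g (i%:R / N%:R : R)).
have itv (i : nat) : (i <= N)%N -> (0 : R) <= i%:R / N%:R <= (1 : R).
  by move=> iN; rewrite divr_ge0//= ler_pdivrMr// mul1r ler_nat.
have fS (i : nat) : (i < N)%N -> (f i.+1 <= f i)%N.
  move=> iN; apply: le_truncn; rewrite ler_pM2l//; apply: g_nonincreasing.
  - by have /andP[] := itv i (ltnW iN).
  - by rewrite ler_pM2r ?invr_gt0// ler_nat.
  - by have /andP[] := itv i.+1 iN.
exists 'I_N, (fun i : 'I_N => unit_cell R N i),
  (* Cell 0 contains the point 0, which is outside ]0, 1[. On a cell without jump, monotonicity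
     makes the index constant. At most M + 1 of the N cells are bad. *)
  (fun i : 'I_N => (i == 0%N :> nat) || (f i != f i.+1)).
split.
- move=> i j t hi hj; apply/val_inj => /=.
  by rewrite -(unit_cell_truncn N0 hi) -(unit_cell_truncn N0 hj).
- by move=> t; rewrite in_itv /= => t01; apply: unit_cell_cover.
- under eq_bigr do rewrite vol_unit_cell.
  rewrite sumr_const -[leLHS]mulr_natr mulrC ler_pdivrMr//.
  apply: (@le_trans _ _ M.+1%:R); last first.
    by rewrite ltr_pdivlMr// mulrC ltr_pdivrMr// in hN; apply: ltW.
  rewrite ler_nat -sum1_card big_mkcond /=.
  apply: (@leq_trans (\sum_(i < N) ((i == 0%N :> nat) + (f i != f i.+1)))).
    by apply: leq_sum => i _; case: ifP => //; rewrite unfold_in => /orP[] -> //; rewrite addn1.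
  rewrite big_split /= -add1n; apply: leq_add.
    case: N N0 {hN N0' f itv fS} => // N' _.
    by rewrite big_ord_recl big1.
  apply: count_jumps1 => //; rewrite /f mul0r g0 mulr1 -ltnS truncn_lt_nat//.
  by rewrite ltr_nat.
- move=> i; rewrite negb_or negbK => /andP[i0 /eqP fi]; split.
    move=> t /unit_cell_itv[h1 h2 h3 h4]; rewrite /= in_itv /=; apply/andP; split.
      by apply: lt_le_trans h1; rewrite divr_gt0// ltr0n lt0n.
    exact: lt_le_trans h2 h4.
  exists (f i) => t /unit_cell_itv[h1 h2 h3 h4]; apply/eqP; rewrite eqn_leq.
  apply/andP; split.
    apply: le_truncn; rewrite ler_pM2l//; apply: g_nonincreasing => //.
    exact: le_trans (ltW h2) h4.
  rewrite fi; apply: le_truncn; rewrite ler_pM2l//; apply: g_nonincreasing => //.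
    exact: le_trans h3 h1.
  exact: ltW.
Qed.

Lemma G_grid M (e : R) : (0 < M)%N -> 0 < e ->
  exists (C : finType) (bx : C -> (R * R) * (R * R)) (bad : pred C),
  [/\ forall c c' t, box2 (bx c) t -> box2 (bx c') t -> c = c',
      forall t : R * R, (`]0, 1[ `*` `]0, 1[) t -> exists c, box2 (bx c) t,
      \sum_(c | bad c) vol2 (bx c) <= e &
      forall c, ~~ bad c -> (box2 (bx c) `<=` (`]0, 1[ `*` `]0, 1[)) /\
        exists k, forall t, box2 (bx c) t -> Num.truncn (M%:R * G t) = k].
Proof.
move=> M0 e0; have C0 : 0 < (2 * M.+1)%:R :> R by rewrite ltr0n.
have M0' : 0 < M%:R :> R by rewrite ltr0n.
have [N N0 hN] := small_inverse (divr_gt0 e0 C0).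
have N0' : 0 < N%:R :> R by rewrite ltr0n.
(* Clamping at N makes the array [f2] bounded and monotone for all natural indices. *)
pose x (i : nat) : R := (minn i N)%:R / N%:R.
pose f2 (i j : nat) := Num.truncn (M%:R * (g (x i) * g (x j))).
have xE i : (i <= N)%N -> x i = i%:R / N%:R by move=> iN; rewrite /x (minn_idPl iN).
have x01 i : 0 <= x i <= 1.
  by rewrite divr_ge0//= ler_pdivrMr// mul1r ler_nat geq_minr.
have xS i : x i <= x i.+1.
  by rewrite ler_pM2r ?invr_gt0// ler_nat; rewrite leq_min geq_minr; lia.
have g01 t : 0 <= t <= 1 -> 0 <= g t :> R by move=> /g_bounds/andP[].
have gg (a b c d : R) : 0 <= a -> a <= c -> c <= 1 -> 0 <= b -> b <= d -> d <= 1 ->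
    (Num.truncn (M%:R * (g c * g d)) <= Num.truncn (M%:R * (g a * g b)))%N.
  move=> a0 ac c1 b0 bd d1; apply: le_truncn; rewrite ler_pM2l//.
  apply: ler_pM; rewrite ?g_nonincreasing// g01//.
    by rewrite (le_trans a0 ac).
  by rewrite (le_trans b0 bd).
have fS i j : (f2 i.+1 j.+1 <= f2 i j)%N.
  by apply: gg => //; case/andP: (x01 i) (x01 i.+1) (x01 j) (x01 j.+1)
    => h1 h2 /andP[h3 h4] /andP[h5 h6] /andP[h7 h8].
have fM i j : (f2 i j <= M)%N.
  rewrite -ltnS truncn_lt_nat; last by rewrite !mulr_ge0 ?g01.
  apply: (@le_lt_trans _ _ (M%:R * 1)); last by rewrite mulr1 ltr_nat.
  rewrite ler_pM2l// mulr_ile1 ?g01//.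
    by case/andP: (g_bounds (x01 i)).
  by case/andP: (g_bounds (x01 j)).
exists ('I_N * 'I_N)%type, (fun c : 'I_N * 'I_N => (unit_cell R N c.1, unit_cell R N c.2)),
  (* G is monotone in each variable, so its extremes on a cell are at two opposite corners. The bad
     cells number at most 2 N + 2 N M out of N^2. *)
  (fun c : 'I_N * 'I_N => [|| c.1 == 0%N :> nat, c.2 == 0%N :> nat | f2 c.1 c.2 != f2 c.1.+1 c.2.+1]).
split.
- move=> [i1 i2] [j1 j2] [t1 t2] [/= h1 h2] [/= h3 h4].
  congr pair; apply/val_inj => /=.
    by rewrite -(unit_cell_truncn N0 h1) -(unit_cell_truncn N0 h3).
  by rewrite -(unit_cell_truncn N0 h2) -(unit_cell_truncn N0 h4).
- move=> [t1 t2] [/=]; rewrite !in_itv /= => h1 h2.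
  have [i hi] := unit_cell_cover N0 h1; have [j hj] := unit_cell_cover N0 h2.
  by exists (i, j).
- under eq_bigr do rewrite /vol2 /= !vol_unit_cell.
  rewrite sumr_const -[leLHS]mulr_natr -invfM mulrC ler_pdivrMr ?mulr_gt0//.
  apply: (@le_trans _ _ ((2 * M.+1 * N)%:R)); last first.
    rewrite natrM mulrA ler_pM2r//.
    by rewrite ltr_pdivlMr// mulrC ltr_pdivrMr// in hN; apply: ltW.
  rewrite ler_nat -sum1_card big_mkcond /=.
  apply: (@leq_trans (\sum_(i < N) \sum_(j < N)
     ((i == 0%N :> nat) + (j == 0%N :> nat) + (f2 i j != f2 i.+1 j.+1)))).
    rewrite pair_bigA /=; apply: leq_sum => -[i j] _ /=; case: ifP => //.
    by rewrite unfold_in /= => /or3P[] ->; rewrite ?addn1 ?add1n.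
  have s0 : (\sum_(i < N) (i == 0%N :> nat) = 1)%N.
    case: N N0 {hN N0' f2 x xE x01 xS fS fM} => // N' _.
    by rewrite big_ord_recl big1.
  have -> : (\sum_(i < N) \sum_(j < N)
     ((i == 0%N :> nat) + (j == 0%N :> nat) + (f2 i j != f2 i.+1 j.+1)) =
     (N + N) + \sum_(i < N) \sum_(j < N) (f2 i j != f2 i.+1 j.+1))%N.
    under eq_bigr do rewrite !big_split /= s0 sum_nat_const card_ord.
    by rewrite !big_split /= -big_distrr /= s0 muln1 sum_nat_const card_ord muln1.
  have := @count_jumps2 f2 N M fM (fun i j _ _ => fS i j); lia.
- move=> [i j] /=; rewrite !negb_or negbK => /and3P[i0 j0 /eqP fij]; split.
    move=> [t1 t2] [/= /unit_cell_itv[h1 h2 h3 h4] /unit_cell_itv[k1 k2 k3 k4]].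
    rewrite /= !in_itv /=; split; apply/andP; split.
    + by apply: lt_le_trans h1; rewrite divr_gt0// ltr0n lt0n.
    + exact: lt_le_trans h2 h4.
    + by apply: lt_le_trans k1; rewrite divr_gt0// ltr0n lt0n.
    + exact: lt_le_trans k2 k4.
  exists (f2 i j) => -[t1 t2] [/= /unit_cell_itv[h1 h2 h3 h4] /unit_cell_itv[k1 k2 k3 k4]].
  rewrite /G /=; apply/eqP; rewrite eqn_leq; apply/andP; split.
    rewrite /f2 !xE ?(ltnW (ltn_ord _))//.
    apply: gg => //; [exact: le_trans (ltW h2) h4|exact: le_trans (ltW k2) k4].
  rewrite fij /f2 !xE ?ltn_ord//.
  apply: gg => //; [exact: le_trans h3 h1|exact: ltW|exact: le_trans k3 k1|exact: ltW].
Qed.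

End GridCells.

(** * Irrational angles *)

Section IrrationalIndex.
Variable R : realType.
Local Notation ratio := (density_ratio R).

Lemma rotation_box_upper (alpha : R) b (e : R) : 0 <= alpha -> irrational alpha ->
  0 < e -> \forall n \near \oo,
    frequency R [set k | box1 b (rotation alpha k.-1)] n <= vol1 b + e.
Proof.
move=> a0 ira e0; have [h|h] := leP b.2 b.1.
  apply: nearW => n.
  rewrite (_ : [set k | _] = set0); last first.
    apply/seteqP; split => // k /=; rewrite /box1 /= in_itv /= => /andP[h1 h2].
    by have := le_lt_trans h1 h2; rewrite ltNge h.
  rewrite /frequency /counting big1 ?mul0r ?addr_ge0 ?(ltW e0)// /vol1 ?le_max ?lexx//.
  by move=> i _; case: asboolP.
have := rotation_upper a0 ira e0; apply: filterS => n /(_ b.1 b.2 (ltW h)).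
rewrite /vol1 max_r ?subr_ge0 ?(ltW h)//; apply: le_trans.
rewrite -!ratio_fst; apply: ratio_le => nm /=.
by rewrite /box1 /= in_itv /= => /andP[-> /ltW ->].
Qed.

Lemma rotation_box_lower (alpha : R) b (e : R) : 0 <= alpha -> irrational alpha ->
  0 < e -> box1 b `<=` [set` `]0, 1[] -> \forall n \near \oo,
    vol1 b - e <= frequency R [set k | box1 b (rotation alpha k.-1)] n.
Proof.
move=> a0 ira e0 bU; have [h|h] := leP b.2 b.1.
  apply: nearW => n; rewrite /vol1 max_l ?subr_le0//.
  by apply: (@le_trans _ _ 0); [lra|rewrite divr_ge0].
have b1 : box1 b b.1 by rewrite /box1 /= in_itv /= lexx.
have /bU := b1; rewrite /= in_itv /= => /andP[b10 b11].
have b2 : b.2 <= 1.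
  rewrite leNgt; apply/negP => b21.
  have /bU : box1 b 1 by rewrite /box1 /= in_itv /= (ltW b11).
  by rewrite /= in_itv /= ltxx andbF.
have := rotation_lower a0 ira e0; apply: filterS => n /(_ b.1 b.2 (ltW b10) (ltW h) b2).
by rewrite /vol1 max_r ?subr_ge0 ?(ltW h).
Qed.

Lemma index_irrational1 (alpha : R) (p : nat * nat -> R) (z : nat -> nat -> R) A :
  0 <= alpha -> irrational alpha ->
  (forall (S : set R) n, ratio [set nm | S (p nm)] n =
     frequency R [set k | S (rotation alpha k.-1)] n) ->
  (exists N1, forall n m, (N1 <= n)%N -> (N1 <= m)%N -> 0 < p (n, m) < 1) ->
  (forall e : R, 0 < e -> exists N0, forall n m,
    (N0 <= n)%N -> (N0 <= m)%N -> `|z n m - g (p (n, m))| < e) ->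
  PJ_measurable1 A -> PJ_measure1 (g_preimage A) (index_set z A).
Proof.
move=> a0 ira hp pin zc PA.
apply: (@jordan_index R R (R * R) (@box1 R) (@vol1 R) [set` `]0, 1[] p (@g R) z) => //.
- by move=> b; rewrite /vol1 le_max lexx.
- move=> b e e0; have := rotation_box_upper b a0 ira e0.
  by apply: filterS => n; rewrite hp.
- move=> b e e0 bU; have := rotation_box_lower a0 ira e0 bU.
  by apply: filterS => n; rewrite hp.
- by move=> t; rewrite /= in_itv /= => t01; rewrite g_gt0// g_lt1.
(* A cell of values is visited with frequency at most 32/M + e/(2M): the first part over rho M cells
   gives e/2, the second over at most M cells gives e/2. *)
- move=> e e0; exists (e / 64); first by rewrite divr_gt0.
  move=> M B M0 hB; have M0' : 0 < M%:R :> R by rewrite ltr0n.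
  have e' : 0 < e / (2 * M%:R) by rewrite divr_gt0// mulr_gt0.
  have := rotation_upper a0 ira e'; apply: filterS => n hn.
  apply: (@le_trans _ _ (\sum_(k in B)
    ratio [set nm | 0 < p nm < 1 /\ Num.truncn (M%:R * g (p nm)) = k] n)).
    apply: ratio_bigcup => nm [/=]; rewrite in_itv /= => pU [k kB ek].
    by exists k.
  have hk (k : 'I_M) : ratio [set nm | 0 < p nm < 1 /\
      Num.truncn (M%:R * g (p nm)) = k] n <= 32 / M%:R + e / (2 * M%:R).
    have [a ha] := @g_cell R M 1 k M0 ltr01.
    apply: (@le_trans _ _ (ratio [set nm | a <= p nm <= a + 32 / M%:R] n)).
      by apply: ratio_le => nm [p01 ek]; have := ha _ p01; rewrite mul1r mulr1; apply.
    rewrite (hp [set t | a <= t <= a + 32 / M%:R]).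
    apply: le_trans (hn _ _ _) _; first by rewrite lerDl divr_ge0.
    by lra.
  apply: le_trans (ler_sum _ (fun k _ => hk k)) _.
  rewrite sumr_const -[leLHS]mulr_natr.
  apply: (@le_trans _ _ ((32 / M%:R + e / (2 * M%:R)) * #|B|%:R)) => //.
  have BM : #|B|%:R <= M%:R :> R by rewrite ler_nat -[leqRHS]card_ord max_card.
  rewrite mulrDl.
  have h1 : 32 / M%:R * #|B|%:R <= e / 2.
    apply: le_trans (ler_wpM2l _ hB) _; first by rewrite divr_ge0.
    have -> : 32 / M%:R * (e / 64 * M%:R) = e / 2 by field; rewrite gt_eqF.
    by [].
  have h2 : e / (2 * M%:R) * #|B|%:R <= e / 2.
    apply: le_trans (ler_wpM2l (ltW e') BM) _.
    have -> : e / (2 * M%:R) * M%:R = e / 2 by field; rewrite gt_eqF.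
    by [].
  lra.
- by move=> M e; exact: g_grid.
Qed.

Lemma index_irrational2 (alpha beta : R) (z : nat -> nat -> R) A :
  0 <= alpha -> irrational alpha -> 0 <= beta -> irrational beta ->
  (forall e : R, 0 < e -> exists N0, forall n m, (N0 <= n)%N -> (N0 <= m)%N ->
    `|z n m - g (rotation alpha n.-1) * g (rotation beta m.-1)| < e) ->
  PJ_measurable1 A -> PJ_measure2 (G_preimage A) (index_set z A).
Proof.
move=> a0 ira b0 irb zc PA.
pose p (nm : nat * nat) := (rotation alpha nm.1.-1, rotation beta nm.2.-1).
have v0 (b : R * R) : 0 <= vol1 b by rewrite /vol1 le_max lexx.
have hbox b n : ratio [set nm | box2 b (p nm)] n =
    frequency R [set k | box1 b.1 (rotation alpha k.-1)] n *
    frequency R [set k | box1 b.2 (rotation beta k.-1)] n.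
  by rewrite -ratio_prod.
have f0 P n : 0 <= frequency R P n by rewrite divr_ge0.
have f1 P n : frequency R P n <= 1 by rewrite -ratio_fst ratio_le1.
apply: (@jordan_index R (R * R)%type ((R * R) * (R * R))%type (@box2 R) (@vol2 R)
  (`]0, 1[ `*` `]0, 1[) p (@G R) z) => //.
- by move=> b; rewrite mulr_ge0.
(* With e1 <= 1, the product (v1 + e1)(v2 + e1) exceeds v1 v2 by at most e1 (v1 + v2 + 1). *)
- move=> b e e0; pose s : R := vol1 b.1 + vol1 b.2 + 1.
  have s0 : 0 < s by rewrite ltr_wpDl// addr_ge0.
  pose e1 := Num.min 1 (e / s).
  have e10 : 0 < e1 by rewrite lt_min ltr01 divr_gt0.
  apply: (filterS _ (filterI (rotation_box_upper b.1 a0 ira e10)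
    (rotation_box_upper b.2 b0 irb e10))) => n [h1 h2]; rewrite hbox.
  apply: le_trans (ler_pM (f0 _ _) (f0 _ _) h1 h2) _.
  have e1s : e1 * s <= e by rewrite -ler_pdivlMr// ge_min lexx orbT.
  have e11 : e1 * e1 <= e1 by rewrite ler_piMr ?(ltW e10)// ge_min lexx.
  rewrite /vol2; move: e1s e11; rewrite /s; lra.
- move=> b e e0 bU.
  have [b1e|/set0P[t1 bt1]] := eqVneq (box1 b.1) set0.
    apply: nearW => n; rewrite hbox /vol2.
    have -> : vol1 b.1 = 0.
      rewrite /vol1 max_l// subr_le0 leNgt; apply/negP => h.
      have : box1 b.1 b.1.1 by rewrite /box1 /= in_itv /= lexx.
      by rewrite b1e.
    by rewrite mul0r; apply: (@le_trans _ _ 0); [lra|rewrite mulr_ge0].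
  have [b2e|/set0P[t2 bt2]] := eqVneq (box1 b.2) set0.
    apply: nearW => n; rewrite hbox /vol2.
    have -> : vol1 b.2 = 0.
      rewrite /vol1 max_l// subr_le0 leNgt; apply/negP => h.
      have : box1 b.2 b.2.1 by rewrite /box1 /= in_itv /= lexx.
      by rewrite b2e.
    by rewrite mulr0; apply: (@le_trans _ _ 0); [lra|rewrite mulr_ge0].
  have bU1 : box1 b.1 `<=` [set` `]0, 1[].
    by move=> t bt; have [] : (`]0, 1[ `*` `]0, 1[)%classic (t, t2) by exact: bU.
  have bU2 : box1 b.2 `<=` [set` `]0, 1[].
    by move=> t bt; have [] : (`]0, 1[ `*` `]0, 1[)%classic (t1, t) by exact: bU.
  have e2 : 0 < Num.min 1 (e / 2) by rewrite lt_min ltr01 divr_gt0.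
  have e1e : Num.min 1 (e / 2) <= e / 2 by rewrite ge_min lexx orbT.
  have vb2 : vol1 b.2 <= 1.
    have [n hn] := filter_ex (rotation_box_lower b0 irb ltr01 bU2).
    apply/ler_addgt0Pr => h h0.
    have [n' hn'] := filter_ex (rotation_box_lower b0 irb h0 bU2).
    by rewrite lerBlDr in hn'; apply: le_trans hn' _; rewrite lerD2r.
  apply: (filterS _ (filterI (rotation_box_lower a0 ira e2 bU1)
    (rotation_box_lower b0 irb e2 bU2))) => n [h1 h2]; rewrite hbox /vol2.
  set d := Num.min 1 (e / 2) in h1 h2 e1e e2.
  set x := frequency _ _ _ in h1 *; set y := frequency _ _ _ in h2 *.
  have x0 : 0 <= x by exact: f0.
  have x1 : x <= 1 by exact: f1.
  have k1 : x * (vol1 b.2 - y) <= d.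
    have [hy|hy] := leP (vol1 b.2 - y) 0.
      by apply: (@le_trans _ _ 0); [rewrite mulr_ge0_le0|exact: ltW].
    by apply: (@le_trans _ _ (vol1 b.2 - y)); [rewrite ler_piMl// ltW|lra].
  have k2 : vol1 b.2 * (vol1 b.1 - x) <= d.
    have [hy|hy] := leP (vol1 b.1 - x) 0.
      by apply: (@le_trans _ _ 0); [rewrite mulr_ge0_le0|exact: ltW].
    by apply: (@le_trans _ _ (vol1 b.1 - x)); [rewrite ler_piMl// ltW|lra].
  lra.
- exists 2%N => -[|[|n]] [|[|m]] // _ _; split; rewrite /= in_itv /=.
    by rewrite rotation_gt0//=; case/andP: (rotation_itv n.+1 a0).
  by rewrite rotation_gt0//=; case/andP: (rotation_itv m.+1 b0).
- move=> [t1 t2] [/=]; rewrite !in_itv /= => h1 h2; rewrite /G /=.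
  rewrite mulr_gt0 ?g_gt0//=; apply: (@le_lt_trans _ _ (g t1)); last exact: g_lt1.
  by rewrite ler_piMr ?ltW ?g_gt0 ?g_lt1.
- move=> e e0.
  (* The strip where the first rotation is at least 1 - d costs at most d + e/4 <= e/2; elsewhere
     the factor g is at least g(1 - d) > 0. The bound 1/2 keeps 1 - d inside ]0, 1[. *)
  pose d : R := Num.min (e / 4) 2^-1.
  have d0 : 0 < d by rewrite lt_min divr_gt0//= invr_gt0.
  have d1 : d <= e / 4 by rewrite ge_min lexx.
  have d2 : d <= 2^-1 by rewrite ge_min lexx orbT.
  have gd : 0 < g (1 - d) by apply: g_gt0; lra.
  (* rho M cells, each of row frequency at most 32 / (M g(1 - d)) plus an error, contribute e/4; the
     errors e/(4M) over at most M cells give another e/4. *)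
  exists (e * g (1 - d) / 128); first by rewrite divr_gt0// mulr_gt0.
  move=> M B M0 hB; have M0' : 0 < M%:R :> R by rewrite ltr0n.
  have e' : 0 < e / (4 * M%:R) by rewrite divr_gt0// mulr_gt0.
  have e4 : 0 < e / 4 by rewrite divr_gt0.
  apply: (filterS _ (filterI (rotation_upper a0 ira e4)
    (rotation_upper b0 irb e'))) => n [hn1 hn2].
  pose K (k : 'I_M) := [set nm : nat * nat | 0 < (p nm).1 < 1 - d /\ 0 < (p nm).2 < 1 /\
     Num.truncn (M%:R * G (p nm)) = k].
  apply: (@le_trans _ _ (ratio ([set nm | 1 - d <= rotation alpha nm.1.-1 <= 1] `|`
    [set nm | exists2 k, k \in B & K k nm]) n)).
    apply: ratio_le => -[i j] [[/=]]; rewrite !in_itv /= => /andP[h0 h1] h2 [k kB ek].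
    have [h|h] := leP (1 - d) (rotation alpha i.-1); first by left; apply/andP; split => //; apply: ltW.
    by right; exists k => //; rewrite /K /= h0 h.
  apply: le_trans (ratio_setU R _ _ _) _.
  have r1 : ratio [set nm | 1 - d <= rotation alpha nm.1.-1 <= 1] n <= e / 2.
    rewrite (ratio_fst R [set k | 1 - d <= rotation alpha k.-1 <= 1]).
    by apply: le_trans (hn1 _ _ _) _; lra.
  have hk (k : 'I_M) : ratio (K k) n <= 32 / (M%:R * g (1 - d)) + e / (4 * M%:R).
    have c0 : 0 <= 32 / (M%:R * g (1 - d)) + e / (4 * M%:R).
      by rewrite addr_ge0 ?(ltW e')// divr_ge0// mulr_ge0 ?(ltW gd).
    apply: ratio_rows => // i.
    have [hi|hi] := pselect (0 < rotation alpha i.-1 < 1 - d); last first.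
      rewrite /frequency /counting big1 ?mul0r// => j _.
      by case: asboolP => // -[]; contradiction.
    have /andP[hi0 hi1] := hi.
    have gi : g (1 - d) <= g (rotation alpha i.-1).
      by apply: g_nonincreasing; [exact: ltW|exact: ltW|lra].
    have gi0 := lt_le_trans gd gi.
    have [a ha] := @g_cell R M (g (rotation alpha i.-1)) k M0 gi0.
    apply: (@le_trans _ _ (frequency R [set m | a <= rotation beta m.-1 <=
        a + 32 / (M%:R * g (rotation alpha i.-1))] n)).
      rewrite -!ratio_snd; apply: ratio_le => nm [_ [h ek]].
      by apply: ha.
    apply: le_trans (hn2 _ _ _) _.
      by rewrite lerDl divr_ge0// mulr_ge0// ltW.
    rewrite [_ + _ - _]addrAC subrr add0r lerD2r ler_pM2l// lef_pV2 ?posrE ?mulr_gt0//.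
    by rewrite ler_pM2l.
  have r2 : ratio [set nm | exists2 k, k \in B & K k nm] n <= e / 2.
    apply: (@le_trans _ _ (\sum_(k in B) ratio (K k) n)).
      by apply: ratio_bigcup => nm [k kB Kk]; exists k.
    apply: le_trans (ler_sum _ (fun k _ => hk k)) _.
    rewrite sumr_const -[leLHS]mulr_natr.
    apply: (@le_trans _ _ ((32 / (M%:R * g (1 - d)) + e / (4 * M%:R)) * #|B|%:R)) => //.
    have BM : #|B|%:R <= M%:R :> R by rewrite ler_nat -[leqRHS]card_ord max_card.
    have n1 : M%:R != 0 :> R by rewrite gt_eqF.
    have n2 : g (1 - d) != 0 by rewrite gt_eqF.
    rewrite mulrDl.
    have h1 : 32 / (M%:R * g (1 - d)) * #|B|%:R <= e / 4.
      apply: le_trans (ler_wpM2l _ hB) _; first by rewrite divr_ge0// mulr_ge0// ltW.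
      have -> // : 32 / (M%:R * g (1 - d)) * (e * g (1 - d) / 128 * M%:R) = e / 4.
      by move: (g (1 - d)) (M%:R : R) n1 n2 => u v n1 n2; field; rewrite n1 n2.
    have h2 : e / (4 * M%:R) * #|B|%:R <= e / 4.
      apply: le_trans (ler_wpM2l (ltW e') BM) _.
      have -> // : e / (4 * M%:R) * M%:R = e / 4.
      by move: (M%:R : R) n1 => v n1; field; rewrite n1.
    lra.
  lra.
- by move=> M e; exact: G_grid.
Qed.

End IrrationalIndex.

(** * The operator applied to a step function *)

Section StepOperator.
Variable R : realType.
Implicit Types (n m : nat) (x y : R).

Definition step_op n x0 x : R :=
  \sum_(i < n | x0 <= node R n i) fundamental i x.

Lemma Lagrange_op_step n m x0 y0 x y :
  Lagrange_op n m (step x0 y0) (x, y) = step_op n x0 x * step_op m y0 y.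
Proof.
rewrite /Lagrange_op /step_op mulr_suml [RHS]big_mkcond; apply: eq_bigr => i _.
rewrite /step /=; case: ifP => hi; last first.
  rewrite big1// => j _; rewrite indicE memNset ?mulr0// => -[/=].
  by rewrite in_itv /= hi.
rewrite mulr_sumr [RHS]big_mkcond; apply: eq_bigr => j _; rewrite indicE.
case: ifP => hj; last first.
  by rewrite memNset ?mulr0// => -[/= _]; rewrite in_itv /= hj.
by rewrite mem_set ?mulr1//=; rewrite !in_itv /= hi hj !cos_le1.
Qed.

Section OneVariable.
Variables (x0 theta0 : R).
Hypotheses (htheta0 : 0 < theta0 < pi) (hx0 : x0 = cos theta0).
Let alpha := theta0 / pi.

Lemma angle_ratio : 0 < alpha < 1.
Proof.
have /andP[t0 t1] := htheta0; have p0 := pi_gt0 R.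
by rewrite /alpha divr_gt0//= ltr_pdivrMr// mul1r.
Qed.

Let cut N := Num.truncn (N%:R * alpha).

Lemma cut_lt N : (0 < N)%N -> (cut N < N)%N.
Proof.
move=> N0; have /andP[a0 a1] := angle_ratio; have N0' : 0 < N%:R :> R by rewrite ltr0n.
rewrite /cut truncn_lt_nat; last by rewrite mulr_ge0// ltW.
by rewrite gtr_pMr.
Qed.

Lemma node_ge_cut N i : (0 < N)%N -> (i <= N)%N ->
  (x0 <= node R N.+1 i) = (i <= cut N)%N.
Proof.
move=> N0 iN; have N0' : 0 < N%:R :> R by rewrite ltr0n.
have /andP[t0 t1] := htheta0; have p0 := pi_gt0 R.
have /andP[a0 a1] := angle_ratio.
have ht : 0 <= theta0 <= pi by rewrite !ltW.
rewrite leNgt hx0 /node /= ltr_cos ?in_itv /= ?angle_bounds//.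
rewrite -leNgt /cut truncn_ge_nat; last by rewrite mulr_ge0// ltW.
by rewrite -ler_pdivlMr// ler_pdivrMr// mulrC.
Qed.

Lemma step_op_lsum N x : (0 < N)%N -> step_op N.+1 x0 x = lsum N (cut N) x.
Proof.
move=> N0; apply: eq_bigl => i; apply: node_ge_cut => //.
by rewrite -ltnS.
Qed.

Lemma theta_cut N : (0 < N)%N ->
  theta0 = ((cut N)%:R + rotation alpha N) / N%:R * pi.
Proof.
move=> N0; have N1 : N%:R != 0 :> R by rewrite pnatr_eq0 -lt0n.
have p0 : pi != 0 :> R by rewrite gt_eqF// pi_gt0.
rewrite /rotation addrCA subrr addr0 /alpha.
move: (N%:R : R) (pi : R) N1 p0 => v w N1 p0.
by field; rewrite N1 p0.
Qed.

Lemma step_op_bounded n x : (1 < n)%N -> -1 <= x <= 1 -> `|step_op n x0 x| <= 5.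
Proof.
case: n => [|[|n]]// _ hx; rewrite step_op_lsum//.
rewrite -[x]acosK; last by rewrite in_itv.
by apply: lsum_le5; rewrite ?cut_lt// acos_ge0// acos_lepi.
Qed.

Lemma step_op_below n x d : (1 < n)%N -> -1 <= x <= 1 -> 0 < d -> x <= x0 - d ->
  `|step_op n x0 x| <= (n.-1%:R * d)^-1.
Proof.
case: n => [|[|n]]// _ hx d0 xd; rewrite step_op_lsum//.
rewrite -[x]acosK; last by rewrite in_itv.
apply: lsum_far_below => //; first exact: cut_lt.
  by rewrite acos_ge0// acos_lepi.
rewrite acosK; last by rewrite in_itv.
have : x0 <= node R n.+2 (cut n.+1) by rewrite node_ge_cut// ltnW// cut_lt.
by move: xd; lra.
Qed.

Lemma step_op_above n x d : (1 < n)%N -> -1 <= x <= 1 -> 0 < d -> x0 + d <= x ->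
  `|step_op n x0 x - 1| <= (n.-1%:R * d)^-1.
Proof.
case: n => [|[|n]]// _ hx d0 xd; rewrite step_op_lsum//.
rewrite -[x]acosK; last by rewrite in_itv.
apply: lsum_far_above => //; first exact: cut_lt.
  by rewrite acos_ge0// acos_lepi.
rewrite acosK; last by rewrite in_itv.
have : node R n.+2 (cut n.+1).+1 < x0.
  by rewrite ltNge node_ge_cut ?ltnn//; apply: cut_lt.
by move: xd; lra.
Qed.

(** J is chosen first so that the truncation error 2/J is below e/2; then n is large enough for the
    kernel error C/n and for the cut to exceed J. *)
Lemma step_op_at_jump (e : R) : 0 < e -> exists N0, forall n, (N0 <= n)%N ->
  `|step_op n x0 x0 - g (rotation alpha n.-1)| < e.
Proof.
move=> e0; have /andP[a0 a1] := angle_ratio.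
have st : 0 < sin theta0 by exact: sin_gt0_pi.
have e4 : 0 < e / 4 by rewrite divr_gt0.
have [J J0 hJ] := small_inverse e4.
have J0' : 0 < J%:R :> R by rewrite ltr0n.
pose C : R := J.+1%:R * (4 / sin theta0).
have C0 : 0 < C by rewrite mulr_gt0// divr_gt0.
have e2 : 0 < e / 2 / C by rewrite !divr_gt0.
have [N1 N10 hN1] := small_inverse e2.
have aJ : 0 < alpha / J.+2%:R by rewrite divr_gt0.
have [N2 N20 hN2] := small_inverse aJ.
exists (maxn N1 N2).+1 => -[//|n]; rewrite ltnS geq_max => /andP[nN1 nN2] /=.
have n0 : (0 < n)%N := leq_trans N10 nN1.
have n0' : 0 < n%:R :> R by rewrite ltr0n.
have kn := cut_lt n0; rewrite step_op_lsum//.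
have th := theta_cut n0; set k := cut n in kn th *; set s := rotation alpha n in th *.
have /andP[s0 s1] : 0 <= s < 1 by apply: rotation_itv; exact: ltW.
(* If s = 0 the jump is itself a node and the sum is exactly 1, which accounts for the convention
   g(0) = 1. *)
have [sz|snz] := eqVneq s 0.
  have xk : x0 = node R n.+1 k by rewrite hx0 th sz addr0.
  rewrite /lsum xk (bigD1 (Ordinal (ltnW kn : (k < n.+1)%N)))//=.
  rewrite -[k in node R n.+1 k]/(val (Ordinal (ltnW kn : (k < n.+1)%N))).
  rewrite fundamental_node// eqxx big1 ?addr0; last first.
    by move=> i /andP[_ ik]; rewrite fundamental_node// (negbTE ik).
  by rewrite sz g0 subrr normr0.
have hs : 0 < s < 1 by rewrite lt_neqAle eq_sym snz s0.
have Jk : (0 < J < k)%N.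
  rewrite J0 /= /k /cut truncn_gt_nat.
  have := inverse_nat_lt N20 nN2 hN2; rewrite ltr_pdivlMr// mulrC ltr_pdivrMr// => h.
  have : J.+1%:R <= J.+2%:R :> R by rewrite ler_nat.
  by rewrite mulrC; move: h; lra.
have := lsum_g kn hs Jk th; rewrite -hx0 => h; apply: le_lt_trans h _.
have h1 : C / n%:R < e / 2.
  rewrite mulrC -ltr_pdivlMr//; exact: inverse_nat_lt N10 nN1 hN1.
have h2 : 2 / J%:R < e / 2 by move: hJ; lra.
by rewrite -/C; move: h1 h2; lra.
Qed.

End OneVariable.

Section TwoVariables.
Variables (x0 y0 theta0 gamma0 : R).
Hypotheses (htheta0 : 0 < theta0 < pi) (hgamma0 : 0 < gamma0 < pi).
Hypotheses (hx0 : x0 = cos theta0) (hy0 : y0 = cos gamma0).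
Local Notation L := (fun x y n m => Lagrange_op n m (step x0 y0) (x, y)).
Let alpha := theta0 / pi.
Let beta := gamma0 / pi.

Let x0_itv : -1 <= x0 <= 1. Proof. by rewrite hx0 cos_geN1 cos_le1. Qed.
Let y0_itv : -1 <= y0 <= 1. Proof. by rewrite hy0 cos_geN1 cos_le1. Qed.
Let alpha_ge0 : 0 <= alpha. Proof. by case/andP: (angle_ratio htheta0) => /ltW. Qed.
Let beta_ge0 : 0 <= beta. Proof. by case/andP: (angle_ratio hgamma0) => /ltW. Qed.

Lemma g_rotation_itv (a : R) i : 0 <= a -> 0 <= g (rotation a i) <= 1.
Proof.
move=> a0; have /andP[h0 h1] := rotation_itv i a0.
by apply: g_bounds; rewrite h0 ltW.
Qed.

(** 5 is the uniform bound of the one-variable operators and 1 that of the limits; 5 e/10 + e/10 <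
    e. *)
Lemma mul_close (a b c d e : R) : 0 < e -> `|a| <= 5 -> `|d| <= 1 ->
  `|a - c| < e / 10 -> `|b - d| < e / 10 -> `|a * b - c * d| < e.
Proof.
move=> e0 a5 d1 ac bd; have -> : a * b - c * d = a * (b - d) + (a - c) * d by ring.
apply: le_lt_trans (ler_normD _ _) _; rewrite !normrM.
have h1 : `|a| * `|b - d| <= 5 * (e / 10) by apply: ler_pM => //; apply: ltW.
have h2 : `|a - c| * `|d| <= `|a - c| by rewrite ler_piMr.
lra.
Qed.

Lemma tends_inverse (d e : R) : 0 < d -> 0 < e ->
  exists N0, forall n, (N0 <= n)%N -> (1 < n)%N /\ (n.-1%:R * d)^-1 < e.
Proof.
move=> d0 e0; have ed : 0 < e * d by rewrite mulr_gt0.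
have [N N0 hN] := small_inverse ed.
exists N.+1 => -[//|n]; rewrite ltnS => Nn /=; split; first exact: leq_trans N0 Nn.
have n0 : 0 < n%:R :> R by rewrite ltr0n (leq_trans N0).
have := inverse_nat_lt N0 Nn hN.
by rewrite invfM ltr_pdivrMr.
Qed.

Lemma close_vertical y : y0 < y <= 1 -> forall e : R, 0 < e ->
  exists N0, forall n m, (N0 <= n)%N -> (N0 <= m)%N ->
    `|L x0 y n m - g (rotation alpha n.-1)| < e.
Proof.
move=> /andP[yy y1] e e0; have e10 : 0 < e / 10 by rewrite divr_gt0.
have d0 : 0 < y - y0 by rewrite subr_gt0.
have [N1 h1] := step_op_at_jump htheta0 hx0 e10.
have [N2 h2] := tends_inverse d0 e10.
exists (maxn N1 N2) => n m; rewrite !geq_max => /andP[nN1 nN2] /andP[mN1 mN2].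
have [n1 _] := h2 n nN2; have [m1 hm] := h2 m mN2.
rewrite Lagrange_op_step -[g _]mulr1; apply: mul_close => //.
- exact: (step_op_bounded htheta0 hx0).
- by rewrite normr1.
- exact: h1.
- apply: le_lt_trans hm; apply: (step_op_above hgamma0 hy0) => //.
    by rewrite y1 andbT; case/andP: y0_itv => h _; apply: le_trans h (ltW yy).
  by rewrite addrC subrK.
Qed.

Lemma close_horizontal x : x0 < x <= 1 -> forall e : R, 0 < e ->
  exists N0, forall n m, (N0 <= n)%N -> (N0 <= m)%N ->
    `|L x y0 n m - g (rotation beta m.-1)| < e.
Proof.
move=> /andP[xx x1] e e0; have e10 : 0 < e / 10 by rewrite divr_gt0.
have d0 : 0 < x - x0 by rewrite subr_gt0.
have [N1 h1] := step_op_at_jump hgamma0 hy0 e10.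
have [N2 h2] := tends_inverse d0 e10.
exists (maxn N1 N2) => n m; rewrite !geq_max => /andP[nN1 nN2] /andP[mN1 mN2].
have [n1 hn] := h2 n nN2; have [m1 _] := h2 m mN2.
rewrite Lagrange_op_step mulrC -[g _]mulr1; apply: mul_close => //.
- exact: (step_op_bounded hgamma0 hy0).
- by rewrite normr1.
- exact: h1.
- apply: le_lt_trans hn; apply: (step_op_above htheta0 hx0) => //.
    by rewrite x1 andbT; case/andP: x0_itv => h _; apply: le_trans h (ltW xx).
  by rewrite addrC subrK.
Qed.

Lemma close_corner (e : R) : 0 < e ->
  exists N0, forall n m, (N0 <= n)%N -> (N0 <= m)%N ->
    `|L x0 y0 n m - g (rotation alpha n.-1) * g (rotation beta m.-1)| < e.
Proof.
move=> e0; have e10 : 0 < e / 10 by rewrite divr_gt0.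
have [N1 h1] := step_op_at_jump htheta0 hx0 e10.
have [N2 h2] := step_op_at_jump hgamma0 hy0 e10.
exists (maxn 2 (maxn N1 N2)) => n m.
rewrite !geq_max => /and3P[n2 nN1 nN2] /and3P[m2 mN1 mN2].
rewrite Lagrange_op_step; apply: mul_close => //.
- exact: (step_op_bounded htheta0 hx0).
- by have /andP[h0 h] := g_rotation_itv m.-1 beta_ge0; rewrite ger0_norm.
- exact: h1.
- exact: h2.
Qed.

(** Compactness gives one margin [r]: every point of K is below the jump by r in some coordinate or
    beyond it by r in both. In the first case one factor tends to 0 and the other is only bounded,
    possibly at its own jump; in the second both tend to 1. *)
Lemma uniform_off_exceptional (K : set (R * R)) : compact K ->
  K `<=` (`[-1, 1] `*` `[-1, 1]) `\` exceptional x0 y0 ->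
  {uniform K, (fun nm : nat * nat => Lagrange_op nm.1 nm.2 (step x0 y0))
     @ filter_prod \oo \oo --> step x0 y0}.
Proof.
move=> cK KQ.
pose P (r : R) (z : R * R) := [\/ z.2 <= y0 - r, z.1 <= x0 - r |
  x0 + r <= z.1 /\ y0 + r <= z.2].
have [r r0 hr] : exists2 r, 0 < r & forall z, K z -> P r z.
  have cov := (compact_near_coveringP K).1 cK R (0^'+) P _.
  have : \forall r \near 0^'+, K `<=` P r.
    apply: cov => -[x y] Kz; have [[/= hx hy] nQ] := KQ _ Kz.
    rewrite !in_itv /= in hx hy.
    have gap rho : 0 < rho -> P (rho *+ 2) (x, y) ->
        \forall z' \near (x, y) & r \near 0^'+, P r z'.
      move=> rho0 Prho; exists (ball (x, y) rho, [set r : R | r < rho]).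
        by split; [exact: nbhsx_ballx|exact: nbhs_right_lt].
      move=> [[x' y'] r] /= [[/= bx by'] rr].
      move: bx by'; rewrite /ball /= !ltr_distl => /andP[b1 b2] /andP[b3 b4].
      case: Prho => /= [h|h|[h1 h2]]; rewrite mulr2n in h * || rewrite mulr2n in h1 h2.
      - by constructor 1 => /=; lra.
      - by constructor 2 => /=; lra.
      - by constructor 3 => /=; split; lra.
    have half (u : R) : u / 2 *+ 2 = u by rewrite mulr2n; lra.
    have [yy|yy] := ltP y y0.
      apply: (gap ((y0 - y) / 2)); first by rewrite divr_gt0// subr_gt0.
      by rewrite half; constructor 1 => /=; lra.
    have [xx|xx] := ltP x x0.
      apply: (gap ((x0 - x) / 2)); first by rewrite divr_gt0// subr_gt0.
      by rewrite half; constructor 2 => /=; lra.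
    have xn : x0 < x.
      rewrite lt_neqAle xx andbT; apply/eqP => xE; apply: nQ; right.
      by split => //=; rewrite in_itv /= yy; case/andP: hy.
    have yn : y0 < y.
      rewrite lt_neqAle yy andbT; apply/eqP => yE; apply: nQ; left.
      by split => //=; rewrite in_itv /= xx; case/andP: hx.
    pose rho := Num.min (x - x0) (y - y0).
    have rho0 : 0 < rho by rewrite lt_min !subr_gt0 xn yn.
    have r1 : rho <= x - x0 by rewrite ge_min lexx.
    have r2 : rho <= y - y0 by rewrite ge_min lexx orbT.
    apply: (gap (rho / 2)); first by rewrite divr_gt0.
    by rewrite half; constructor 3 => /=; split; lra.
  move=> h; have [r [r0 hr]] := filter_ex (filterI (nbhs_right_gt (0 : R)) h).
  by exists r => // z /hr.
move=> W /uniform_nbhs [E [entE EW]].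
have [e e0 he] : exists2 e : R, 0 < e & forall u v : R, `|u - v| < e -> E (u, v).
  move: entE; rewrite -entourage_ballE => -[e /= e0 he].
  by exists e => // u v uv; apply: he.
have e10 : 0 < e / 10 by rewrite divr_gt0.
have [N0 hN0] := tends_inverse r0 e10.
exists ([set n | (N0 <= n)%N], [set m | (N0 <= m)%N]).
  by split; exists N0.
move=> [n m] [/= nN mN]; apply: EW => -[x y] Kz; apply: he.
have [[/= hx hy] _] := KQ _ Kz; rewrite !in_itv /= in hx hy.
have [n1 hn] := hN0 n nN; have [m1 hm] := hN0 m mN.
rewrite distrC Lagrange_op_step.
have ux := step_op_bounded htheta0 hx0 n1 hx.
have uy := step_op_bounded hgamma0 hy0 m1 hy.
have st0 : y < y0 \/ x < x0 -> step x0 y0 (x, y) = 0 * 0.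
  move=> h; rewrite /step indicE memNset ?mul0r// => -[/=]; rewrite !in_itv /=.
  by move=> /andP[h1 _] /andP[h2 _]; case: h => h; [move: h2|move: h1]; rewrite leNgt h.
have [/= h|/= h|[/= h1 h2]] := hr _ Kz.
- rewrite st0; last by left; lra.
  rewrite mul0r -(mulr0 (step_op n x0 x)).
  apply: mul_close => //; rewrite ?normr0// ?subrr ?normr0// subr0.
  by apply: le_lt_trans hm; apply: (step_op_below hgamma0 hy0).
- rewrite st0; last by right; lra.
  rewrite mul0r mulrC -(mulr0 (step_op m y0 y)).
  apply: mul_close => //; rewrite ?normr0// ?subrr ?normr0// subr0.
  by apply: le_lt_trans hn; apply: (step_op_below htheta0 hx0).
- have -> : step x0 y0 (x, y) = 1 * 1.
    rewrite /step indicE mem_set ?mulr1//; split => /=; rewrite in_itv /=; apply/andP.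
      by split; [lra|case/andP: hx].
    by split; [lra|case/andP: hy].
  apply: mul_close => //; rewrite ?normr1//.
    by apply: le_lt_trans hn; apply: (step_op_above htheta0 hx0).
  by apply: le_lt_trans hm; apply: (step_op_above hgamma0 hy0).
Qed.

End TwoVariables.
End StepOperator.

(** * Rational angles *)

Section RationalIndex.
Variable R : realType.
Local Notation ratio := (density_ratio R).

Definition residue (q p : nat) (q0 : (0 < q)%N) (k : nat) : 'I_q :=
  Ordinal (ltn_pmod (k.-1 * p) q0).

Lemma residue_rotation (q p : nat) (q0 : (0 < q)%N) (k : nat) :
  rotation (p%:R / q%:R : R) k.-1 = (residue p q0 k)%:R / q%:R.
Proof. exact: rational_rotation. Qed.

Lemma residue_frequency (q p : nat) (q0 : (0 < q)%N) (j : 'I_q) : coprime p q ->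
  frequency R [set k | residue p q0 k = j] @ \oo --> (q%:R^-1 : R).
Proof.
move=> pq.
have -> : [set k | residue p q0 k = j] = [set k | ((k.-1 * p) %% q)%N = j].
  by apply/seteqP; split => k /= [h]; [rewrite -h|apply/val_inj].
exact: rational_frequency.
Qed.

Lemma single_mass (q : nat) (m1 : nat) : (m1 < q)%N ->
  \sum_(j < q | g (j%:R / q%:R) == g (m1%:R / q%:R) :> R) (q%:R^-1 : R) = 1 / q%:R.
Proof.
move=> mq; have q0 : 0 < q%:R :> R by rewrite ltr0n (leq_ltn_trans _ mq).
rewrite div1r (big_pred1 (Ordinal mq))// => j.
have itv (i : nat) : (i < q)%N -> 0 <= (i%:R / q%:R : R) < 1.
  by move=> iq; rewrite divr_ge0//= ltr_pdivrMr// mul1r ltr_nat.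
apply/eqP/eqP => [|-> //] h; apply/val_inj => /=.
have := g_injective (itv j (ltn_ord j)) (itv m1 mq) h.
by move=> /(congr1 (fun x => x * q%:R)); rewrite !divfK ?gt_eqF// => /eqP; rewrite eqr_nat => /eqP.
Qed.

(** [c] stands for either coordinate, so one proof serves both edges of Q. The mass 1/q is not
    shared because g is injective on [0, 1[. *)
Lemma index_rational1 (p q : nat) (c : nat * nat -> nat) (z : nat -> nat -> R) m1 :
  (0 < q)%N -> coprime p q ->
  (forall (S : set nat) n, ratio [set nm | S (c nm)] n = frequency R S n) ->
  (forall e : R, 0 < e -> exists N0, forall n m, (N0 <= n)%N -> (N0 <= m)%N ->
    `|z n m - g (rotation (p%:R / q%:R) (c (n, m)).-1)| < e) ->
  (m1 < q)%N -> index_pt z (g (m1%:R / q%:R)) = 1 / q%:R.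
Proof.
move=> q0 pq hc hz mq; rewrite -(single_mass mq).
apply: (@index_pt_classes R 'I_q (fun nm => residue p q0 (c nm))
  (fun j => g (j%:R / q%:R)) z (fun=> q%:R^-1)) => [e e0|j].
  have [N0 hN0] := hz e e0; exists N0 => n m nN mN.
  by rewrite -residue_rotation; apply: hN0.
rewrite (_ : ratio _ = frequency R [set k | residue p q0 k = j]).
  exact: residue_frequency.
by apply/funext => n; rewrite -hc.
Qed.

Lemma index_rational2 (p1 q1 p2 q2 : nat) (z : nat -> nat -> R) v :
  (0 < q1)%N -> coprime p1 q1 -> (0 < q2)%N -> coprime p2 q2 ->
  (forall e : R, 0 < e -> exists N0, forall n m, (N0 <= n)%N -> (N0 <= m)%N ->
    `|z n m - g (rotation (p1%:R / q1%:R) n.-1) *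
              g (rotation (p2%:R / q2%:R) m.-1)| < e) ->
  index_pt z v = \sum_(k : 'I_q1 * 'I_q2 |
    g (k.1%:R / q1%:R) * g (k.2%:R / q2%:R) == v) 1 / (q1 * q2)%:R.
Proof.
move=> q10 pq1 q20 pq2 hz.
apply: (@index_pt_classes R ('I_q1 * 'I_q2)%type
  (fun nm => (residue p1 q10 nm.1, residue p2 q20 nm.2))
  (fun k => g (k.1%:R / q1%:R) * g (k.2%:R / q2%:R)) z
  (fun=> 1 / (q1 * q2)%:R)) => [e e0|[j1 j2]].
  have [N0 hN0] := hz e e0; exists N0 => n m nN mN.
  have := hN0 n m nN mN.
  by rewrite (residue_rotation p1 q10) (residue_rotation p2 q20).
rewrite div1r natrM invfM (_ : ratio _ = fun n =>
  frequency R [set k | residue p1 q10 k = j1] n *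
  frequency R [set k | residue p2 q20 k = j2] n).
  by apply: cvgM; apply: residue_frequency.
apply/funext => n; rewrite -ratio_prod; congr (ratio _ n).
by apply/seteqP; split => nm /= [-> ->].
Qed.

(** On the residue class attached to j, of density 1/q, the terms approach g(j/q) b with b in
    [0, 1], hence points of the interval. *)
Lemma index_mixed (p q : nat) (c : nat * nat -> nat) (b : nat -> nat -> R)
    (z : nat -> nat -> R) (j : nat) :
  (0 < q)%N -> coprime p q ->
  (forall (S : set nat) n, ratio [set nm | S (c nm)] n = frequency R S n) ->
  (forall n m, 0 <= b n m <= 1) ->
  (forall e : R, 0 < e -> exists N0, forall n m, (N0 <= n)%N -> (N0 <= m)%N ->
    `|z n m - g (rotation (p%:R / q%:R) (c (n, m)).-1) * b n m| < e) ->
  (j < q)%N -> 1 / q%:R <= index_set z [set` `[0, g (j%:R / q%:R)]].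
Proof.
move=> q0 pq hc hb hz jq; have q0' : 0 < q%:R :> R by rewrite ltr0n.
pose j' := Ordinal jq.
apply: index_ge => e e0; apply: upper_density_le => eta eta0.
have eta2 : 0 < eta / 2 by rewrite divr_gt0.
have [N0 hN0] := hz e e0.
pose S := [set k | residue p q0 k = j'].
have h1 := @ratio_eventually_le R
  [set nm | ~ enlarge [set` `[0, g (j%:R / q%:R)]] e (z nm.1 nm.2)]
  (~` [set nm | S (c nm)]) N0 _ eta2.
have {}h1 : \forall n \near \oo,
   ratio [set nm | ~ enlarge [set` `[0, g (j%:R / q%:R)]] e (z nm.1 nm.2)] n <=
   ratio (~` [set nm | S (c nm)]) n + eta / 2.
  apply: h1 => n m nN mN /= nz Sc; apply: nz.
  have := hN0 n m nN mN; rewrite residue_rotation Sc /= => hzz.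
  have /andP[b0 b1] := hb n m.
  have /andP[g0' g1'] : 0 <= g (j%:R / q%:R : R) <= 1.
    apply: g_bounds; rewrite divr_ge0//= ler_pdivrMr// mul1r ler_nat ltnW//.
  exists (g (j%:R / q%:R) * b n m).
    by rewrite /= in_itv /= mulr_ge0//= ler_piMr.
  exists (z n m - g (j%:R / q%:R) * b n m); last by rewrite addrC subrK.
  by rewrite /= in_itv /= -ltr_norml.
have /cvgrPdist_le /(_ _ eta2) h2 := @residue_frequency q p q0 j' pq.
near=> n.
have n0 : (0 < n)%N by near: n; exists 1%N.
have k1 : ratio [set nm | ~ enlarge [set` `[0, g (j%:R / q%:R)]] e (z nm.1 nm.2)] n <=
   ratio (~` [set nm | S (c nm)]) n + eta / 2 by near: n.
have k2 : `|q%:R^-1 - frequency R S n| <= eta / 2 by near: n.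
rewrite ratio_setC// (hc S) in k1; rewrite div1r.
move: k2; rewrite ler_distl => /andP[k2 k3]; move: k1 k2 k3; lra.
Unshelve. all: by end_near. Qed.

End RationalIndex.

(* When both angles are rational multiples of pi, each pair (k1, k2) contributes
   the mass 1/(q1 q2) at the value g(k1/q1) g(k2/q2), and the masses of pairs
   giving the same value add up: the index is 1/(q1 q2) exactly when the value
   comes from a single pair.  Coincidences do occur, for instance
   g(0) g(1/2) = g(1/2) g(0) when q1 = q2 = 2, where the index at 1/2 is 1/2. *)
Theorem theorem2p3 (R : realType) (x0 y0 theta0 gamma0 : R)
    (htheta0 : 0 < theta0 < pi) (hgamma0 : 0 < gamma0 < pi)
    (hx0 : x0 = cos theta0) (hy0 : y0 = cos gamma0)
    (hz0 : -1 < x0 < 1 /\ -1 < y0 < 1) :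
  let h := step x0 y0 in
  let L := fun (x y : R) (n m : nat) => Lagrange_op n m h (x, y) in
  (forall K : set (R * R), compact K ->
     K `<=` (`[-1, 1] `*` `[-1, 1]) `\` exceptional x0 y0 ->
     {uniform K, (fun nm : nat * nat => Lagrange_op nm.1 nm.2 h)
                   @ filter_prod \oo \oo --> h})
  /\
  (forall y : R, y0 < y <= 1 ->
     (forall p1 q1 : nat, irreducible_fraction (theta0 / pi) p1 q1 ->
        forall m1 : nat, (m1 < q1)%N ->
        index_pt (L x0 y) (g (m1%:R / q1%:R)) = 1 / q1%:R)
     /\
     (irrational (theta0 / pi) ->
        forall A : set R, PJ_measurable1 A ->
        PJ_measure1 (g_preimage A) (index_set (L x0 y) A)))
  /\
  (forall x : R, x0 < x <= 1 ->
     (forall p2 q2 : nat, irreducible_fraction (gamma0 / pi) p2 q2 ->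
        forall m2 : nat, (m2 < q2)%N ->
        index_pt (L x y0) (g (m2%:R / q2%:R)) = 1 / q2%:R)
     /\
     (irrational (gamma0 / pi) ->
        forall A : set R, PJ_measurable1 A ->
        PJ_measure1 (g_preimage A) (index_set (L x y0) A)))
  /\
  [/\ forall p1 q1 p2 q2 : nat,
        irreducible_fraction (theta0 / pi) p1 q1 ->
        irreducible_fraction (gamma0 / pi) p2 q2 ->
        forall m1 m2 : nat, (m1 < q1)%N -> (m2 < q2)%N ->
        let v := g (m1%:R / q1%:R) * g (m2%:R / q2%:R) in
        index_pt (L x0 y0) v =
          \sum_(k : 'I_q1 * 'I_q2 | g (k.1%:R / q1%:R) * g (k.2%:R / q2%:R) == v)
            1 / (q1 * q2)%:R,
      forall p1 q1 : nat, irreducible_fraction (theta0 / pi) p1 q1 ->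
        irrational (gamma0 / pi) ->
        forall j : nat, (j < q1)%N ->
        index_set (L x0 y0) `[0, g (j%:R / q1%:R)] >= 1 / q1%:R,
      forall p2 q2 : nat, irrational (theta0 / pi) ->
        irreducible_fraction (gamma0 / pi) p2 q2 ->
        forall j : nat, (j < q2)%N ->
        index_set (L x0 y0) `[0, g (j%:R / q2%:R)] >= 1 / q2%:R
    & irrational (theta0 / pi) -> irrational (gamma0 / pi) ->
        forall A : set R, PJ_measurable1 A ->
        PJ_measure2 (G_preimage A) (index_set (L x0 y0) A)].
Proof.
move=> h L.
have /andP[/ltW a0 _] := angle_ratio htheta0.
have /andP[/ltW b0 _] := angle_ratio hgamma0.
split; first by move=> K; apply: uniform_off_exceptional htheta0 hgamma0 hx0 hy0 K.
split.
  move=> y hy; have hz := close_vertical htheta0 hgamma0 hx0 hy0 hy; split.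
    move=> p1 q1 [p0 q0 pq e] m1 mq; rewrite e in hz.
    apply: (@index_rational1 R p1 q1 fst (L x0 y)) => // S n; exact: ratio_fst.
  move=> ira A; apply: (@index_irrational1 R (theta0 / pi)
    (fun nm => rotation (theta0 / pi) nm.1.-1)) => //.
    by move=> S n; rewrite -ratio_fst.
  exists 2%N => -[|[|n]] m // _ _ /=.
  by rewrite rotation_gt0//; case/andP: (rotation_itv n.+1 a0).
split.
  move=> x hx; have hz := close_horizontal htheta0 hgamma0 hx0 hy0 hx; split.
    move=> p2 q2 [p0 q0 pq e] m2 mq; rewrite e in hz.
    apply: (@index_rational1 R p2 q2 snd (L x y0)) => // S n; exact: ratio_snd.
  move=> irb A; apply: (@index_irrational1 R (gamma0 / pi)
    (fun nm => rotation (gamma0 / pi) nm.2.-1)) => //.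
    by move=> S n; rewrite -ratio_snd.
  exists 2%N => n [|[|m]] // _ _ /=.
  by rewrite rotation_gt0//; case/andP: (rotation_itv m.+1 b0).
have hz := close_corner htheta0 hgamma0 hx0 hy0; split.
- move=> p1 q1 p2 q2 [p10 q10 pq1 e1] [p20 q20 pq2 e2] m1 m2 _ _ v.
  by rewrite e1 e2 in hz; apply: index_rational2 hz.
- move=> p1 q1 [p10 q10 pq1 e1] irb j jq; rewrite e1 in hz.
  apply: (@index_mixed R p1 q1 fst (fun _ m => g (rotation (gamma0 / pi) m.-1))) => //.
    by move=> S n; exact: ratio_fst.
  by move=> n m; apply: g_rotation_itv.
- move=> p2 q2 ira [p20 q20 pq2 e2] j jq; rewrite e2 in hz.
  apply: (@index_mixed R p2 q2 snd (fun n _ => g (rotation (theta0 / pi) n.-1))) => //.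
  + by move=> S n; exact: ratio_snd.
  + by move=> n m; apply: g_rotation_itv.
  + by move=> e /hz [N0 hN0]; exists N0 => n m nN mN; rewrite mulrC; apply: hN0.
- by move=> ira irb A PA; exact: index_irrational2 a0 ira b0 irb hz PA.
Qed.
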